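(* Let $\Omega$ be a domain of class $\mathcal C^s$ for some $s\ge1$ and let $u=\chi_\Omega$. The AEROS recovery of the interface based on polynomials of degree $2k$ satisfies for each singular cell $T$ a local error bound of the form $$\|u-R_T(a_S(u))\|_{L^1(T)}\le Ch^{r+1},\qquad r:=\min\{s,2k+1\},$$ and the global error bound $$\|u-\tilde u\|_{L^1(D)}\le Ch^r$$ for the same value of $r$. Here $C$ denotes constants that do not depend on the mesh size $h$ or on the cell $T$.
   Context: **Setting.** $D=[0,1]^2$, $\Omega\subset D$, and $k\ge1$ is a fixed integer. For $h=1/\ell$ with an integer $\ell>1$, $D$ is partitioned into the set $\mathcal T_h$ of square cells of side $h$; the cell of coordinates $(i,j)$ is the one with lower left corner $(ih,jh)$. The data are the cell averages $a_T(u)=\frac1{|T|}\int_T u(x)\,dx$, $T\in\mathcal T_h$. A cell $T$ is singular if $|T\cap\Omega|\neq0$ and $|T\cap\Omega^c|\neq0$; the other cells are regular. **AEROS (Algorithms for Edge Reconstruction using Oriented Stencils) on a singular cell $T$ of coordinates $(i_T,j_T)$.** *Orientation.* Let $T_{\varepsilon_x,\varepsilon_y}$ be the cell obtained by displacing $T$ by $(\varepsilon_xh,\varepsilon_yh)$, with $\varepsilon_x,\varepsilon_y\in\{-1,0,1\}$, and, with cell averages of $u$, set $$H_T=2a_{T_{1,0}}+a_{T_{1,1}}+a_{T_{1,-1}}-(2a_{T_{-1,0}}+a_{T_{-1,1}}+a_{T_{-1,-1}}),$$ $$V_T=2a_{T_{0,1}}+a_{T_{1,1}}+a_{T_{-1,1}}-(2a_{T_{0,-1}}+a_{T_{1,-1}}+a_{T_{-1,-1}}).$$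 The recovered set is searched in the form $y\le p(x)$ if $|V_T|\ge|H_T|$ and $V_T\le0$; $y\ge p(x)$ if $|V_T|\ge|H_T|$ and $V_T>0$; $x\le p(y)$ if $|V_T|<|H_T|$ and $H_T\le0$; $x\ge p(y)$ if $|V_T|<|H_T|$ and $H_T>0$. *Stencil (described for the form $y\le p(x)$).* Let $l^-$ be the smallest $l>0$ such that all cells of coordinates $(i,j_T-l-1)$, $i=i_T-k,\dots,i_T+k$, have average $1$, and $l^+$ the smallest $l>0$ such that all cells of coordinates $(i,j_T+l+1)$, $i=i_T-k,\dots,i_T+k$, have average $0$. The stencil $S=S_T$ consists of the cells $(i,j)$ with $i=i_T-k,\dots,i_T+k$ and $j=j_T-l^-,\dots,j_T+l^+$. Optionally the stencil may also be taken not centered horizontally, with $i=i_T-k^-,\dots,i_T+k^+$, where $k^-,k^+\ge0$, $k^-+k^+=2k$, are selected to minimize the vertical size $1+l^-+l^+$ (with $l^\pm$ relative to these columns); the centered case is $k^-=k^+=k$. *Polynomial.* For each $i=i_T-k^-,\dots,i_T+k^+$ let $a_i(u)=h\sum a_{\tilde T}(u)$, the sum being over the cells $\tilde T\in S_T$ with first coordinate $i$, and let $b_T=(j_T-l^-)h$. Then $p_T$ is the unique univariate polynomial of degree at most $2k$ such that $$\frac1h\int_{ih}^{(i+1)h}p_T(x)\,dx=a_i(u)+b_T,\qquad i=i_T-k^-,\dots,i_T+k^+.$$ With $a_S(u)=(a_{\tilde T}(u))_{\tilde T\in S}$, the recovery on $T$ is $R_T(a_S(u))=\tilde u_T:=\chi_{\{y\le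 p_T(x)\}}$. The three other forms are treated similarly, up to exchange of $x$ and $y$ or change of sign in one of these variables. **Global reconstruction.** On a regular cell $T$ one sets $\tilde u_T=a_T(u)$ (which is $0$ or $1$), and $\tilde u=\sum_{T\in\mathcal T_h}\tilde u_T\chi_T$. **$\mathcal C^s$ domains.** $\Omega\subset\mathbb R^2$ is of class $\mathcal C^s$ if there exist $R>0$, $P>1$ and $M>0$ such that for any $z_0\in\partial\Omega$ there exist an orthonormal system $(e_1,e_2)$ and a function $\psi\in\mathcal C^s([-R,R])$ with $\|\psi\|_{\mathcal C^s}\le M$, taking its values in $[-PR,PR]$, such that $z\in\Omega\iff z_2\le\psi(z_1)$ for any $z=z_0+z_1e_1+z_2e_2$ with $|z_1|\le R$ and $|z_2|\le PR$. Here $\|\psi\|_{\mathcal C^s}=\sup_{0\le j\le\lfloor s\rfloor}\|\psi^{(j)}\|_{L^\infty([-R,R])}+\sup_{x,t\in[-R,R]}|x-t|^{\lfloor s\rfloor-s}|\psi^{(\lfloor s\rfloor)}(x)-\psi^{(\lfloor s\rfloor)}(t)|$ is the usual Hölder norm; for integer $s$, $\mathcal C^s$ denotes by convention the functions with Lipschitz derivatives up to order $s-1$ (so $s=1$ corresponds to Lipschitz boundaries). *)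

(* Defs.v *)
From mathcomp Require Import all_boot all_order all_algebra.
From mathcomp Require Import all_classical all_reals all_analysis.
Set Implicit Arguments.
Unset Strict Implicit.
Unset Printing Implicit Defensive.
Import Order.TTheory GRing.Theory Num.Theory.
Import numFieldNormedType.Exports.
Local Open Scope classical_set_scope.
Local Open Scope ring_scope.

Definition lebesgue_measure2 {R : realType} :
    {measure set (measurableTypeR R * measurableTypeR R) -> \bar R} :=
  (@lebesgue_measure R \x @lebesgue_measure R)%E.

Definition unit_square {R : realType} : set (R * R) := `[0, 1] `*` `[0, 1].

Definition L1_norm {R : realType} (A : set (R * R)) (f : R * R -> R) : \bar R :=
  (\int[lebesgue_measure2]_(z in A) `|(f z)%:E|)%E.

(* The order of the top derivative of a C^s function: floor s if s is not an
   integer, and s - 1 if s is an integer, in which case the Hoelder exponent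
   s - (s - 1) = 1 encodes the convention that derivatives up to order s - 1 are
   Lipschitz. Meaningful for 0 < s. *)
Definition top_order {R : realType} (s : R) : nat := `|Num.ceil s|.-1.

(* Derivatives are two-sided, hence taken in the open interval. When the norm
   below is finite, they all extend continuously to [-r, r]. *)
Definition holder_norm {R : realType} (s r : R) (psi : R -> R) : \bar R :=
  (ereal_sup [set `|derive1n jx.1 psi jx.2|%R%:E | jx in
     [set jx : nat * R | (jx.1 <= top_order s)%N /\ (jx.2 \in `]-r, r[)%R]]
   + ereal_sup [set (`|xt.1 - xt.2| `^ ((top_order s)%:R - s) *
         `|derive1n (top_order s) psi xt.1 - derive1n (top_order s) psi xt.2|)%R%:E
       | xt in [set xt : R * R |
           [/\ (xt.1 \in `]-r, r[)%R, (xt.2 \in `]-r, r[)%R & xt.1 != xt.2]]])%E.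

Definition is_Cs {R : realType} (s r : R) (psi : R -> R) : Prop :=
  [/\ {within `[-r, r], continuous psi},
      forall j x, (j < top_order s)%N -> x \in `]-r, r[ ->
        derivable (derive1n j psi) x 1
    & (holder_norm s r psi < +oo)%E].

Definition boundary {T : topologicalType} (A : set T) : set T :=
  closure A `\` interior A.

Definition orthonormal2 {R : realType} (e1 e2 : R * R) : Prop :=
  [/\ e1.1 ^+ 2 + e1.2 ^+ 2 = 1, e2.1 ^+ 2 + e2.2 ^+ 2 = 1
    & e1.1 * e2.1 + e1.2 * e2.2 = 0].

Definition local_point {R : realType} (z0 e1 e2 : R * R) (z1 z2 : R) : R * R :=
  (z0.1 + z1 * e1.1 + z2 * e2.1, z0.2 + z1 * e1.2 + z2 * e2.2).

Definition Cs_domain {R : realType} (s : R) (Omega : set (R * R)) : Prop :=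
  exists r P M : R, [/\ 0 < r, 1 < P, 0 < M &
    forall z0, boundary Omega z0 ->
    exists (e1 e2 : R * R) (psi : R -> R),
      [/\ orthonormal2 e1 e2, is_Cs s r psi, (holder_norm s r psi <= M%:E)%E,
          forall x, x \in `[-r, r] -> psi x \in `[- (P * r), P * r]
        & forall z1 z2, `|z1| <= r -> `|z2| <= P * r ->
            (Omega (local_point z0 e1 e2 z1 z2) <-> z2 <= psi z1)]].

(* Cells are half-open, so that they are pairwise disjoint; closed cells give
   the same averages and L^1 norms. Coordinates range over all of Z^2: stencils
   may leave [0, 1]^2, where the characteristic function of a subset of [0, 1]^2
   vanishes. *)
Definition cell {R : realType} (h : R) (i j : int) : set (R * R) :=
  `[i%:~R * h, (i + 1)%:~R * h[ `*` `[j%:~R * h, (j + 1)%:~R * h[.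

Definition cell_average {R : realType} (u : R * R -> R) (h : R) (i j : int) : R :=
  (fine (lebesgue_measure2 (cell h i j)))^-1
  * \int[lebesgue_measure2]_(z in cell h i j) u z.

Definition singular {R : realType} (Omega : set (R * R)) (h : R) (i j : int) : Prop :=
  lebesgue_measure2 (cell h i j `&` Omega) <> 0%E /\
  lebesgue_measure2 (cell h i j `&` ~` Omega) <> 0%E.

(* Here and below, a i j is the average on the cell (i, j). *)
Definition aerosH {R : realType} (a : int -> int -> R) (i j : int) : R :=
  2 * a (i + 1) j + a (i + 1) (j + 1) + a (i + 1) (j - 1)
  - (2 * a (i - 1) j + a (i - 1) (j + 1) + a (i - 1) (j - 1)).

Definition aerosV {R : realType} (a : int -> int -> R) (i j : int) : R :=
  2 * a i (j + 1) + a (i + 1) (j + 1) + a (i - 1) (j + 1)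
  - (2 * a i (j - 1) + a (i + 1) (j - 1) + a (i - 1) (j - 1)).

(* The forms  y <= p(x),  y >= p(x),  x <= p(y),  x >= p(y). *)
Inductive form := YleP | YgeP | XleP | XgeP.

Definition aeros_form {R : realType} (a : int -> int -> R) (i j : int) : form :=
  if `|aerosH a i j| <= `|aerosV a i j| then
    if aerosV a i j <= 0 then YleP else YgeP
  else
    if aerosH a i j <= 0 then XleP else XgeP.

(* Each form is reduced to the first one by the symmetry to_frame of the plane.
   The reflection y |-> -y maps the cell (i, j) to the cell (i, -1 - j). *)
Definition to_frame {R : realType} (f : form) (z : R * R) : R * R :=
  match f with
  | YleP => (z.1, z.2)
  | YgeP => (z.1, - z.2)
  | XleP => (z.2, z.1)
  | XgeP => (z.2, - z.1)
  end.

Definition cell_to_frame (f : form) (i j : int) : int * int :=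
  match f with
  | YleP => (i, j)
  | YgeP => (i, -1 - j)
  | XleP => (j, i)
  | XgeP => (j, -1 - i)
  end.

(* The data seen in the frame: the average on the cell whose image under the
   symmetry is (i, j). *)
Definition data_in_frame {R : realType} (f : form) (a : int -> int -> R)
    (i j : int) : R :=
  match f with
  | YleP => a i j
  | YgeP => a i (-1 - j)
  | XleP => a j i
  | XgeP => a (-1 - j) i
  end.

Definition row_equals {R : realType} (a : int -> int -> R) (iT : int)
    (km kp : nat) (j : int) (c : R) : Prop :=
  forall i : int, iT - km%:Z <= i <= iT + kp%:Z -> a i j = c.

Definition is_least (Q : nat -> Prop) (l : nat) : Prop :=
  Q l /\ forall m, Q m -> (l <= m)%N.

Definition is_stencil {R : realType} (a : int -> int -> R) (iT jT : int)
    (km kp lm lp : nat) : Prop :=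
  is_least (fun l => (0 < l)%N /\ row_equals a iT km kp (jT - l%:Z - 1) 1) lm /\
  is_least (fun l => (0 < l)%N /\ row_equals a iT km kp (jT + l%:Z + 1) 0) lp.

(* Both the centered stencil and the optional non-centered one are covered. *)
Definition aeros_stencil {R : realType} (k : nat) (a : int -> int -> R)
    (iT jT : int) (km kp lm lp : nat) : Prop :=
  [/\ (km + kp)%N = (2 * k)%N,
      is_stencil a iT jT km kp lm lp
    & (km = k /\ kp = k) \/
      forall km' kp' lm' lp' : nat, (km' + kp')%N = (2 * k)%N ->
        is_stencil a iT jT km' kp' lm' lp' -> (1 + lm + lp <= 1 + lm' + lp')%N].

Definition column_sum {R : realType} (h : R) (a : int -> int -> R) (jT : int)
    (lm lp : nat) (i : int) : R :=
  h * \sum_(n < (lm + lp).+1) a i (jT - lm%:Z + n%:Z).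

Definition fits_columns {R : realType} (k : nat) (h : R) (a : int -> int -> R)
    (iT jT : int) (km kp lm lp : nat) (p : {poly R}) : Prop :=
  (size p <= (2 * k).+1)%N /\
  forall i : int, iT - km%:Z <= i <= iT + kp%:Z ->
    h^-1 * \int[lebesgue_measure]_(x in `[i%:~R * h, (i + 1)%:~R * h]) p.[x]
    = column_sum h a jT lm lp i + (jT - lm%:Z)%:~R * h.

(* p is a polynomial computed by AEROS on the cell (i, j), expressed in the frame
   given by the form selected on that cell. *)
Definition aeros_poly {R : realType} (k : nat) (h : R) (a : int -> int -> R)
    (i j : int) (p : {poly R}) : Prop :=
  let f := aeros_form a i j in
  let: (iT, jT) := cell_to_frame f i j in
  exists km kp lm lp : nat,
    aeros_stencil k (data_in_frame f a) iT jT km kp lm lp /\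
    fits_columns k h (data_in_frame f a) iT jT km kp lm lp p.

(* On a coarse mesh, or near a merely Lipschitz interface, l^- or l^+ may fail to
   exist; nothing is then required of the polynomial, so that what is proved for
   every aeros_output holds whatever is done on such cells. *)
Definition aeros_output {R : realType} (k : nat) (h : R) (a : int -> int -> R)
    (i j : int) (p : {poly R}) : Prop :=
  (exists q, aeros_poly k h a i j q) -> aeros_poly k h a i j p.

Definition recovered_set {R : realType} (a : int -> int -> R) (i j : int)
    (p : {poly R}) : set (R * R) :=
  [set z | let w := to_frame (aeros_form a i j) z in w.2 <= p.[w.1]].

Definition recovery {R : realType} (a : int -> int -> R) (i j : int)
    (p : {poly R}) : R * R -> R :=
  \1_(recovered_set a i j p).

(* p i j is the polynomial used on the cell (i, j) if that cell is singular. *)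
Definition reconstruction {R : realType} (Omega : set (R * R)) (ell : nat)
    (p : 'I_ell -> 'I_ell -> {poly R}) (z : R * R) : R :=
  let h := ell%:R^-1 in
  let a := cell_average \1_Omega h in
  \sum_(i < ell) \sum_(j < ell)
    (if `[< singular Omega h i%:Z j%:Z >] then recovery a i%:Z j%:Z (p i j) z
     else a i%:Z j%:Z)
    * \1_(cell h i%:Z j%:Z) z.

(* Main.v *)
Require Import Defs.
From mathcomp Require Import all_boot all_order all_algebra.
From mathcomp Require Import all_classical all_reals all_analysis.
From mathcomp Require Import measurable_realfun.
From mathcomp Require Import qpoly zify ring lra.

(** Near a boundary point, the chart of the domain differs from its Taylor
    polynomial [p], taken of degree at most 2k, by O(h^r)
    ([Cs_domain_taylor_charts]). In the axes of the chart, the domain therefore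
    contains the points where [w2 - p(w1)] is below -O(h^r), and none where it is
    above O(h^r): up to an error O(h^r) the interface is the zero set
    of a polynomial, [implicit_eq]. The regularity of the boundary enters only
    through this squeeze. In particular the interface is never shown to be a
    graph over the axis that the algorithm selects, and no implicit function is
    differentiated.

    A singular cell contains a boundary point ([singular_boundary]). If, at this
    point, the derivative of [implicit_eq] in the second variable of the selected
    frame were below 1/40, then either the interface would be nearly vertical, so
    that |H_T| > |V_T| in this frame, or the set would lie above it, so that V_T > 0; the
    orientation test excludes both ([chart_orientation]). With this lower bound, Newton's
    iteration with a frozen slope, truncated to degree 2k, gives a polynomial [q]
    such that the interface lies between the graphs of [q - E] and [q + E] on all
    the cells that a stencil can use, where E = O(h^r) ([implicit_squeeze],
    [chart_window]).

    As E is small compared with h, the cell averages decrease upwards in each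
    column. The rows that a stencil leaves out are thus full below and empty
    above, and the height recovered from a column does not depend on the stencil
    ([column_sum_extend]). This height is the area of the domain in the column
    divided by h, hence the average of [q] up to E ([column_squeeze]). The
    polynomial of the algorithm and [q], both of degree at most 2k, have averages
    at distance at most E over 2k + 1 consecutive intervals, so that they differ
    by at most K * E on the cell ([averages_stable]). The recovery is then wrong
    only where |y - q(x)| <= (K + 1) * E, a set of area O(h^(r + 1)) in the cell
    ([aeros_local_error]). On coarse meshes, or if s = 1, the area h^2 of the
    cell is already of this order ([aeros_local_error_all]).

    For the global bound, the regular cells contribute nothing, and since the
    boundary is covered by a bounded number of Lipschitz graphs, O(1 / h) cells
    are singular ([singular_count], [global_error]). *)

Import Order.TTheory GRing.Theory Num.Theory.
Import numFieldNormedType.Exports.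
Local Open Scope classical_set_scope.
Local Open Scope ring_scope.

Set Implicit Arguments.
Unset Strict Implicit.
Unset Printing Implicit Defensive.

(** * Lebesgue measure in the plane *)

Section PlaneMeasure.
Context {R : realType}.
Local Notation mR := (measurableTypeR R).
Local Notation plane := (mR * mR)%type.
Local Notation lam := (@lebesgue_measure R).
Local Notation mu := (@lebesgue_measure2 R).

Lemma lebesgue_preimage (f : mR -> mR) : measurable_fun setT f ->
  (forall a b : R, a < b -> lam (f @^-1` `]a, b]) = (b - a)%:E) ->
  forall A : set mR, measurable A -> lam (f @^-1` A) = lam A.
Proof.
move=> mf Hf A mA; apply/esym.
apply: (lebesgue_measure_unique (mu := [the {measure set mR -> \bar R} of pushforward lam f])) => // X /ocitvP[->|[[a b] /= ab ->]].
  by rewrite !measure0.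
by rewrite /pushforward Hf // lebesgue_measure_itv/= lte_fin ab EFinB.
Qed.

Lemma measurable_shift (c : R) : measurable_fun setT ((fun x => x + c) : mR -> mR).
Proof. by apply: measurable_funD. Qed.

Lemma measurable_opp : measurable_fun setT (-%R : mR -> mR).
Proof. exact: oppr_measurable. Qed.

Lemma lebesgue_preimage_shift (c : R) (A : set mR) :
  measurable A -> lam ((fun x => x + c) @^-1` A) = lam A.
Proof.
apply: lebesgue_preimage; first exact: measurable_shift.
move=> a b ab.
have -> : (fun x => x + c) @^-1` `]a, b] = `]a - c, b - c]%classic.
  by apply/seteqP; split => x /=; rewrite !in_itv /= ltrBlDr lerBrDr.
rewrite lebesgue_measure_itv/= lte_fin ltrD2r ab -EFinB.
by congr EFin; ring.
Qed.

Lemma lebesgue_preimage_opp (A : set mR) :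
  measurable A -> lam ((fun x => - x) @^-1` A) = lam A.
Proof. exact: lebesgue_measureN. Qed.

Lemma lebesgue2X (A B : set mR) : measurable A -> measurable B ->
  mu (A `*` B) = (lam A * lam B)%E.
Proof. exact: product_measure1E. Qed.

Lemma lebesgue2_preimage (F : plane -> plane) : measurable_fun setT F ->
  (forall A B : set mR, measurable A -> measurable B ->
     mu (F @^-1` (A `*` B)) = (lam A * lam B)%E) ->
  forall X, measurable X -> mu (F @^-1` X) = mu X.
Proof.
move=> mF HF X mX; apply/esym.
by apply: (product_measure_unique
  (m' := [the {measure set plane -> \bar R} of pushforward mu F])).
Qed.

Lemma measurable_plane_shift (v : plane) :
  measurable_fun setT ((fun z => (z.1 + v.1, z.2 + v.2)) : plane -> plane).
Proof.
by apply/measurable_fun_pair; apply: measurable_funD => //; exact: measurable_cst.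
Qed.

Lemma lebesgue2_preimage_shift (v : plane) (X : set plane) : measurable X ->
  mu ((fun z : plane => (z.1 + v.1, z.2 + v.2)) @^-1` X) = mu X.
Proof.
apply: lebesgue2_preimage => [|A B mA mB]; first exact: measurable_plane_shift.
have -> : (fun z : plane => (z.1 + v.1, z.2 + v.2)) @^-1` (A `*` B) =
  ((fun x => x + v.1) @^-1` A) `*` ((fun x => x + v.2) @^-1` B) by [].
by rewrite lebesgue2X ?lebesgue_preimage_shift//; rewrite -[X in measurable X]setTI;
  exact: measurable_shift.
Qed.

Lemma measurable_to_frame (f : Defs.form) : measurable_fun setT (@to_frame R f : plane -> plane).
Proof.
case: f; apply/measurable_fun_pair => //=; by apply: measurableT_comp => //; exact: oppr_measurable.
Qed.

Lemma lebesgue2_to_frame (f : Defs.form) (X : set plane) : measurable X ->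
  mu (@to_frame R f @^-1` X) = mu X.
Proof.
apply: lebesgue2_preimage => [|A B mA mB]; first exact: measurable_to_frame.
have mB' : measurable ((fun x => - x) @^-1` B : set mR).
  by rewrite -[X in measurable X]setTI; exact: measurable_opp.
case: f; rewrite /to_frame /=.
- have -> : (fun z : plane => (z.1, z.2)) @^-1` (A `*` B) = A `*` B by [].
  exact: lebesgue2X.
- have -> : (fun z : plane => (z.1, - z.2)) @^-1` (A `*` B) = A `*` ((fun x => - x) @^-1` B) by [].
  by rewrite lebesgue2X// lebesgue_preimage_opp.
- have -> : (fun z : plane => (z.2, z.1)) @^-1` (A `*` B) = B `*` A.
    by apply/seteqP; split => z /= [].
  by rewrite lebesgue2X// muleC.
- have -> : (fun z : plane => (z.2, - z.1)) @^-1` (A `*` B) = ((fun x => - x) @^-1` B) `*` A.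
    by apply/seteqP; split => z /= [].
  by rewrite lebesgue2X// lebesgue_preimage_opp// muleC.
Qed.

(** An open set is the union of the cells, of all mesh sizes [n.+1%:R^-1], that it
    contains, and there are countably many such cells. *)
Lemma open_measurable_plane (U : set (R * R)) : open U -> measurable (U : set plane).
Proof.
move=> oU.
pose I := (int * int * nat)%type.
pose c (t : I) : set (R * R) := cell (t.2.+1%:R)^-1 t.1.1 t.1.2.
have -> : U = \bigcup_(t in [set t : I | c t `<=` U]) c t.
  apply/seteqP; split => [z Uz|z [t /= ht /ht //]].
  have /nbhs_ballP[e /= e0 he] : nbhs z U by exact: open_nbhs_nbhs.
  have [n hn] : exists n : nat, (n.+1%:R)^-1 < e.
    exists (Num.truncn e^-1); rewrite invf_plt ?posrE ?ltr0n//.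
    exact: truncnS_gt.
  have n0 : (0 : R) < n.+1%:R by rewrite ltr0n.
  pose fl (x : R) := Num.floor (x * n.+1%:R).
  have hfl x : (fl x)%:~R * n.+1%:R^-1 <= x < ((fl x) + 1)%:~R * n.+1%:R^-1.
    rewrite ler_pdivrMr// ltr_pdivlMr//.
    by rewrite floor_le /= floorD1_gt.
  exists (fl z.1, fl z.2, n).
    have hE (x : R) : (fl x + 1)%:~R * n.+1%:R^-1 = (fl x)%:~R * n.+1%:R^-1 + n.+1%:R^-1 :> R.
      by rewrite intrD mulrDl mul1r.
    have close (x y : R) : y \in `[(fl x)%:~R * n.+1%:R^-1, (fl x + 1)%:~R * n.+1%:R^-1[ ->
        ball x e y.
      rewrite in_itv /= => /andP[a1 a2]; have /andP[] := hfl x; move: a2; rewrite hE.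
      move=> a2 b1 b2; rewrite /ball /= ltr_norml; apply/andP.
      move: hn a1 a2 b1 b2; set d := n.+1%:R^-1; set f := _ * d => *.
      by split; lra.
    by move=> w [/close w1 /close w2]; apply: he; split.
  by split; rewrite /= in_itv /= hfl.
have -> : \bigcup_(t in [set t : I | c t `<=` U]) c t =
    \bigcup_t (if `[< c t `<=` U >] then c t else set0).
  apply/seteqP; split => [z [t /= ht hz]|z [t _]].
    by exists t => //; case: asboolP.
  by case: asboolP => // ht hz; exists t.
apply: countable_bigcupT_measurable => [|t]; first exact: countableP.
case: ifP => // _.
by apply: measurableX; exact: measurable_itv.
Qed.

Lemma closed_measurable_plane (A : set (R * R)) : closed A -> measurable (A : set plane).
Proof.
by move=> /closed_openC/open_measurable_plane/measurableC; rewrite setCK.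
Qed.

End PlaneMeasure.

(** * Cells and cell averages *)

Section Cells.
Context {R : realType}.
Local Notation mR := (measurableTypeR R).
Local Notation plane := (mR * mR)%type.
Local Notation lam := (@lebesgue_measure R).
Local Notation mu := (@lebesgue_measure2 R).
Implicit Types (h : R) (A : set plane) (i j : int).

Lemma lebesgue_itv_co (a b : R) : a <= b -> lam `[a, b[%classic = (b - a)%:E.
Proof.
rewrite le_eqVlt => /predU1P[->|ab].
  by rewrite set_itvco0 ?measure0 ?subrr.
by rewrite lebesgue_measure_itv /= lte_fin ab EFinB.
Qed.

Lemma intrSl (x : int) h : (x + 1)%:~R * h = x%:~R * h + h.
Proof. by rewrite intrD mulrDl mul1r. Qed.

Lemma measurable_cell h i j : measurable (cell h i j : set plane).
Proof. by apply: measurableX; exact: measurable_itv. Qed.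

Lemma lebesgue2_cell h i j : 0 <= h -> mu (cell h i j) = (h ^+ 2)%:E.
Proof.
move=> h0; rewrite /cell lebesgue2X; try exact: measurable_itv.
rewrite !lebesgue_itv_co ?intrSl ?lerDl//.
by rewrite ![_ + h]addrC !addrK -EFinM.
Qed.

Lemma cell_average_indic h A i j : 0 < h -> measurable A ->
  mu (cell h i j `&` A) = (h ^+ 2 * cell_average \1_A h i j)%:E.
Proof.
move=> h0 mA; rewrite /cell_average lebesgue2_cell ?ltW//=.
rewrite mulrA divff ?mul1r ?expf_neq0 ?gt_eqF// /Rintegral.
rewrite integral_indic//; last exact: measurable_cell.
rewrite setIC fineK// ge0_fin_numE//.
rewrite (@le_lt_trans _ _ (mu (cell h i j)))//.
  apply: le_measure => //; rewrite ?inE; last exact: measurable_cell.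
  by apply: measurableI => //; exact: measurable_cell.
by rewrite lebesgue2_cell ?ltW// ltry.
Qed.

Lemma cell_average_eq h A A' i j i' j' : 0 < h ->
  measurable A -> measurable A' ->
  mu (cell h i j `&` A) = mu (cell h i' j' `&` A') ->
  cell_average \1_A h i j = cell_average \1_A' h i' j'.
Proof.
move=> h0 mA mA'; rewrite !cell_average_indic// => -[] /mulfI; apply.
by rewrite expf_neq0 ?gt_eqF.
Qed.

Lemma cell_average_ge0 h A i j : 0 < h -> measurable A ->
  0 <= cell_average \1_A h i j.
Proof.
move=> h0 mA; rewrite -(pmulr_rge0 _ (exprn_gt0 2 h0)) -lee_fin.
by rewrite -cell_average_indic.
Qed.

Lemma cell_average_sub1 h A i j : 0 < h -> measurable A ->
  h ^+ 2 * (1 - cell_average \1_A h i j) = fine (mu (cell h i j `\` A)).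
Proof.
move=> h0 mA; have mc := measurable_cell h i j.
have muc := lebesgue2_cell i j (ltW h0).
by rewrite measureD//= ?muc ?ltry// cell_average_indic//= mulrBr mulr1.
Qed.

Lemma cell_average_le1 h A i j : 0 < h -> measurable A ->
  cell_average \1_A h i j <= 1.
Proof.
move=> h0 mA; rewrite -subr_ge0 -(pmulr_rge0 _ (exprn_gt0 2 h0)).
by rewrite cell_average_sub1// fine_ge0.
Qed.

Lemma cell_average1 h A i j : 0 < h -> measurable A ->
  cell h i j `<=` A -> cell_average \1_A h i j = 1.
Proof.
rewrite -setD_eq0 => h0 mA cA; apply/eqP; rewrite eq_sym -subr_eq0.
have /eqP := @cell_average_sub1 h A i j h0 mA.
by rewrite cA measure0 mulf_eq0 expf_eq0 (gt_eqF h0).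
Qed.

Lemma cell_average0 h A i j : 0 < h -> measurable A ->
  cell h i j `&` A = set0 -> cell_average \1_A h i j = 0.
Proof.
move=> h0 mA cA; have := @cell_average_indic h A i j h0 mA.
rewrite cA measure0 => -[/esym/eqP].
by rewrite mulf_eq0 expf_eq0 (gt_eqF h0)/= => /eqP.
Qed.

Lemma in_cellP h i j (z : plane) : cell h i j z <->
  (i%:~R * h <= z.1 < i%:~R * h + h) /\ (j%:~R * h <= z.2 < j%:~R * h + h).
Proof. by rewrite /cell /= !in_itv/= !intrSl. Qed.

Lemma cell_shift h i j (m n : int) (z : plane) :
  cell h (i + m) (j + n) (z.1 + m%:~R * h, z.2 + n%:~R * h) <-> cell h i j z.
Proof.
rewrite !in_cellP /= !intrD !mulrDl !lerD2r.
by rewrite ![_ + _ + h]addrAC !ltrD2r.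
Qed.

Lemma le_cell_average_shift h A i j (m n : int) : 0 < h -> measurable A ->
  (forall z, cell h i j z -> A z -> A (z.1 + m%:~R * h, z.2 + n%:~R * h)) ->
  cell_average \1_A h i j <= cell_average \1_A h (i + m) (j + n).
Proof.
move=> h0 mA sA; rewrite -(ler_pM2l (exprn_gt0 2 h0)) -lee_fin.
have mcA i' j' : measurable (cell h i' j' `&` A : set plane).
  by apply: measurableI => //; exact: measurable_cell.
rewrite -(cell_average_indic i j h0 mA) -(cell_average_indic (i + m) (j + n) h0 mA).
rewrite -[leRHS](lebesgue2_preimage_shift (m%:~R * h, n%:~R * h) (mcA _ _)).
apply: le_measure; rewrite ?inE//.
  by rewrite -[X in measurable X]setTI; exact: (measurable_plane_shift _ measurableT (mcA _ _)).
by move=> z [cz Az]; split; [exact/cell_shift|exact: sA].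
Qed.

Lemma cell_row_measure h A i j (n : nat) : 0 < h -> measurable A ->
  mu ((`[i%:~R * h, (i + 1)%:~R * h[ `*` `[j%:~R * h, (j + n%:Z)%:~R * h[) `&` A)
  = (h ^+ 2 * \sum_(m < n) cell_average \1_A h i (j + m%:Z))%:E.
Proof.
move=> h0 mA; elim: n => [|n IHn].
  by rewrite addr0 set_itvco0 setX0 set0I measure0 big_ord0 mulr0.
rewrite big_ord_recr /= mulrDr EFinD -IHn -cell_average_indic//.
have hle (a b : int) : (a <= b) -> a%:~R * h <= b%:~R * h :> R.
  by move=> ab; rewrite ler_pM2r// ler_int.
rewrite -measureU//.
- congr (mu _); apply/seteqP; split=> [[x y] [[/= hx hy] Az]|[x y]].
    move: hy; rewrite in_itv/= => /andP[y1 y2].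
    have [yn|yn] := ltP y ((j + n%:Z)%:~R * h).
      by left; split => //; split => //=; rewrite in_itv/= y1.
    right; split => //; split => //=; rewrite in_itv/= yn/=.
    by have -> : j + n%:Z + 1 = j + n.+1%:Z by lia.
  move=> [|] [[/= hx]]; rewrite in_itv/= => /andP[y1 y2] Az; split => //; split => //=.
    by rewrite in_itv/= y1 (lt_le_trans y2)// hle//; lia.
  rewrite in_itv/= (le_trans _ y1) ?hle//; last lia.
  by rewrite (lt_le_trans y2)// hle//; lia.
- by apply: measurableI => //; apply: measurableX; exact: measurable_itv.
- by apply: measurableI => //; exact: measurable_cell.
- apply/seteqP; split => // -[x y] [[[/= _ +] _] [[/= _ +] _]].
  by rewrite !in_itv/= => /andP[_ y1] /andP[y2 _]; have := lt_le_trans y1 y2; rewrite ltxx.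
Qed.

Lemma horner_FTC (p P : {poly R}) (a b : R) : a <= b -> P^`() = p ->
  (\int[lam]_(x in `[a, b]) (p.[x])%:E = (P.[b] - P.[a])%:E)%E.
Proof.
rewrite le_eqVlt => /predU1P[->|ab] Pp.
  by rewrite set_itv1 integral_set1 subrr.
rewrite (@continuous_FTC2 _ (horner p) (horner P)) ?EFinB//.
- by apply: continuous_subspaceT => x; exact: continuous_horner.
- split.
  + by move=> x _; exact: derivable_horner.
  + by apply: cvg_at_right_filter; exact: continuous_horner.
  + by apply: cvg_at_left_filter; exact: continuous_horner.
- by move=> x _; rewrite -derivE Pp.
Qed.

Lemma measurable_horner (D : set mR) (p : {poly R}) : measurable_fun D (horner p : mR -> R).
Proof.
apply: (@measurable_funS _ _ _ _ setT) => //.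
by apply: continuous_measurable_fun => x; exact: continuous_horner.
Qed.

End Cells.

(** * Areas in a column *)

Section Columns.
Context {R : realType}.
Local Notation mR := (measurableTypeR R).
Local Notation plane := (mR * mR)%type.
Local Notation lam := (@lebesgue_measure R).
Local Notation mu := (@lebesgue_measure2 R).
Implicit Types (h : R) (A : set plane) (i j : int).

Lemma horner_FTC_co (p P : {poly R}) (a b : R) : a <= b -> P^`() = p ->
  (\int[lam]_(x in `[a, b[) (p.[x])%:E = (P.[b] - P.[a])%:E)%E.
Proof.
move=> ab Pp; rewrite integral_itv_bndo_bndc; first exact: horner_FTC.
apply/measurable_EFinP; exact: measurable_horner.
Qed.

Lemma integral_xsection_column (X : set plane) (D : set mR) :
  (forall z, X z -> D z.1) ->
  mu X = (\int[lam]_(x in D) lam (xsection X x))%E.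
Proof.
move=> XD; rewrite integral_mkcond; apply: eq_integral => x _.
rewrite patchE; case: ifPn => // xD /=.
have -> : xsection X x = set0.
  by apply/seteqP; split => // y /xsectionP /XD /= Dx; rewrite notin_setE in xD.
by rewrite measure0.
Qed.

Lemma strip_measure (X : set plane) (g : R -> R) (a b w : R) : measurable X ->
  a <= b -> 0 <= w ->
  (forall z, X z -> (z.1 \in `[a, b[) /\ `|z.2 - g z.1| <= w) ->
  (mu X <= (2 * w * (b - a))%:E)%E.
Proof.
move=> mX ab w0 HX.
rewrite (@integral_xsection_column X `[a, b[%classic); last by move=> z /HX [].
pose D := `[a, b[%classic : set mR.
apply: (@le_trans _ _ (\int[lam]_(x in D) cst (2 * w)%:E x)%E); last first.
  have -> : (2 * w * (b - a))%:E = ((2 * w)%:E * lam D)%E by rewrite lebesgue_itv_co.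
  by rewrite integral_cst//; exact: measurable_itv.
apply: ge0_le_integral => //.
- exact: measurable_funTS (measurable_fun_xsection _ mX).
- move=> x _ /=; apply: (@le_trans _ _ (lam `[g x - w, g x + w]%classic)).
    apply: le_measure; rewrite ?inE//; first exact: measurable_xsection.
    move=> y /xsectionP /HX [_]; rewrite /= in_itv/= ler_norml => /andP[h1 h2].
    by apply/andP; split; lra.
  have := lebesgue_measure_itv `[g x - w, g x + w]; rewrite /= lte_fin => ->.
  by case: ifP => _; rewrite -?EFinB lee_fin; lra.
Qed.

(** The vertical section of [A] at [x] has a length between [q.[x] - E - b] and
    [q.[x] + E - b]; the area is the integral of these lengths. *)
Lemma column_squeeze A (q Q : {poly R}) (a c b t E : R) : measurable A ->
  a <= c -> 0 <= E -> Q^`() = q ->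
  (forall x, x \in `[a, c[ -> b <= q.[x] - E /\ q.[x] + E <= t) ->
  (forall x y, x \in `[a, c[ -> y \in `[b, t[ ->
     (y <= q.[x] - E -> A (x, y)) /\ (A (x, y) -> y <= q.[x] + E)) ->
  exists m, mu ((`[a, c[ `*` `[b, t[) `&` A) = m%:E /\
    `|m - (Q.[c] - Q.[a] - b * (c - a))| <= E * (c - a).
Proof.
move=> mA ac E0 Qq Hq HA; set X := _ `&` A.
have mX : measurable X.
  by apply: measurableI => //; apply: measurableX; exact: measurable_itv.
pose D := `[a, c[%classic : set mR.
have mD : measurable D by exact: measurable_itv.
have XE : mu X = (\int[lam]_(x in D) lam (xsection X x))%E.
  by apply: integral_xsection_column => z [[]].
have mf : measurable_fun D (fun x => lam (xsection X x)).
  exact: measurable_funTS (measurable_fun_xsection _ mX).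
have IH (e : R) : (\int[lam]_(x in D) ((q + (e - b)%:P).[x])%:E =
    (Q.[c] - Q.[a] - b * (c - a) + e * (c - a))%:E)%E.
  rewrite (@horner_FTC_co _ (Q + (e - b)%:P * 'X))//; last first.
    by rewrite derivD Qq derivM derivC mul0r add0r derivX mulr1.
  by rewrite !hornerE; congr EFin; ring.
have mp (p : {poly R}) : measurable_fun D (fun x => (p.[x])%:E).
  by apply/measurable_EFinP; exact: measurable_horner.
have lo : ((Q.[c] - Q.[a] - b * (c - a) - E * (c - a))%:E <= mu X)%E.
  have IHE := IH (- E); rewrite mulNr in IHE.
  rewrite -IHE XE; apply: ge0_le_integral => //.
    by move=> x Dx; have [h1 h2] := Hq x Dx; rewrite hornerD hornerC lee_fin; lra.
  move=> x Dx; have [h1 h2] := Hq x Dx.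
  apply: (@le_trans _ _ (lam `[b, q.[x] - E[%classic)).
    by rewrite lebesgue_itv_co ?lee_fin ?hornerD ?hornerC; lra.
  apply: le_measure; rewrite ?inE//; first exact: measurable_xsection.
  move=> y /=; rewrite in_itv/= => /andP[y1 y2]; apply/xsectionP.
  have ybt : y \in `[b, t[ by rewrite in_itv/= y1/=; lra.
  by split => //; apply: (HA x y Dx ybt).1; exact: ltW.
have up : (mu X <= (Q.[c] - Q.[a] - b * (c - a) + E * (c - a))%:E)%E.
  rewrite -IH XE; apply: ge0_le_integral => //.
  move=> x Dx; have [h1 h2] := Hq x Dx.
  apply: (@le_trans _ _ (lam `[b, q.[x] + E]%classic)); last first.
    have := lebesgue_measure_itv `[b, q.[x] + E]; rewrite /= lte_fin => ->.
    by rewrite hornerD hornerC; case: ifP => _; rewrite -?EFinB lee_fin; lra.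
  apply: le_measure; rewrite ?inE//; first exact: measurable_xsection.
  move=> y /xsectionP [[_ /= ybt] Ay].
  have := (HA x y Dx ybt).2 Ay; move: ybt; rewrite !in_itv/= => /andP[-> _].
  by move=> ->.
have fX : mu X \is a fin_num.
  by rewrite ge0_fin_numE// (le_lt_trans up)// ltry.
exists (fine (mu X)); rewrite fineK//; split => //.
by move: lo up; rewrite -[mu X]fineK// !lee_fin => lo up; rewrite ler_norml; apply/andP; split; lra.
Qed.

End Columns.

(** * The data seen in the frame of a form *)

Section Frames.
Context {R : realType}.
Local Notation mR := (measurableTypeR R).
Local Notation plane := (mR * mR)%type.
Local Notation mu := (@lebesgue_measure2 R).
Implicit Types (h : R) (A : set plane) (i j : int).

Definition open_cell h i j : set (R * R) :=
  `]i%:~R * h, (i + 1)%:~R * h[ `*` `]j%:~R * h, (j + 1)%:~R * h[.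

Lemma measurable_open_cell h i j : measurable (open_cell h i j : set plane).
Proof. by apply: measurableX; exact: measurable_itv. Qed.

(** A reflection turns a half-open cell into a cell that is half-open on the other
    side. Both have the same open cell, from which they differ by two sides, of
    measure zero. *)
Lemma lebesgue2_open_cell h A i j : measurable A ->
  mu (open_cell h i j `&` A) = mu (cell h i j `&` A).
Proof.
move=> mA.
pose N : set plane := ([set i%:~R * h] `*` setT) `|` (setT `*` [set j%:~R * h]).
have mN1 : measurable ([set i%:~R * h] `*` setT : set plane) by exact: measurableX.
have mN2 : measurable (setT `*` [set j%:~R * h] : set plane) by exact: measurableX.
have mN : measurable N by exact: measurableU.
have N0 : mu N = 0%E.
  have z1 : mu ([set i%:~R * h] `*` setT) = 0%E.
    by rewrite lebesgue2X// lebesgue_measure_set1 mul0e.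
  have z2 : mu (setT `*` [set j%:~R * h]) = 0%E.
    by rewrite lebesgue2X// lebesgue_measure_set1 mule0.
  by rewrite /N measureU0.
have mc := measurable_cell h i j; have mo := measurable_open_cell h i j.
have mNc : measurable (N `&` (cell h i j `&` A)).
  by apply: measurableI => //; exact: measurableI.
have mu0 : mu (N `&` (cell h i j `&` A)) = 0%E.
  by apply: (subset_measure0 mNc mN) => // z [].
have -> : cell h i j `&` A = (open_cell h i j `&` A) `|` (N `&` (cell h i j `&` A)).
  apply/seteqP; split => [z [[z1 z2] Az]|z [[[z1 z2] Az]|[_ ?]]] //.
    move: (z1) (z2); rewrite /= !in_itv/= => /andP[] + u1 /andP[] + u2.
    rewrite le_eqVlt => /orP[/eqP e|v1]; first by right; split => //; left; split => //=.
    rewrite le_eqVlt => /orP[/eqP e|v2]; first by right; split => //; right; split => //=.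
    by left; split => //; split; rewrite /= in_itv/= ?v1 ?v2.
  move: z1 z2; rewrite /= !in_itv/= => /andP[a1 a2] /andP[b1 b2].
  by split => //; split; rewrite /= in_itv/= ?a2 ?b2 ltW.
by rewrite measureU0//; exact: measurableI.
Qed.

Lemma lebesgue2_cell_to_frame (f : Defs.form) h A i j : measurable A ->
  mu (cell h i j `&` @to_frame R f @^-1` A) =
  mu (cell h (cell_to_frame f i j).1 (cell_to_frame f i j).2 `&` A).
Proof.
move=> mA.
have mtA : measurable (@to_frame R f @^-1` A : set plane).
  by rewrite -[X in measurable X]setTI; exact: (@measurable_to_frame R f measurableT _ mA).
rewrite -!lebesgue2_open_cell// -[RHS](lebesgue2_to_frame f); last first.
  by apply: measurableI => //; exact: measurable_open_cell.
congr (mu _); rewrite preimage_setI; congr (_ `&` _).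
have e1 (x : R) (m : int) :
    ((-1 - m)%:~R * h < - x < (-1 - m + 1)%:~R * h) = (m%:~R * h < x < (m + 1)%:~R * h).
  have -> : -1 - m + 1 = - m by lia.
  have -> : -1 - m = - (m + 1) by lia.
  by rewrite !intrN !mulNr !ltrN2 andbC.
by case: f {mtA} => /=; apply/seteqP; split => z []; rewrite /= !in_itv/= ?e1 => ? ?;
  split; rewrite /= in_itv/= ?e1.
Qed.

Lemma data_in_frame_indic (f : Defs.form) h A : 0 < h -> measurable A ->
  data_in_frame f (cell_average \1_(@to_frame R f @^-1` A) h) = cell_average \1_A h.
Proof.
move=> h0 mA; apply/funext => i; apply/funext => j.
have mtA : measurable (@to_frame R f @^-1` A : set plane).
  by rewrite -[X in measurable X]setTI; exact: (@measurable_to_frame R f measurableT _ mA).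
have key i' j' : cell_to_frame f i' j' = (i, j) ->
    cell_average \1_(@to_frame R f @^-1` A) h i' j' = cell_average \1_A h i j.
  move=> e; apply: (cell_average_eq h0 mtA mA).
  by rewrite (lebesgue2_cell_to_frame f h i' j' mA) e.
case: f {mtA} key => key; apply: key => //=; congr (_, _); lia.
Qed.

Definition from_frame (f : Defs.form) (z : R * R) : R * R :=
  match f with
  | YleP => (z.1, z.2)
  | YgeP => (z.1, - z.2)
  | XleP => (z.2, z.1)
  | XgeP => (- z.2, z.1)
  end.

Lemma to_frameK (f : Defs.form) : cancel (@to_frame R f) (from_frame f).
Proof. by case: f => -[x y] /=; rewrite ?opprK. Qed.

(** In the frame of the selected form, the orientation test always selects the
    form [YleP]: the analysis of one form covers the four. *)
Lemma aeros_form_in_frame (a : int -> int -> R) i j :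
  let f := aeros_form a i j in
  let H := aerosH (data_in_frame f a) (cell_to_frame f i j).1 (cell_to_frame f i j).2 in
  let V := aerosV (data_in_frame f a) (cell_to_frame f i j).1 (cell_to_frame f i j).2 in
  `|H| <= `|V| /\ V <= 0.
Proof.
have e1 (m : int) : -1 - (-1 - m) = m by lia.
have e2 (m : int) : -1 - (-1 - m + 1) = m - 1 by lia.
have e3 (m : int) : -1 - (-1 - m - 1) = m + 1 by lia.
rewrite /aeros_form; case: ifPn => [HV|]; [case: ifPn => [V0|]|rewrite -ltNge => HV; case: ifPn => [H0|]] => //=.
- rewrite -ltNge => V0.
  have -> : aerosV (fun i j => a i (-1 - j)) i (-1 - j) = - aerosV a i j.
    by rewrite /aerosV ?e1 ?e2 ?e3; ring.
  have -> : aerosH (fun i j => a i (-1 - j)) i (-1 - j) = aerosH a i j.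
    by rewrite /aerosH ?e1 ?e2 ?e3; ring.
  by split; [rewrite normrN|rewrite oppr_le0 ltW].
- have -> : aerosV (fun i j => a j i) j i = aerosH a i j by rewrite /aerosV /aerosH; ring.
  have -> : aerosH (fun i j => a j i) j i = aerosV a i j by rewrite /aerosV /aerosH; ring.
  by split; [exact: ltW|].
- rewrite -ltNge => H0.
  have -> : aerosV (fun i j => a (-1 - j) i) j (-1 - i) = - aerosH a i j.
    by rewrite /aerosV /aerosH ?e1 ?e2 ?e3; ring.
  have -> : aerosH (fun i j => a (-1 - j) i) j (-1 - i) = aerosV a i j.
    by rewrite /aerosV /aerosH ?e1 ?e2 ?e3; ring.
  by split; [rewrite normrN ltW|rewrite oppr_le0 ltW].
Qed.

End Frames.

(** * The sum of the absolute values of the coefficients of a polynomial *)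

Section CoefNorm.
Context {R : realType}.
Implicit Types (p q : {poly R}) (x y z : R) (n : nat).

(** A submultiplicative norm that bounds the values where [`|x| <= 1]. All constants
    depend on the charts only through bounds on it, which makes them uniform along
    the boundary. *)
Definition coef_norm p : R := \sum_(i < size p) `|p`_i|.

Lemma coef_normE n p : (size p <= n)%N -> coef_norm p = \sum_(i < n) `|p`_i|.
Proof.
move=> pn; rewrite /coef_norm (big_ord_widen _ (fun i => `|p`_i|) pn) [RHS](bigID (fun i : 'I_n => (i < size p)%N)) /=.
rewrite [X in _ = _ + X]big1 ?addr0// => i; rewrite -leqNgt => pi.
by rewrite nth_default// normr0.
Qed.

Lemma coef_norm_ge0 p : 0 <= coef_norm p.
Proof. exact: sumr_ge0. Qed.

Lemma coef_normD p q : coef_norm (p + q) <= coef_norm p + coef_norm q.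
Proof.
pose n := maxn (size p) (size q).
rewrite (@coef_normE n)// ?size_polyD//.
rewrite (@coef_normE n p) ?leq_maxl// (@coef_normE n q) ?leq_maxr//.
by rewrite -big_split; apply: ler_sum => i _; rewrite coefD ler_normD.
Qed.

Lemma coef_normZ a p : coef_norm (a *: p) = `|a| * coef_norm p.
Proof.
rewrite (@coef_normE (size p)) ?size_scale_leq// /coef_norm mulr_sumr.
by apply: eq_bigr => i _; rewrite coefZ normrM.
Qed.

Lemma coef_normN p : coef_norm (- p) = coef_norm p.
Proof. by rewrite -scaleN1r coef_normZ normrN1 mul1r. Qed.

Lemma coef_norm0 : coef_norm 0 = 0.
Proof. by rewrite /coef_norm size_poly0 big_ord0. Qed.

Lemma coef_norm1 : coef_norm 1 = 1.
Proof. by rewrite (@coef_normE 1) ?size_poly1// big_ord1 coef1 normr1. Qed.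

Lemma coef_normMX p : coef_norm (p * 'X) = coef_norm p.
Proof.
rewrite (@coef_normE (size p).+1); last first.
  by have [->|p0] := eqVneq p 0; rewrite ?mul0r ?size_poly0// size_mulX.
rewrite big_ord_recl coefMX eqxx normr0 add0r.
by apply: eq_bigr => i _; rewrite coefMX.
Qed.

Lemma coef_normMXn p n : coef_norm (p * 'X^n) = coef_norm p.
Proof.
by elim: n => [|n IHn]; rewrite ?expr0 ?mulr1// exprSr mulrA coef_normMX.
Qed.

Lemma coef_normX : coef_norm 'X = 1.
Proof. by rewrite -['X]mul1r coef_normMX coef_norm1. Qed.

Lemma coef_norm_sum n (F : 'I_n -> {poly R}) :
  coef_norm (\sum_(i < n) F i) <= \sum_(i < n) coef_norm (F i).
Proof.
elim/big_rec2: _ => [|i a b _ h]; first by rewrite coef_norm0.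
by rewrite (le_trans (coef_normD _ _))// lerD2l.
Qed.

Lemma coef_normM p q : coef_norm (p * q) <= coef_norm p * coef_norm q.
Proof.
rewrite -[p in p * q]coefK poly_def mulr_suml (le_trans (coef_norm_sum _))//.
rewrite [coef_norm p]/coef_norm mulr_suml; apply: ler_sum => i _.
by rewrite -scalerAl coef_normZ [_ * q]mulrC coef_normMXn.
Qed.

Lemma coef_normXn p n : coef_norm (p ^+ n) <= coef_norm p ^+ n.
Proof.
elim: n => [|n IHn]; first by rewrite !expr0 coef_norm1.
by rewrite !exprS (le_trans (coef_normM _ _))// ler_wpM2l ?coef_norm_ge0.
Qed.

Lemma coef_norm_comp n p q (B : R) : (size p <= n)%N -> 1 <= B -> coef_norm q <= B ->
  coef_norm (p \Po q) <= coef_norm p * B ^+ n.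
Proof.
move=> pn B1 qB; rewrite comp_polyE (le_trans (coef_norm_sum _))//.
rewrite [coef_norm p]/coef_norm mulr_suml; apply: ler_sum => i _; rewrite coef_normZ ler_wpM2l//.
rewrite (le_trans (coef_normXn _ _))//.
rewrite (@le_trans _ _ (B ^+ i))//; first by rewrite lerXn2r ?nnegrE ?coef_norm_ge0// (le_trans _ qB)// coef_norm_ge0.
by rewrite ler_weXn2l// (leq_trans _ pn)// ltnW.
Qed.

Lemma coef_norm_horner p x : `|x| <= 1 -> `|p.[x]| <= coef_norm p.
Proof.
move=> x1; rewrite horner_coef (le_trans (ler_norm_sum _ _ _))//.
apply: ler_sum => i _; rewrite normrM normrX ler_piMr// exprn_ile1//.
Qed.

Lemma coef_norm_horner0 p x : p.[0] = 0 -> `|x| <= 1 ->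
  `|p.[x]| <= coef_norm p * `|x|.
Proof.
move=> p0 x1.
have [q pq] : exists q, p = q * 'X.
  by have /factor_theorem[q] : root p 0 by [rewrite /root p0]; rewrite subr0; exists q.
by rewrite pq hornerMX normrM coef_normMX ler_wpM2r// coef_norm_horner.
Qed.

Lemma coef_norm_take n p : coef_norm (take_poly n p) <= coef_norm p.
Proof.
pose m := maxn n (size p).
rewrite (@coef_normE m) ?(leq_trans (size_take_poly _ _)) ?leq_maxl//.
rewrite (@coef_normE m p) ?leq_maxr//; apply: ler_sum => i _.
by rewrite coef_take_poly; case: ifP => // _; rewrite normr0.
Qed.

Lemma coef_norm_drop n p : coef_norm (drop_poly n p) <= coef_norm p.
Proof.
have [pn|np] := leqP (size p) n; first by rewrite drop_poly_eq0// coef_norm0 coef_norm_ge0.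
rewrite (@coef_normE (size p - n)) ?size_drop_poly//.
rewrite (@coef_normE (n + (size p - n)) p); last by rewrite subnKC// ltnW.
rewrite big_split_ord /= -[leLHS]add0r lerD ?sumr_ge0//.
by apply: ler_sum => i _; rewrite coef_drop_poly addnC.
Qed.

Lemma horner_take n p x : `|x| <= 1 ->
  `|p.[x] - (take_poly n p).[x]| <= coef_norm p * `|x| ^+ n.
Proof.
move=> x1; rewrite -[p in p.[x]](poly_take_drop n) hornerD addrC addKr.
rewrite hornerM hornerXn normrM normrX ler_wpM2r ?exprn_ge0//.
by rewrite (le_trans (coef_norm_horner _ x1))// coef_norm_drop.
Qed.

Lemma expr_sub_le x y z n : `|x| <= z -> `|y| <= z -> z <= 1 ->
  `|x ^+ n.+2 - y ^+ n.+2| <= n.+2%:R * (z * `|x - y|).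
Proof.
move=> xz yz z1.
have z0 : 0 <= z by rewrite (le_trans _ xz).
rewrite subrXX normrM mulrC [z * _]mulrC mulrCA [leRHS]mulrC.
rewrite ler_wpM2r//; rewrite (le_trans (ler_norm_sum _ _ _))//.
rewrite (@le_trans _ _ (\sum_(i < n.+2) z))//; last by rewrite sumr_const card_ord mulr_natl.
apply: ler_sum => i _; rewrite normrM !normrX.
have /= hi := ltn_ord i.
rewrite (@le_trans _ _ (z ^+ (n.+1 - i) * z ^+ i))//.
  by rewrite ler_pM ?exprn_ge0// lerXn2r ?nnegrE.
by rewrite -exprD subnK// exprS ler_piMr// exprn_ile1.
Qed.

(** Each power of degree at least two has near the origin a Lipschitz constant
    proportional to [z]. *)
Lemma horner_linear_approx n p x y z : (size p <= n)%N ->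
  `|x| <= z -> `|y| <= z -> z <= 1 ->
  `|p.[x] - p.[y] - p`_1 * (x - y)| <= n.+1%:R * coef_norm p * (z * `|x - y|).
Proof.
move=> pn xz yz z1; set m := n.+2.
have pm : (size p <= m)%N by rewrite (leq_trans pn)// /m; lia.
rewrite (horner_coef_wide x pm) (horner_coef_wide y pm) (coef_normE pm) /m.
rewrite !(big_ord_recl n.+1) !(big_ord_recl n) /= !expr0 !expr1.
rewrite [X in `|X|](_ : _ = \sum_(i < n) p`_(bump 0 (bump 0 i)) * (x ^+ i.+2 - y ^+ i.+2)); last first.
  under [in RHS]eq_bigr do rewrite mulrBr.
  by rewrite [in RHS]big_split /= sumrN; ring.
rewrite (le_trans (ler_norm_sum _ _ _))//.
have z0 : 0 <= z by rewrite (le_trans _ xz).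
set s := \sum_(i < n) `|p`_(bump 0 (bump 0 i))|.
rewrite (@le_trans _ _ (n.+1%:R * s * (z * `|x - y|)))//.
  rewrite mulr_sumr mulr_suml; apply: ler_sum => i _.
  rewrite normrM [n.+1%:R * _]mulrC -mulrA ler_wpM2l//.
  rewrite (le_trans (expr_sub_le _ xz yz z1))//.
  by rewrite ler_wpM2r ?mulr_ge0// ler_nat ltnS.
rewrite ler_wpM2r ?mulr_ge0// ler_wpM2l// addrA -[leLHS]add0r lerD// addr_ge0//.
Qed.

End CoefNorm.

(** * Polynomials solving an implicit equation up to a given order *)

Section Implicit.
Context {R : realType}.
Implicit Types (p q : {poly R}) (x y z X Y : R) (n m : nat) (e : R * R).

(** In axes [e1] and [e2], with coordinates [w1] and [w2], this is [w2 - p(w1)]; the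
    interface is its zero set up to small errors. *)
Definition implicit_eq e1 e2 p X Y : R :=
  (X * e2.1 + Y * e2.2) - p.[X * e1.1 + Y * e1.2].

Definition small_dir e := `|e.1| <= 1 /\ `|e.2| <= 1.

(** The field [islope] bounds from below the derivative in [Y] of [implicit_eq] at
    the origin. *)
Record implicit_data (n : nat) (C d : R) e1 e2 p : Prop := ImplicitData {
  idir1 : small_dir e1;
  idir2 : small_dir e2;
  isize : (size p <= n)%N;
  ip0 : p.[0] = 0;
  inorm : coef_norm p <= C;
  islope : d <= e2.2 - p`_1 * e1.2 }.

Lemma dir_bound e X Y z : small_dir e -> `|X| <= z -> `|Y| <= z ->
  `|X * e.1 + Y * e.2| <= 2 * z.
Proof.
move=> [h1 h2] hX hY; rewrite (le_trans (ler_normD _ _))// !normrM mulrDl mul1r.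
have z0 : 0 <= z by rewrite (le_trans _ hX).
by rewrite lerD// -[leRHS]mulr1 ler_pM.
Qed.

(** Near the origin, [implicit_eq] differs from a function of slope
    [e2.2 - p`_1 * e1.2] in [Y] by a perturbation of small Lipschitz constant. *)
Lemma implicit_eq_lip n C e1 e2 p X Y Y' z : small_dir e1 ->
  (size p <= n)%N -> coef_norm p <= C ->
  `|X| <= z -> `|Y| <= z -> `|Y'| <= z -> 2 * z <= 1 ->
  `|implicit_eq e1 e2 p X Y - implicit_eq e1 e2 p X Y'
    - (e2.2 - p`_1 * e1.2) * (Y - Y')| <= n.+1%:R * C * (2 * z) * `|Y - Y'|.
Proof.
move=> se1 pn pC hX hY hY' z1.
have w1 := dir_bound se1 hX hY; have w2 := dir_bound se1 hX hY'.
have := horner_linear_approx pn w1 w2 z1.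
set w := X * _ + _; set w' := X * _ + _ => h.
have ww' : w - w' = (Y - Y') * e1.2 by rewrite /w /w'; ring.
have -> : implicit_eq e1 e2 p X Y - implicit_eq e1 e2 p X Y'
    - (e2.2 - p`_1 * e1.2) * (Y - Y') = - (p.[w] - p.[w'] - p`_1 * (w - w')).
  by rewrite ww' /implicit_eq -/w -/w'; ring.
rewrite normrN (le_trans h)// ww' normrM.
have z0 : 0 <= z by rewrite (le_trans _ hX).
rewrite -!mulrA ler_wpM2l// ler_pM ?coef_norm_ge0 ?mulr_ge0//.
by rewrite ler_wpM2l// ler_wpM2l// ler_piMr//; case: se1.
Qed.

Definition implicit_poly e1 e2 p q : {poly R} :=
  e2.1 *: 'X + e2.2 *: q - (p \Po (e1.1 *: 'X + e1.2 *: q)).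

Lemma implicit_polyE e1 e2 p q X :
  (implicit_poly e1 e2 p q).[X] = implicit_eq e1 e2 p X q.[X].
Proof.
rewrite /implicit_poly /implicit_eq hornerD hornerN hornerD !hornerZ hornerX horner_comp hornerD !hornerZ hornerX.
by congr (_ - p.[_]); ring.
Qed.

Lemma implicit_poly_norm n C e1 e2 p q (B : R) : small_dir e1 -> small_dir e2 ->
  (size p <= n)%N -> coef_norm p <= C -> coef_norm q <= B -> 1 <= B ->
  coef_norm (implicit_poly e1 e2 p q) <= 1 + B + C * (1 + B) ^+ n.
Proof.
move=> se1 se2 pn pC qB B1.
have lin e : small_dir e -> coef_norm (e.1 *: 'X + e.2 *: q) <= 1 + B.
  move=> [h1 h2]; rewrite (le_trans (coef_normD _ _))// !coef_normZ coef_normX mulr1.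
  by rewrite lerD// -[leRHS]mul1r ler_pM ?coef_norm_ge0.
rewrite /implicit_poly (le_trans (coef_normD _ _))// coef_normN lerD// ?lin//.
rewrite (le_trans (@coef_norm_comp _ n _ _ (1 + B) pn _ (lin _ se1)))//; first lra.
by rewrite ler_wpM2r// exprn_ge0//; lra.
Qed.

(** Newton's iteration with the frozen slope [e2.2 - p`_1 * e1.2]: each step
    raises by one the order at which the implicit equation is solved. *)
Lemma implicit_iter n C d m : 0 < C -> 0 < d ->
  exists B rho, [/\ 1 <= B, 0 < rho, rho <= 1 &
   forall e1 e2 p, implicit_data n C d e1 e2 p ->
   exists q, [/\ q.[0] = 0, coef_norm q <= B &
     forall X, `|X| <= rho -> `|implicit_eq e1 e2 p X q.[X]| <= B * `|X| ^+ m.+1]].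
Proof.
move=> C0 d0; elim: m => [|m [B [rho [B1 rho0 rho1 IH]]]].
  exists (1 + C), 1; split => //; first lra.
  move=> e1 e2 p [se1 se2 pn p0 pC sl]; exists 0; split.
  - by rewrite horner0.
  - by rewrite coef_norm0; lra.
  - move=> X X1; rewrite horner0 /implicit_eq !mul0r !addr0 expr1 mulrDl mul1r.
    case: se1 se2 => h1 _ [h2 _].
    have X1' : `|X * e1.1| <= 1 by rewrite normrM -[leRHS]mulr1 ler_pM.
    rewrite (le_trans (ler_normB _ _))// lerD//.
      by rewrite normrM ler_piMr.
    rewrite (le_trans (coef_norm_horner0 p0 X1'))// ler_pM ?coef_norm_ge0//.
    by rewrite normrM ler_piMr.
(* [B1'] bounds the residual polynomial, [B2] the new iterate, and [B3] the new
   residual. *)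
pose B1' := 1 + B + C * (1 + B) ^+ n.
pose B2 := B + d^-1 * B1'.
have B1'0 : 0 < B1' by rewrite /B1' ltr_wpDr ?mulr_ge0 ?exprn_ge0//; lra.
have B2B : B <= B2 by rewrite /B2 lerDl mulr_ge0// ?invr_ge0 ltW.
pose B3 := n.+1%:R * C * (2 * B2) * (d^-1 * B).
have B30 : 0 <= B3 by rewrite /B3 !mulr_ge0 ?invr_ge0//; lra.
exists (B2 + B3), (Num.min rho (2 * B2)^-1); split.
- lra.
- by rewrite lt_min rho0 invr_gt0; lra.
- by rewrite ge_min rho1.
move=> e1 e2 p D; have [se1 se2 pn p0 pC sl] := D.
have [q [q0 qB qX]] := IH _ _ _ D.
set s := e2.2 - _ in sl.
have s0 : 0 < s by exact: lt_le_trans sl.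
have si0 : 0 <= s^-1 by rewrite invr_ge0 ltW.
have sd : s^-1 <= d^-1 by rewrite lef_pV2.
pose Gq := implicit_poly e1 e2 p q.
exists (q - s^-1 *: Gq); split.
- by rewrite hornerD hornerN hornerZ implicit_polyE q0 /implicit_eq !mul0r !addr0 p0 subr0 mulr0 subr0.
- rewrite (le_trans (coef_normD _ _))// coef_normN coef_normZ.
  rewrite (@le_trans _ _ B2) ?lerDl// /B2 lerD//.
  rewrite ger0_norm// ler_pM ?coef_norm_ge0//.
  exact: implicit_poly_norm.
move=> X; rewrite le_min => /andP[Xr X2].
have X1 : `|X| <= 1 by exact: le_trans rho1.
set q' := q - _.
have q'E : q'.[X] = q.[X] - s^-1 * implicit_eq e1 e2 p X q.[X].
  by rewrite hornerD hornerN hornerZ implicit_polyE.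
have q'0 : q'.[0] = 0.
  by rewrite hornerD hornerN hornerZ implicit_polyE q0 /implicit_eq !mul0r !addr0 p0 subr0 mulr0 subr0.
have q'B : coef_norm q' <= B2.
  rewrite (le_trans (coef_normD _ _))// coef_normN coef_normZ /B2 lerD//.
  rewrite ger0_norm// ler_pM ?coef_norm_ge0//.
  exact: implicit_poly_norm.
have hq' : `|q'.[X]| <= B2 * `|X|.
  by rewrite (le_trans (coef_norm_horner0 q'0 X1))// ler_wpM2r.
have hq : `|q.[X]| <= B2 * `|X|.
  by rewrite (le_trans (coef_norm_horner0 q0 X1))// ler_wpM2r// (le_trans qB).
have hX : `|X| <= B2 * `|X| by rewrite ler_peMl//; lra.
have z1 : 2 * (B2 * `|X|) <= 1.
  by rewrite mulrA -ler_pdivlMl ?mulr1//; lra.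
have := implicit_eq_lip e2 se1 pn pC hX hq' hq z1.
rewrite -/s; set G := implicit_eq _ _ _; move=> h.
have qq : q'.[X] - q.[X] = - (s^-1 * G X q.[X]) by rewrite q'E -/G; ring.
have sG : s * (q'.[X] - q.[X]) = - G X q.[X] by rewrite qq mulrN mulrA divff ?mul1r ?gt_eqF.
rewrite sG opprK subrK in h; rewrite (le_trans h)// qq normrN normrM.
rewrite gtr0_norm ?invr_gt0//.
have hG : s^-1 * `|G X q.[X]| <= d^-1 * B * `|X| ^+ m.+1.
  by rewrite -mulrA ler_pM ?qX.
apply: (@le_trans _ _ (B3 * `|X| ^+ m.+2)); last first.
  by rewrite ler_wpM2r ?exprn_ge0//; lra.
rewrite (@le_trans _ _ (n.+1%:R * C * (2 * (B2 * `|X|)) * (d^-1 * B * `|X| ^+ m.+1)))//.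
  by rewrite ler_wpM2l// !mulr_ge0//; lra.
rewrite /B3 [_ ^+ m.+2]exprS le_eqVlt; apply/orP; left; apply/eqP.
by set t := `|X| ^+ m.+1; set u := d^-1; ring.
Qed.

(** The truncation of the iterates above to degree less than [n] still solves
    the equation to order [n]; monotonicity in [Y] then locates the level sets. *)
Lemma implicit_squeeze n (C d r : R) : 0 < C -> 0 < d -> 0 < r -> r <= n%:R -> (0 < n)%N ->
  exists B rho, [/\ 1 <= B, 0 < rho, rho <= 1 &
   forall e1 e2 p, implicit_data n C d e1 e2 p ->
   exists q, [/\ (size q <= n)%N, q.[0] = 0, coef_norm q <= B &
     forall z X Y, 0 <= z -> z <= rho -> `|X| <= z -> `|Y| <= z ->
       (Y <= q.[X] - B * z `^ r ->
          implicit_eq e1 e2 p X Y <= - (C * (2 * z) `^ r)) /\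
       (q.[X] + B * z `^ r < Y ->
          C * (2 * z) `^ r < implicit_eq e1 e2 p X Y)]].
Proof.
move=> C0 d0 r0 rn n0.
have [B [rho [B1 rho0 rho1 HB]]] := @implicit_iter n C d n.-1 C0 d0.
rewrite prednK// in HB.
(* [L] bounds the effect of the truncation on the residual. With [MON], a
   displacement [y] in [Y] changes the level by at least [d / 2 * y], so that [B'] is
   the displacement that outweighs the residual and the prescribed level. *)
pose L := (1 + C + n.+1%:R * C) * B.
have nC0 : 0 <= n.+1%:R * C by rewrite mulr_ge0 ?ltW.
have L0 : 0 <= L by rewrite /L mulr_ge0//; lra.
have P2r : 0 < 2 `^ r :> R by rewrite powR_gt0.
pose B' := B + (2 / d) * (B + L + C * 2 `^ r).
have CP0 : 0 <= C * 2 `^ r by rewrite mulr_ge0//; exact: ltW.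
have d20 : 0 <= 2 / d by rewrite divr_ge0//; exact: ltW.
have B0 : 0 <= B by exact: le_trans B1.
have BB' : B <= B' by rewrite /B' lerDl mulr_ge0//; lra.
have B'0 : 0 <= B' by exact: le_trans BB'.
(* For [z] below [nu], the perturbation in [implicit_eq_lip] is at most half the slope. *)
pose nu := Num.min (4 * B)^-1 (d / (4 * (n.+1%:R * C * B + 1))).
have K0 : 0 < 4 * (n.+1%:R * C * B + 1).
  by rewrite mulr_gt0// ltr_wpDl// mulr_ge0//; lra.
exists B', (Num.min rho nu); split.
- lra.
- by rewrite !lt_min rho0 invr_gt0 divr_gt0// andbT/=; lra.
- by rewrite ge_min rho1.
move=> e1 e2 p D; have [se1 se2 pn p0 pC sl] := D.
have [q [q0 qB qX]] := HB _ _ _ D.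
set s := e2.2 - _ in sl.
have s0 : 0 < s by exact: lt_le_trans sl.
have sC : s <= 1 + C.
  rewrite /s; have [_ h1] := se1; have [_ h2] := se2.
  have p1 : `|p`_1| <= C.
    rewrite (le_trans _ pC)// (coef_normE (leqW (leqnSn (size p)))).
    rewrite (bigD1 (inord 1)) //= inordK// lerDl.
    by apply: sumr_ge0.
  have := ler_pM (normr_ge0 _) (normr_ge0 _) p1 h1; rewrite mulr1 -normrM.
  by move: h2; rewrite !ler_norml => /andP[_ h2] /andP[h3 _]; lra.
pose t := take_poly n q.
have t0 : t.[0] = 0.
  move: q0; rewrite !horner_coef0 /t coef_take_poly => ->.
  by case: ifP.
have tB : coef_norm t <= B by rewrite (le_trans (coef_norm_take _ _)).
exists t; split => //; first exact: size_take_poly.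
  by rewrite (le_trans tB).
move=> z X Y z0; rewrite !le_min => /andP[zr /andP[z1 z2]] hX hY.
have zle1 : z <= 1 by exact: le_trans rho1.
have X1 : `|X| <= 1 by exact: le_trans zle1.
have ht : `|t.[X]| <= B * z.
  by rewrite (le_trans (coef_norm_horner0 t0 X1))// ler_pM ?coef_norm_ge0.
have hq : `|q.[X]| <= B * z.
  by rewrite (le_trans (coef_norm_horner0 q0 X1))// ler_pM ?coef_norm_ge0.
have zB : z <= B * z by rewrite ler_peMl.
have hX' : `|X| <= B * z by exact: le_trans zB.
have hY' : `|Y| <= B * z by exact: le_trans zB.
have Bz0 : 0 <= B * z by exact: le_trans zB.
have Bz : 4 * (B * z) <= 1.
  rewrite mulrA -ler_pdivlMl ?mulr1//; last by rewrite mulr_gt0// (lt_le_trans ltr01).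
have Bz1 : 2 * (B * z) <= 1 by clear - Bz Bz0; lra.
have Kz : n.+1%:R * C * (2 * (B * z)) <= d / 2.
  move: z2; rewrite ler_pdivlMr//; set u := n.+1%:R * C => z2.
  by clear - z0 z2; lra.
have LIP Y1 Y2 : `|Y1| <= B * z -> `|Y2| <= B * z ->
    `|implicit_eq e1 e2 p X Y1 - implicit_eq e1 e2 p X Y2 - s * (Y1 - Y2)|
      <= d / 2 * `|Y1 - Y2|.
  move=> h1 h2; rewrite (le_trans (implicit_eq_lip e2 se1 pn pC hX' h1 h2 Bz1))//.
  by rewrite ler_wpM2r.
have MON Y1 Y2 : `|Y1| <= B * z -> `|Y2| <= B * z -> Y1 <= Y2 ->
    d / 2 * (Y2 - Y1) <= implicit_eq e1 e2 p X Y2 - implicit_eq e1 e2 p X Y1.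
  move=> h1 h2 h12; have := LIP _ _ h2 h1.
  rewrite [`|Y2 - Y1|]ger0_norm ?subr_ge0// ler_norml => /andP[h3 _].
  have : d * (Y2 - Y1) <= s * (Y2 - Y1) by rewrite ler_wpM2r// subr_ge0.
  by move: h3; set a := implicit_eq _ _ _ _ _ - _; set b := Y2 - Y1; clear; lra.
have zn : `|X| ^+ n <= z `^ r.
  have [z00|zn0] := eqVneq z 0.
    have -> : X = 0 by apply/eqP; rewrite -normr_le0 -z00.
    by rewrite normr0 expr0n gtn_eqF// powR_ge0.
  have zp : 0 < z by rewrite lt_neqAle eq_sym zn0.
  rewrite (@le_trans _ _ (z ^+ n))//; first by rewrite lerXn2r ?nnegrE.
  by rewrite -powR_mulrn// ger_powR// zp.
have GT : `|implicit_eq e1 e2 p X t.[X]| <= (B + L) * z `^ r.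
  have h1 : `|t.[X] - q.[X]| <= B * z `^ r.
    rewrite distrC (le_trans (horner_take n q X1))// ler_pM ?coef_norm_ge0 ?exprn_ge0//.
  have h2 : `|implicit_eq e1 e2 p X q.[X]| <= B * z `^ r.
    by rewrite (le_trans (qX _ (le_trans hX zr)))// ler_wpM2l.
  have h3 := implicit_eq_lip e2 se1 pn pC hX' ht hq Bz1.
  have h4 : n.+1%:R * C * (2 * (B * z)) * `|t.[X] - q.[X]| <= n.+1%:R * C * (B * z `^ r).
    rewrite -mulrA ler_wpM2l//; apply: (le_trans _ h1).
    by rewrite ler_piMl.
  have h5 : `|s * (t.[X] - q.[X])| <= (1 + C) * (B * z `^ r).
    by rewrite normrM ler_pM// gtr0_norm.
  have -> : implicit_eq e1 e2 p X t.[X] = implicit_eq e1 e2 p X q.[X]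
     + s * (t.[X] - q.[X]) + (implicit_eq e1 e2 p X t.[X] - implicit_eq e1 e2 p X q.[X] - s * (t.[X] - q.[X])) by ring.
  rewrite (le_trans (ler_normD _ _))//.
  have := ler_normD (implicit_eq e1 e2 p X q.[X]) (s * (t.[X] - q.[X])).
  move: (le_trans h3 h4) h5 h2; rewrite -/s /L.
  set a := `|_ - _ - _|; set b := `|s * _|; set c := `|_ + _|; set e := `|implicit_eq _ _ _ _ _|.
  set w := z `^ r.
  have -> : (B + (1 + C + n.+1%:R * C) * B) * w = B * w + (1 + C) * (B * w) + n.+1%:R * C * (B * w) by ring.
  by clear; lra.
have E2 : (2 * z) `^ r = 2 `^ r * z `^ r by rewrite powRM.
have zr0 : 0 <= z `^ r by exact: powR_ge0.
have key : d / 2 * (B' * z `^ r) = d / 2 * B * z `^ r + (B + L) * z `^ r + C * (2 * z) `^ r.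
  rewrite E2 /B'; set u := z `^ r; set v := 2 `^ r.
  by field; rewrite gt_eqF.
have dB : 0 <= d / 2 * B * z `^ r by do 2!apply: mulr_ge0 => //; rewrite ltW// divr_gt0.
move: GT; rewrite ler_norml => /andP[G1 G2]; split => hYt.
  have hm : Y <= t.[X] by rewrite (le_trans hYt)// gerBl mulr_ge0.
  have := MON _ _ hY' ht hm.
  have : d / 2 * (B' * z `^ r) <= d / 2 * (t.[X] - Y).
    by rewrite ler_wpM2l ?divr_ge0 ?(ltW d0)// lerBrDr -lerBrDl; clear - hYt; lra.
  by rewrite key; clear - G2 dB; lra.
have hm : t.[X] <= Y by rewrite (le_trans _ (ltW hYt))// lerDl mulr_ge0.
have := MON _ _ ht hY' hm.
have : d / 2 * (B' * z `^ r) < d / 2 * (Y - t.[X]).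
  by rewrite ltr_pM2l ?divr_gt0//; clear - hYt; lra.
by rewrite key; clear - G1 dB; lra.
Qed.

End Implicit.

(** * Polynomials and their averages over consecutive intervals *)

Section Averages.
Context {R : realType}.
Implicit Types (p q P : {poly R}) (x y z h : R) (n m : nat).

Lemma primitive_exists p : exists P, P^`() = p /\ (size P <= (size p).+1)%N.
Proof.
pose P := \poly_(i < (size p).+1) (p`_i.-1 / i%:R).
exists P; split; last exact: size_poly.
apply/polyP => i; rewrite coef_deriv coef_poly ltnS /=.
case: ltnP => hi; last by rewrite mul0rn nth_default.
by rewrite -[LHS]mulr_natr divfK// pnatr_eq0.
Qed.

Lemma horner_bounded p z : exists K, 0 <= K /\ forall x, `|x| <= z -> `|p.[x]| <= K.
Proof.
exists (\sum_(i < size p) `|p`_i| * `|z| ^+ i); split.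
  by apply: sumr_ge0 => i _; rewrite mulr_ge0 ?exprn_ge0.
move=> x xz; rewrite horner_coef (le_trans (ler_norm_sum _ _ _))//.
apply: ler_sum => i _; rewrite normrM normrX ler_wpM2l// lerXn2r ?nnegrE//.
by rewrite (le_trans xz)// ler_norm.
Qed.

Definition node_lagrange n (i : 'I_n.+1) : {poly R} :=
  tnth (lagrange n.+1 (fun m => m%:R : R)) i.

Lemma node_lagrangeE n (i j : 'I_n.+1) : (node_lagrange i).[j%:R] = (i == j)%:R.
Proof. by rewrite lagrange_sample// => a b /eqP; rewrite eqr_nat => /eqP. Qed.

Lemma node_lagrange_gen n p : (size p <= n.+1)%N ->
  p = \sum_(i < n.+1) p.[i%:R] *: node_lagrange i.
Proof.
move=> sp; rewrite {1}(@lagrange_gen _ n.+1 (fun m => m%:R : R) _ _ p sp)//.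
  by apply: eq_bigr => i _; rewrite mul_polyC.
by move=> a b /eqP; rewrite eqr_nat => /eqP.
Qed.

Lemma size_node_lagrange n (i : 'I_n.+1) : size (node_lagrange i) = n.+1.
Proof. by rewrite size_lagrange_// => a b /eqP; rewrite eqr_nat => /eqP. Qed.

(** At the ends of the cells, the primitive vanishing at the first one is a sum of
    averages times [h]. It is interpolated there by Lagrange polynomials, whose
    derivatives are bounded independently of [h] after rescaling to the nodes
    0, ..., [n]. *)
Lemma averages_stable n : exists K, 0 <= K /\
  forall p P x0 h e, 0 < h -> (size P <= n.+1)%N -> P^`() = p -> 
  (forall m, (m < n)%N ->
     `|P.[x0 + m.+1%:R * h] - P.[x0 + m%:R * h]| <= h * e) ->
  forall t, 0 <= t <= n%:R -> `|p.[x0 + t * h]| <= K * e.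
Proof.
have /choice[K HK] : forall i : 'I_n.+1, exists K, 0 <= K /\ forall x, `|x| <= n%:R ->
   `|(node_lagrange i)^`().[x]| <= K.
  by move=> i; exact: horner_bounded.
exists (n%:R * \sum_i K i); split.
  by rewrite mulr_ge0// sumr_ge0// => i _; case: (HK i).
move=> p P x0 h e h0 sP Pp He t /andP[t0 tn].
pose P1 := (P \Po (h *: 'X + x0%:P)) - P.[x0]%:P.
have P1E y : P1.[y] = P.[x0 + y * h] - P.[x0].
  by rewrite hornerD hornerN hornerC horner_comp hornerD hornerZ hornerX hornerC addrC [x0 + _]addrC [h * y]mulrC addrC.
have sP1 : (size P1 <= n.+1)%N.
  rewrite (leq_trans (size_polyD _ _))// geq_max size_polyN (leq_trans (size_polyC_leq1 _))// andbT.
  have s2 : size (h *: 'X + x0%:P) = 2%N.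
    by rewrite -mul_polyC size_MXaddC polyC_eq0 gt_eqF//= size_polyC gt_eqF.
  by rewrite (leq_trans _ sP)// size_comp_poly2.
have P1m m : (m <= n)%N -> `|P1.[m%:R]| <= m%:R * (h * e).
  elim: m => [|m IHm] mn; first by rewrite P1E !mul0r addr0 subrr normr0.
  have -> : P1.[m.+1%:R] = P1.[m%:R] + (P.[x0 + m.+1%:R * h] - P.[x0 + m%:R * h]).
    by rewrite !P1E; ring.
  rewrite (le_trans (ler_normD _ _))// -[m.+1%:R in leRHS]natr1 mulrDl mul1r lerD//.
    by apply: IHm; exact: ltnW.
  exact: He.
have he0 : (0 < n)%N -> 0 <= h * e.
  by move=> n0; rewrite (le_trans _ (He _ n0)).
have dP1 : P1^`().[t] = h * p.[x0 + t * h].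
  rewrite /P1 derivB derivC subr0 deriv_comp Pp hornerM horner_comp derivD derivZ derivX derivC addr0.
  by rewrite hornerD !hornerZ hornerX !hornerC mulr1 [LHS]mulrC [h * t]mulrC addrC.
have : `|P1^`().[t]| <= n%:R * (\sum_i K i) * (h * e).
  rewrite {1}(node_lagrange_gen sP1) raddf_sum /= horner_sum.
  rewrite (le_trans (ler_norm_sum _ _ _))// mulrAC mulr_sumr; apply: ler_sum => i _.
  rewrite derivZ hornerZ normrM ler_pM//.
    rewrite (le_trans (P1m _ _)) ?leq_ord//.
    case: (posnP n) => [n00|n0]; last by rewrite ler_wpM2r ?he0// ler_nat leq_ord.
    have i0 : (i : nat) = 0%N by apply/eqP; rewrite -leqn0 -[X in (_ <= X)%N]n00 leq_ord.
    by rewrite i0 mul0r (_ : n%:R = 0) ?mul0r// n00.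
  by apply: (HK i).2; rewrite ger0_norm.
rewrite dP1 normrM gtr0_norm// [h * e]mulrC mulrA [h * _]mulrC ler_pM2r//.
Qed.

(** The increments of a primitive between consecutive nodes are prescribed, and the
    primitive can be interpolated. *)
Lemma averages_exist n x0 h (c : nat -> R) : 0 < h -> (0 < n)%N ->
  exists p P, [/\ (size p <= n)%N, P^`() = p &
    forall m, (m < n)%N -> P.[x0 + m.+1%:R * h] - P.[x0 + m%:R * h] = c m].
Proof.
move=> h0 n0.
pose P1 := \sum_(i < n.+1) (\sum_(l < i) c l) *: node_lagrange i.
have P1E m : (m <= n)%N -> P1.[m%:R] = \sum_(l < m) c l.
  move=> mn; rewrite horner_sum (bigD1 (Ordinal (mn : (m < n.+1)%N)))//= hornerZ.
  rewrite (node_lagrangeE _ (Ordinal (mn : (m < n.+1)%N))) eqxx mulr1.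
  rewrite [X in _ + X]big1 ?addr0// => i im; rewrite hornerZ (node_lagrangeE _ (Ordinal (mn : (m < n.+1)%N))).
  by rewrite (negbTE im) mulr0.
have sP1 : (size P1 <= n.+1)%N.
  rewrite (leq_trans (size_sum _ _ _))//; apply/bigmax_leqP => i _.
  by rewrite (leq_trans (size_scale_leq _ _))// size_node_lagrange.
pose P := P1 \Po (h^-1 *: 'X + (- x0 / h)%:P).
have PE t : P.[x0 + t * h] = P1.[t].
  rewrite horner_comp hornerD hornerZ hornerX hornerC; congr (_.[_]).
  by field; rewrite gt_eqF.
have sP : (size P <= n.+1)%N.
  rewrite (leq_trans _ sP1)// size_comp_poly2//.
  by rewrite -mul_polyC size_MXaddC polyC_eq0 invr_eq0 gt_eqF//= size_polyC invr_eq0 gt_eqF.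
exists P^`(), P; split => //.
  have [->|Pn0] := eqVneq P 0; first by rewrite deriv0 size_poly0.
  by rewrite -ltnS (leq_trans (lt_size_deriv Pn0)).
move=> m mn; rewrite !PE P1E// P1E; last exact: ltnW.
by rewrite big_ord_recr /= [LHS]addrAC subrr add0r.
Qed.

End Averages.

(** * Taylor polynomials of Hoelder functions *)

Section Holder.
Context {R : realType}.
Implicit Types (s r M : R) (psi : R -> R).

Lemma top_order_bounds s : 1 <= s ->
  (top_order s)%:R < s /\ s <= (top_order s).+1%:R.
Proof.
move=> s1.
have c1 : (0 < Num.ceil s)%R by rewrite ceil_gt0 (lt_le_trans ltr01).
have cE : Num.ceil s = (top_order s).+1%:Z.
  by rewrite /top_order prednK ?absz_gt0 ?gt_eqF// gtz0_abs.
have /andP[] := ceil_itv s; rewrite cE.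
have -> : (top_order s).+1%:Z - 1 = (top_order s)%:Z by lia.
by [].
Qed.

Lemma holder_norm_bounds s r psi M : 0 < r ->
  (holder_norm s r psi <= M%:E)%E ->
  (forall j x, (j <= top_order s)%N -> x \in `]-r, r[ -> `|derive1n j psi x| <= M) /\
  (forall x t, x \in `]-r, r[ -> t \in `]-r, r[ ->
     `|derive1n (top_order s) psi x - derive1n (top_order s) psi t|
       <= M * `|x - t| `^ (s - (top_order s)%:R)).
Proof.
move=> r0; rewrite /holder_norm; set S1 := ereal_sup _; set S2 := ereal_sup _ => h.
have x0 : (0 : R) \in `]-r, r[ by rewrite in_itv/= oppr_lt0 r0.
have S10 : (0 <= S1)%E.
  apply: (@le_trans _ _ (`|derive1n 0 psi 0|%:E)).
    by rewrite lee_fin.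
  by apply: ereal_sup_ubound; exists (0%N, 0).
have S20 : (0 <= S2)%E.
  set m := top_order s.
  apply: (@le_trans _ _ ((`|0 - r / 2| `^ (m%:R - s) *
         `|derive1n m psi 0 - derive1n m psi (r / 2)|)%R%:E)).
    by rewrite lee_fin mulr_ge0 ?powR_ge0.
  apply: ereal_sup_ubound; exists (0, r / 2) => //; split => //=.
    by rewrite in_itv/=; apply/andP; split; lra.
  by rewrite lt_eqF// divr_gt0.
have h1 : (S1 <= M%:E)%E by apply: le_trans h; rewrite leeDl.
have h2 : (S2 <= M%:E)%E by apply: le_trans h; rewrite leeDr.
have M0 : 0 <= M by rewrite -lee_fin (le_trans S10).
split=> [j x jm xr|x t xr tr].
  by rewrite -lee_fin (le_trans _ h1)//; apply: ereal_sup_ubound; exists (j, x).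
have [->|xt] := eqVneq x t.
  by rewrite subrr normr0 mulr_ge0 ?powR_ge0.
have : ((`|x - t| `^ ((top_order s)%:R - s) *
    `|derive1n (top_order s) psi x - derive1n (top_order s) psi t|)%R%:E <= M%:E)%E.
  by rewrite (le_trans _ h2)//; apply: ereal_sup_ubound; exists (x, t).
rewrite lee_fin -[_%:R - s]opprB powRN => hM.
have p0 : 0 < `|x - t| `^ (s - (top_order s)%:R).
  by apply: powR_gt0; rewrite normr_gt0 subr_eq0.
by rewrite mulrC -ler_pdivrMl// mulrC.
Qed.

Lemma MVT_open (r : R) (f : R -> R) (x y : R) :
  (forall z, z \in `]-r, r[ -> derivable f z 1) ->
  x \in `]-r, r[ -> y \in `]-r, r[ ->
  exists2 c, Num.min x y <= c <= Num.max x y & f y - f x = derive1 f c * (y - x).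
Proof.
move=> df.
wlog xy : x y / x <= y.
  move=> W xr yr; have [xy|/ltW yx] := leP x y; first by have := W x y xy xr yr; rewrite min_l// max_r.
  have [c hc e] := W y x yx yr xr; exists c.
    by move: hc; rewrite min_l// max_r.
  by rewrite -opprB e; ring.
rewrite !in_itv/= => /andP[x1 x2] /andP[y1 y2].
have dz z : z \in `[x, y] -> derivable f z 1.
  rewrite in_itv/= => /andP[z1 z2]; apply: df; rewrite in_itv/=.
  by rewrite (lt_le_trans x1)// (le_lt_trans z2).
have [||c cxy e] := @MVT_segment R f (derive1 f) x y xy.
- move=> z zxy; apply: DeriveDef; last by rewrite derive1E.
  by apply: dz; apply: subset_itv_oo_cc zxy.
- apply: derivable_within_continuous => z; exact: dz.
by exists c => //; move: cxy; rewrite in_itv/= (min_idPl xy) (max_idPr xy).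
Qed.

(** Taylor's formula by successive integrations: a bound on the remainder of
    [f^`()] integrates to one on the remainder of [f], by the mean value theorem. *)
Lemma taylor_poly (r M sg : R) (n : nat) (f : R -> R) : 0 < r -> 0 <= M -> 0 <= sg ->
  (forall j x, (j < n)%N -> x \in `]-r, r[ -> derivable (derive1n j f) x 1) ->
  (forall j x, (j <= n)%N -> x \in `]-r, r[ -> `|derive1n j f x| <= M) ->
  (forall x, x \in `]-r, r[ ->
     `|derive1n n f x - derive1n n f 0| <= M * `|x| `^ sg) ->
  exists p : {poly R}, [/\ (size p <= n.+1)%N, coef_norm p <= n.+1%:R * M &
    forall x, x \in `]-r, r[ -> `|f x - p.[x]| <= M * `|x| `^ (sg + n%:R)].
Proof.
move=> r0 M0 sg0 df bf hf.
have x0 : (0 : R) \in `]-r, r[ by rewrite in_itv/= oppr_lt0 r0.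
suff H i : (i <= n)%N -> exists p : {poly R}, [/\ (size p <= i.+1)%N, coef_norm p <= i.+1%:R * M &
    forall x, x \in `]-r, r[ -> `|derive1n (n - i) f x - p.[x]| <= M * `|x| `^ (sg + i%:R)].
  by have := H n (leqnn n); rewrite subnn.
elim: i => [_|i IHi ni].
  exists (derive1n n f 0)%:P; rewrite subn0 addr0 size_polyC_leq1; split => //.
    by rewrite (coef_normE (size_polyC_leq1 _)) big_ord1 coefC eqxx mul1r bf.
  by move=> x xr; rewrite hornerC hf.
have [q [sq nq hq]] := IHi (ltnW ni).
set m := (n - i.+1)%N.
have mE : (n - i)%N = m.+1 by rewrite /m; lia.
have mn : (m < n)%N by rewrite /m; lia.
have [Q [QD sQ]] := primitive_exists q.
pose p := Q + (derive1n m f 0 - Q.[0])%:P.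
have pD : p^`() = q by rewrite derivD derivC addr0.
have p0 : p.[0] = derive1n m f 0 by rewrite hornerD hornerC addrC subrK.
have sp : (size p <= i.+2)%N.
  rewrite (leq_trans (size_polyD _ _))// geq_max (leq_trans sQ)//=.
  by rewrite (leq_trans (size_polyC_leq1 _)).
exists p; split => //.
  rewrite (coef_normE sp) big_ord_recl /= -[i.+2%:R]natr1 mulrDl mul1r addrC lerD//.
    rewrite (le_trans _ nq)// (coef_normE sq); apply: ler_sum => j _.
    rewrite /bump /= add1n -pD coef_deriv normrMn.
    by rewrite mulrS lerDl mulrn_wge0.
  by rewrite -horner_coef0 p0 bf// ltnW.
move=> x xr.
have dg z : z \in `]-r, r[ -> derivable (derive1n m f \- horner p) z 1.
  by move=> zr; apply: derivableB; [exact: df|exact: derivable_horner].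
have [c /andP[c1 c2] e] := MVT_open dg x0 xr.
have cx : `|c| <= `|x|.
  move: c1 c2; rewrite /Num.min /Num.max; case: ltP => x1 c1 c2.
    by rewrite !ger0_norm// ltW// (lt_le_trans x1).
  by rewrite !ler0_norm// lerN2.
have cr : c \in `]-r, r[.
  by move: xr; rewrite !in_itv/= -!ltr_norml; exact: le_lt_trans.
move: e; rewrite /= p0 subrr !subr0 => ->.
have -> : derive1 (derive1n m f \- horner p) c = derive1n m.+1 f c - q.[c].
  rewrite derive1E deriveB; [|exact: df|exact: derivable_horner].
  by rewrite -!derive1E -derivE pD derive1nS.
rewrite normrM (le_trans (ler_wpM2r _ (_ : _ <= M * `|x| `^ (sg + i%:R))))//.
  rewrite -mE (le_trans (hq _ cr))// ler_wpM2l// ge0_ler_powR ?nnegrE//.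
  by rewrite addr_ge0.
have [->|xn0] := eqVneq x 0; first by rewrite normr0 mulr0 mulr_ge0 ?powR_ge0.
rewrite -mulrA ler_wpM2l// -natr1 addrA [in leRHS]powRD ?powRr1//.
by apply/implyP => _; rewrite normr_eq0.
Qed.

(** If [2 * k] is below the top order, the expansion stops at degree [2 * k] and the
    bound on the next derivative replaces the Hoelder condition. *)
Lemma Cs_taylor (k : nat) s r M psi : 1 <= s -> 0 < r -> is_Cs s r psi ->
  (holder_norm s r psi <= M%:E)%E ->
  exists p : {poly R}, [/\ (size p <= (2 * k).+1)%N, coef_norm p <= (2 * k).+1%:R * M &
    forall x, x \in `]-r, r[ ->
      `|psi x - p.[x]| <= M * `|x| `^ (Num.min s (2 * k + 1)%:R)].
Proof.
move=> s1 r0 [_ dpsi _] hM.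
have [b1 b2] := holder_norm_bounds r0 hM.
have [t1 t2] := top_order_bounds s1.
have x0 : (0 : R) \in `]-r, r[ by rewrite in_itv/= oppr_lt0 r0.
have M0 : 0 <= M by rewrite (le_trans _ (b1 0%N 0 _ x0)).
have [mk|km] := leqP (top_order s) (2 * k).
  have -> : Num.min s (2 * k + 1)%:R = s.
    by apply/min_idPl; rewrite (le_trans t2)// ler_nat addn1 ltnS.
  have [||p [sp np hp]] := @taylor_poly r M (s - (top_order s)%:R) (top_order s) psi r0 M0 _ dpsi b1 _.
  - by rewrite subr_ge0 ltW.
  - by move=> x xr; rewrite (le_trans (b2 _ _ xr x0))// subr0.
  - exists p; split.
    + by rewrite (leq_trans sp).
    + by rewrite (le_trans np)// ler_wpM2r// ler_nat ltnS.
    + by move=> x /hp; rewrite subrK.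
have -> : Num.min s (2 * k + 1)%:R = (2 * k + 1)%:R.
  apply/min_idPr; rewrite (le_trans _ (ltW t1))// ler_nat addn1//.
have [|||p [sp np hp]] := @taylor_poly r M 1 (2 * k) psi r0 M0 ler01 _ _ _.
- by move=> j x jk; apply: dpsi; rewrite (ltn_trans jk).
- by move=> j x jk; apply: b1; rewrite (leq_trans jk)// ltnW.
- move=> x xr.
  have [c /andP[c1 c2] e] := MVT_open (fun z zr => dpsi _ z km zr) x0 xr.
  have cr : c \in `]-r, r[.
    move: c1 c2 xr; rewrite /Num.min /Num.max !in_itv/=; case: ltP => h c1 c2 /andP[u1 u2];
      apply/andP; split; lra.
  by rewrite e subr0 normrM powRr1// ler_wpM2r// -derive1nS b1.
- exists p; split => // x /hp; suff -> : 1 + (2 * k)%:R = (2 * k + 1)%:R :> R by [].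
  by rewrite natrD addrC.
Qed.

Lemma Cs_lipschitz s r M psi : 1 <= s -> 0 < r -> is_Cs s r psi ->
  (holder_norm s r psi <= M%:E)%E ->
  forall x t, x \in `]-r, r[ -> t \in `]-r, r[ -> `|psi x - psi t| <= M * `|x - t|.
Proof.
move=> s1 r0 [_ dpsi _] hM x t xr tr.
have [b1 b2] := holder_norm_bounds r0 hM.
have [t1 t2] := top_order_bounds s1.
case: (posnP (top_order s)) => m0.
  have := b2 _ _ xr tr; rewrite m0 /= subr0.
  have -> : s = 1 by apply/eqP; rewrite eq_le s1 andbT (le_trans t2)// m0.
  by rewrite powRr1.
have [c /andP[c1 c2] e] := MVT_open (fun z zr => dpsi _ z m0 zr) tr xr.
rewrite e normrM ler_wpM2r// -derive1nS b1//.
by move: c1 c2 xr tr; rewrite /Num.min /Num.max !in_itv/=; case: ltP => h c1 c2 /andP[u1 u2] /andP[v1 v2];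
   apply/andP; split; lra.
Qed.

End Holder.

(** * Charts of the boundary *)

Section Charts.
Context {R : realType}.
Implicit Types (s r M : R) (psi : R -> R) (z e : R * R) (A Omega : set (R * R)).

Definition axis_coord e z0 z : R := (z.1 - z0.1) * e.1 + (z.2 - z0.2) * e.2.

Lemma orthonormal2_small (e1 e2 : R * R) : orthonormal2 e1 e2 ->
  small_dir e1 /\ small_dir e2.
Proof.
have H (a b : R) : a ^+ 2 + b ^+ 2 = 1 -> `|a| <= 1 /\ `|b| <= 1.
  by move=> h; rewrite !ler_norml; split; apply/andP; split; nra.
by case=> /H h1 /H h2 _.
Qed.

(** The axes [e1] and [e2] being orthonormal, [e2] is [e1] turned by a right angle, up
    to a sign [t]; the rows of their matrix are then orthonormal too. *)
Lemma local_point_coord (z0 e1 e2 z : R * R) : orthonormal2 e1 e2 ->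
  local_point z0 e1 e2 (axis_coord e1 z0 z) (axis_coord e2 z0 z) = z.
Proof.
move: e1 e2 z0 z => [a b] [c d] [x0 y0] [x y] [/= h1 h2 h3].
pose t := a * d - b * c.
have t2 : t ^+ 2 = 1.
  have -> : t ^+ 2 = (a ^+ 2 + b ^+ 2) * (c ^+ 2 + d ^+ 2) - (a * c + b * d) ^+ 2 by rewrite /t; ring.
  by rewrite h1 h2 h3; ring.
have cE : c = - t * b.
  have -> : - t * b = (a ^+ 2 + b ^+ 2) * c - a * (a * c + b * d) by rewrite /t; ring.
  by rewrite h1 h3; ring.
have dE : d = t * a.
  have -> : t * a = (a ^+ 2 + b ^+ 2) * d - b * (a * c + b * d) by rewrite /t; ring.
  by rewrite h1 h3; ring.
rewrite /local_point /axis_coord /=; congr (_, _).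
  have -> : x0 + ((x - x0) * a + (y - y0) * b) * a + ((x - x0) * c + (y - y0) * d) * c =
    x0 + (x - x0) * (a ^+ 2 + c ^+ 2) + (y - y0) * (a * b + c * d) by ring.
  have -> : a ^+ 2 + c ^+ 2 = 1.
    have e : a ^+ 2 + (- t * b) ^+ 2 = a ^+ 2 + t ^+ 2 * b ^+ 2 by ring.
    by rewrite cE e t2 mul1r.
  have -> : a * b + c * d = 0.
    have e : a * b + - t * b * (t * a) = (1 - t ^+ 2) * (a * b) by ring.
    by rewrite {1}cE dE e t2 subrr mul0r.
  by ring.
have -> : y0 + ((x - x0) * a + (y - y0) * b) * b + ((x - x0) * c + (y - y0) * d) * d =
  y0 + (x - x0) * (a * b + c * d) + (y - y0) * (b ^+ 2 + d ^+ 2) by ring.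
have -> : b ^+ 2 + d ^+ 2 = 1.
  have e : b ^+ 2 + (t * a) ^+ 2 = b ^+ 2 + t ^+ 2 * a ^+ 2 by ring.
  by rewrite dE e t2 mul1r addrC.
have -> : a * b + c * d = 0.
  have e : a * b + - t * b * (t * a) = (1 - t ^+ 2) * (a * b) by ring.
  by rewrite {1}cE dE e t2 subrr mul0r.
by ring.
Qed.

Lemma axis_coord_sub e z0 z z' : axis_coord e z0 z' - axis_coord e z0 z = axis_coord e z z'.
Proof. by rewrite /axis_coord; ring. Qed.

Lemma axis_coord_le e z z' (d : R) : small_dir e ->
  `|z'.1 - z.1| <= d -> `|z'.2 - z.2| <= d -> `|axis_coord e z z'| <= 2 * d.
Proof. by move=> se h1 h2; exact: dir_bound. Qed.

Lemma axis_coord0 e z : axis_coord e z z = 0.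
Proof. by rewrite /axis_coord !subrr !mul0r addr0. Qed.

(** The chart as a Lipschitz graph, on which depend the closedness of the domain and
    the number of singular cells. *)
Definition graph_chart (r M : R) Omega z0 e1 e2 psi :=
  [/\ orthonormal2 e1 e2,
    forall x t, x \in `]-r, r[ -> t \in `]-r, r[ -> `|psi x - psi t| <= M * `|x - t|
  & forall z, `|axis_coord e1 z0 z| < r -> `|axis_coord e2 z0 z| < r ->
    (Omega z <-> axis_coord e2 z0 z <= psi (axis_coord e1 z0 z))].

(** A point below the graph is interior to the domain and a point above it is
    interior to the complement, because [psi] is continuous. *)
Lemma boundary_on_graph (r M : R) Omega z0 e1 e2 psi z : 0 <= M ->
  graph_chart r M Omega z0 e1 e2 psi -> boundary Omega z ->
  `|axis_coord e1 z0 z| < r -> `|axis_coord e2 z0 z| < r ->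
  axis_coord e2 z0 z = psi (axis_coord e1 z0 z).
Proof.
move=> M0 [on lip HO] [cz iz].
have [se1 se2] := orthonormal2_small on.
set w1 := axis_coord e1 z0 z; set w2 := axis_coord e2 z0 z => hw1 hw2.
have near (g : R) : 0 < g -> exists d : R, [/\ 0 < d,
   2 * d <= r - `|w1|, 2 * d <= r - `|w2| & 2 * d * (1 + M) <= g].
  move=> g0; pose d := Num.min ((r - `|w1|) / 2) (Num.min ((r - `|w2|) / 2) (g / (2 * (1 + M)))).
  have M1 : 0 < 1 + M by lra.
  have d1 : d <= (r - `|w1|) / 2 by rewrite /d ge_min lexx.
  have d2 : d <= (r - `|w2|) / 2 by rewrite /d !ge_min lexx orbT.
  have d3 : d <= g / (2 * (1 + M)) by rewrite /d !ge_min lexx !orbT.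
  exists d; split; [|lra|lra|].
    by rewrite !lt_min !divr_gt0// ?subr_gt0// mulr_gt0.
  by rewrite mulrAC mulrC -ler_pdivlMr// mulr_gt0.
have loc (d : R) z' : 0 < d -> 2 * d <= r - `|w1| -> 2 * d <= r - `|w2| ->
    ball z d z' -> exists w1' w2', [/\ w1' = axis_coord e1 z0 z' /\ w2' = axis_coord e2 z0 z',
     `|w1'| < r, `|w2'| < r, `|w2' - w2| < 2 * d & `|psi w1' - psi w1| <= 2 * d * M].
  move=> d0 d1 d2 [/= b1 b2].
  have b1' : `|z'.1 - z.1| < d by rewrite distrC.
  have b2' : `|z'.2 - z.2| < d by rewrite distrC.
  have bd e : small_dir e -> `|axis_coord e z0 z' - axis_coord e z0 z| < 2 * d.
    move=> se; rewrite axis_coord_sub.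
    have : `|axis_coord e z z'| <= 2 * Num.max `|z'.1 - z.1| `|z'.2 - z.2|.
      by apply: axis_coord_le; rewrite ?le_max ?lexx ?orbT.
    move=> /le_lt_trans; apply; rewrite ltr_pM2l//.
    by rewrite gt_max b1' b2'.
  have n1 := bd _ se1; have n2 := bd _ se2.
  rewrite -/w1 -/w2 in n1 n2.
  set w1' := axis_coord e1 z0 z' in n1 *; set w2' := axis_coord e2 z0 z' in n2 *.
  exists w1', w2'.
  have k1 : `|w1'| < r.
    by have := ler_normD (w1' - w1) w1; rewrite subrK => h; lra.
  have k2 : `|w2'| < r.
    by have := ler_normD (w2' - w2) w2; rewrite subrK => h; lra.
  split => //; rewrite (le_trans (lip _ _ _ _)) ?in_itv/= -?ltr_norml//.
  by rewrite mulrC ler_wpM2r// ltW.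
have [hlt|hgt|//] := ltgtP w2 (psi w1).
- exfalso; apply: iz.
  have [d [d0 d1 d2 d3]] := near (psi w1 - w2) ltac:(by rewrite subr_gt0).
  apply/nbhs_ballP; exists d => // z' bz'.
  have [w1' [w2' [[e1' e2'] k1 k2 n2 n1]]] := loc d z' d0 d1 d2 bz'.
  rewrite e1' in k1 n1; rewrite e2' in k2 n2; apply/(HO _ k1 k2).
  by move: n1 n2; rewrite ler_norml ltr_norml => /andP[n1 _] /andP[_ n2]; lra.
- exfalso.
  have [d [d0 d1 d2 d3]] := near (w2 - psi w1) ltac:(by rewrite subr_gt0).
  have [|z' [Oz' bz']] := cz (ball z d).
    by apply: nbhsx_ballx.
  have [w1' [w2' [[e1' e2'] k1 k2 n2 n1]]] := loc d z' d0 d1 d2 bz'.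
  rewrite e1' in k1 n1; rewrite e2' in k2 n2; move/(HO _ k1 k2): Oz'.
  by move: n1 n2; rewrite ler_norml ltr_norml => /andP[_ n1] /andP[n2 _]; lra.
Qed.

(** A limit point outside the domain would be a boundary point, thus on the graph of
    its own chart, which belongs to the domain. *)
Lemma chart_closed (r M : R) Omega : 0 < r -> 0 <= M ->
  (forall z0, boundary Omega z0 -> exists e1 e2 psi, graph_chart r M Omega z0 e1 e2 psi) ->
  closed Omega.
Proof.
move=> r0 M0 H z cz; apply: contrapT => nOz.
have bz : boundary Omega z by split => // /interior_subset.
have [e1 [e2 [psi G]]] := H z bz.
have := boundary_on_graph M0 G bz; rewrite !axis_coord0 normr0 => /(_ r0 r0) e.
have [_ _ /(_ z)] := G; rewrite !axis_coord0 normr0 => /(_ r0 r0) [_ HO].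
by apply: nOz; apply: HO; rewrite -e.
Qed.

(** The parameters of the points in [A] have a supremum, which gives a boundary
    point. *)
Lemma segment_boundary A (p q : R * R) : closed A -> A p -> ~ A q ->
  exists t : R, 0 <= t <= 1 /\
    boundary A (p.1 + t * (q.1 - p.1), p.2 + t * (q.2 - p.2)).
Proof.
move=> cA Ap nAq.
pose g (t : R) : R * R := (p.1 + t * (q.1 - p.1), p.2 + t * (q.2 - p.2)).
pose T := [set t : R | 0 <= t <= 1 /\ A (g t)].
have T0 : T 0.
  by split; rewrite ?lexx ?ler01// /g !mul0r !addr0; case: (p) Ap.
have hT : has_sup T.
  by split; [exists 0|exists 1 => t [/andP[]]].
pose t := sup T.
have t01 : 0 <= t <= 1.
  apply/andP; split; first by apply: sup_upper_bound.
  by apply: ge_sup; [exists 0|move=> u [/andP[]]].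
pose L := 1 + `|q.1 - p.1| + `|q.2 - p.2|.
have L0 : 0 < L.
  have := normr_ge0 (q.1 - p.1); have := normr_ge0 (q.2 - p.2); rewrite /L; lra.
have gb u (d : R) : `|u - t| < d / L -> ball (g t) d (g u).
  move=> h; have h' : `|u - t| * L < d by rewrite -ltr_pdivlMr.
  have n1 := normr_ge0 (q.1 - p.1); have n2 := normr_ge0 (q.2 - p.2).
  have n3 := normr_ge0 (u - t).
  split; rewrite /ball /= opprD addrACA subrr add0r -mulrBl normrM distrC.
    by apply: le_lt_trans h'; rewrite ler_wpM2l// /L; lra.
  by apply: le_lt_trans h'; rewrite ler_wpM2l// /L; lra.
have cl : closure A (g t).
  move=> B /nbhs_ballP[d /= d0 hd].
  have [u [u01 Au] hu] := sup_adherent (divr_gt0 d0 L0) hT.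
  exists (g u); split => //; apply: hd; apply: gb.
  have ut : u <= t by apply: sup_upper_bound.
  by rewrite ler0_norm ?subr_le0//; rewrite -/t in hu; lra.
exists t; split => //; split => // /nbhs_ballP[d /= d0 hd].
have At : A (g t) by exact: cA.
have t1 : t < 1.
  rewrite lt_neqAle; case/andP: t01 => _ ->; rewrite andbT; apply/eqP => t1.
  by apply: nAq; move: At; rewrite t1 /g !mul1r !subrKC; case: (q).
pose u := t + Num.min (1 - t) (d / L / 2).
have m0 : 0 < Num.min (1 - t) (d / L / 2).
  by rewrite lt_min subr_gt0 t1 !divr_gt0.
have m1 : Num.min (1 - t) (d / L / 2) <= 1 - t by rewrite ge_min lexx.
have m2 : Num.min (1 - t) (d / L / 2) <= d / L / 2 by rewrite ge_min lexx orbT.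
have dL : 0 < d / L by rewrite divr_gt0.
have Tu : T u.
  split; first by case/andP: t01 => *; apply/andP; split; rewrite /u; lra.
  apply: hd; apply: gb; rewrite /u addrC addKr gtr0_norm//; lra.
have : u <= t by apply: sup_upper_bound.
by rewrite /u; lra.
Qed.

End Charts.

(** * Charts with a polynomial in place of the function *)

Section TaylorCharts.
Context {R : realType}.
Implicit Types (s r M C rho : R) (psi : R -> R) (z e : R * R) (A Omega : set (R * R)).

(** The squeeze of [A] between two level sets of a polynomial equation. Unlike a graph,
    it makes sense in all frames ([taylor_chart_frame]). *)
Definition taylor_chart (n : nat) C rho r A z0 e1 e2 (p : {poly R}) : Prop :=
  [/\ orthonormal2 e1 e2, (size p <= n)%N, p.[0] = 0, coef_norm p <= C &
    forall z, `|z.1 - z0.1| <= rho -> `|z.2 - z0.2| <= rho ->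
      let G := implicit_eq e1 e2 p (z.1 - z0.1) (z.2 - z0.2) in
      (G <= - (C * `|axis_coord e1 z0 z| `^ r) -> A z) /\
      (A z -> G <= C * `|axis_coord e1 z0 z| `^ r)].

Lemma Cs_graph_chart s r P M Omega z0 (e1 e2 : R * R) psi :
  1 <= s -> 0 < r -> 1 < P ->
  orthonormal2 e1 e2 -> is_Cs s r psi -> (holder_norm s r psi <= M%:E)%E ->
  (forall z1 z2 : R, `|z1| <= r -> `|z2| <= P * r ->
            (Omega (local_point z0 e1 e2 z1 z2) <-> z2 <= psi z1)) ->
  graph_chart r M Omega z0 e1 e2 psi.
Proof.
move=> s1 r0 P1 on Cs hM HO; split => //; first exact: Cs_lipschitz hM.
move=> z h1 h2; rewrite -{1}(local_point_coord z0 z on); apply: HO; first exact: ltW.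
by rewrite (le_trans (ltW h2))// ler_peMl// ltW.
Qed.

Lemma Cs_domain_graph_charts s Omega : 1 <= s -> Cs_domain s Omega ->
  exists r M, [/\ 0 < r, 0 < M & forall z0, boundary Omega z0 ->
    exists e1 e2 psi, graph_chart r M Omega z0 e1 e2 psi].
Proof.
move=> s1 [r [P [M [r0 P1 M0 H]]]]; exists r, M; split => // z0 /H.
move=> [e1 [e2 [psi [on Cs hM _ HO]]]]; exists e1, e2, psi.
exact: Cs_graph_chart hM HO.
Qed.

Lemma Cs_domain_closed s Omega : 1 <= s -> Cs_domain s Omega -> closed Omega.
Proof.
move=> s1 /(Cs_domain_graph_charts s1)[r [M [r0 M0 H]]].
exact: (chart_closed r0 (ltW M0)).
Qed.

(** As the boundary point is on the graph, [psi] vanishes at 0 and so does its Taylor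
    polynomial. *)
Lemma Cs_domain_taylor_charts (k : nat) s Omega : 1 <= s -> Cs_domain s Omega ->
  exists C rho, [/\ 0 < C, 0 < rho & forall z0, boundary Omega z0 ->
    exists e1 e2 p,
      taylor_chart (2 * k + 1) C rho (Num.min s (2 * k + 1)%:R) Omega z0 e1 e2 p].
Proof.
move=> s1 [r [P [M [r0 P1 M0 H]]]]; exists ((2 * k).+1%:R * M), (r / 4).
have C0 : 0 < (2 * k).+1%:R * M by rewrite mulr_gt0.
have MC : M <= (2 * k).+1%:R * M by rewrite ler_peMl ?(ltW M0)// ler1n.
split => //; first by rewrite divr_gt0.
move=> z0 bz0; have [e1 [e2 [psi [on Cs hM _ HO]]]] := H z0 bz0.
have G := Cs_graph_chart s1 r0 P1 on Cs hM HO.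
have [se1 se2] := orthonormal2_small on.
have [p [sp np hp]] := Cs_taylor k s1 r0 Cs hM.
have psi0 : psi 0 = 0.
  have := boundary_on_graph (ltW M0) G bz0.
  by rewrite !axis_coord0 normr0 => /(_ r0 r0).
set rr := Num.min _ _ in hp *.
have rr0 : 0 < rr by rewrite lt_min (lt_le_trans ltr01)//= ltr0n addn1.
exists e1, e2, p; split => //.
- by rewrite addn1.
- have := hp 0; rewrite in_itv/= oppr_lt0 r0 psi0 normr0 powR0 ?gt_eqF// mulr0 sub0r normrN.
  by move=> /(_ isT); rewrite normr_le0 => /eqP.
move=> z h1 h2 G0; have [_ _ HG] := G.
have w1 := axis_coord_le se1 h1 h2; have w2 := axis_coord_le se2 h1 h2.
have w1r : `|axis_coord e1 z0 z| < r by apply: le_lt_trans w1 _; lra.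
have w2r : `|axis_coord e2 z0 z| < r by apply: le_lt_trans w2 _; lra.
have := hp (axis_coord e1 z0 z); rewrite in_itv/= -ltr_norml => /(_ w1r).
have GE : G0 = axis_coord e2 z0 z - p.[axis_coord e1 z0 z] by [].
have powC : M * `|axis_coord e1 z0 z| `^ rr <= (2 * k).+1%:R * M * `|axis_coord e1 z0 z| `^ rr.
  by rewrite ler_wpM2r ?powR_ge0.
rewrite ler_norml => /andP[k1 k2]; rewrite GE; split.
  by move=> h; apply/(HG z w1r w2r); lra.
by move=> /(HG z w1r w2r) h; lra.
Qed.

Lemma taylor_chart_frame (f : Defs.form) n C rho r A z0 e1 e2 (p : {poly R}) :
  taylor_chart n C rho r A z0 e1 e2 p ->
  taylor_chart n C rho r (from_frame f @^-1` A) (to_frame f z0)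
    (to_frame f e1) (to_frame f e2) p.
Proof.
move=> [on sp p0 pC H]; split => //.
  by case: on => o1 o2 o3; case: f; (split; [rewrite -[RHS]o1|rewrite -[RHS]o2|rewrite -[RHS]o3]); rewrite /=; ring.
move=> z h1 h2 G.
have G0 : implicit_eq e1 e2 p ((from_frame f z).1 - z0.1) ((from_frame f z).2 - z0.2) = G.
  by rewrite /G /implicit_eq; case: f {h1 h2 G} => /=; congr (_ - p.[_]); ring.
have c0 : axis_coord e1 z0 (from_frame f z) = axis_coord (to_frame f e1) (to_frame f z0) z.
  by rewrite /axis_coord; case: f {h1 h2 G G0} => /=; ring.
have N (a b c : R) : `|a - - b| <= c -> `|- a - b| <= c by rewrite opprK -opprD normrN.
by rewrite -G0 -c0; apply: H; move: h1 h2; case: f {G G0 c0} => //= h1 h2; exact: N.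
Qed.

End TaylorCharts.

(** * The orientation test *)

Section Orientation.
Context {R : realType}.
Local Notation mR := (measurableTypeR R).
Local Notation plane := (mR * mR)%type.
Local Notation mu := (@lebesgue_measure2 R).
Implicit Types (h : R) (A : set plane) (i j : int).

Lemma cell_average_setC h A i j : 0 < h -> measurable A ->
  cell_average \1_(~` A) h i j = 1 - cell_average \1_A h i j.
Proof.
move=> h0 mA; apply: (@mulfI _ (h ^+ 2)); first by rewrite expf_neq0 ?gt_eqF.
rewrite cell_average_sub1// setDE cell_average_indic//=.
exact: measurableC.
Qed.

Lemma cell_average_le_vstrip h A i j (c w : R) : 0 < h -> measurable A -> 0 <= w ->
  (forall z, cell h i j z -> A z -> c <= z.1 <= c + w * h) ->
  cell_average \1_A h i j <= w.
Proof.
move=> h0 mA w0 H; rewrite -(ler_pM2l (exprn_gt0 2 h0)) -lee_fin -cell_average_indic//.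
pose B : set plane := `[c, c + w * h]%classic `*` `[j%:~R * h, (j + 1)%:~R * h[%classic.
have mB : measurable B by apply: measurableX; exact: measurable_itv.
apply: (@le_trans _ _ (mu B)).
  apply: le_measure; rewrite ?inE//.
    by apply: measurableI => //; exact: measurable_cell.
  by move=> z [cz Az]; split; rewrite /= ?in_itv/= ?(H z cz Az)//; case: cz.
rewrite lebesgue2X; try exact: measurable_itv.
rewrite lebesgue_itv_co ?intrSl ?lerDl ?(ltW h0)// [_ + h]addrC addrK.
have := lebesgue_measure_itv `[c, c + w * h]; rewrite /= lte_fin => ->.
have wh : 0 <= w * h by rewrite mulr_ge0// ltW.
case: ifP => _; last by rewrite mul0e lee_fin mulr_ge0// sqr_ge0.
by rewrite -EFinB -EFinM lee_fin le_eqVlt; apply/orP; left; apply/eqP; ring.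
Qed.

(** Translation sends [B], which is outside [A], into [A]: the translated cell gains at
    least the measure of [B]. *)
Lemma lt_cell_average_shift h A i j (n : int) (B : set plane) : 0 < h -> measurable A ->
  measurable B -> B `<=` cell h i j -> mu B <> 0%E ->
  (forall z, B z -> ~ A z /\ A (z.1, z.2 + n%:~R * h)) ->
  (forall z, cell h i j z -> A z -> A (z.1, z.2 + n%:~R * h)) ->
  cell_average \1_A h i j < cell_average \1_A h i (j + n).
Proof.
move=> h0 mA mB Bc B0 HB sA.
have mcA i' j' : measurable (cell h i' j' `&` A : set plane).
  by apply: measurableI => //; exact: measurable_cell.
have le : (mu (cell h i j `&` A) + mu B <= mu (cell h i (j + n) `&` A))%E.
  rewrite -measureU//; last first.
    by apply/seteqP; split => // z [[_ Az] /HB[]].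
  rewrite -[leRHS](lebesgue2_preimage_shift (0, n%:~R * h))//.
  apply: le_measure; rewrite ?inE//.
  - exact: measurableU.
  - by rewrite -[X in measurable X]setTI; exact: (measurable_plane_shift _ measurableT (mcA _ _)).
  - have sh z : cell h i j z -> cell h i (j + n) (z.1 + 0, z.2 + n%:~R * h).
      by move=> /(cell_shift h i j 0 n z); rewrite addr0 mul0r.
    move=> z [[cz Az]|Bz]; split => /=.
    + exact: sh.
    + by rewrite addr0; exact: sA.
    + exact/sh/Bc.
    + by rewrite addr0; case: (HB z Bz).
have Bp : (0 < mu B)%E by rewrite lt_neqAle measure_ge0 andbT eq_sym; apply/eqP.
rewrite -(ltr_pM2l (exprn_gt0 2 h0)) -lte_fin -!cell_average_indic//.
apply: lt_le_trans le; rewrite -[ltLHS]adde0 lteD2lE//.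
by rewrite cell_average_indic.
Qed.

Lemma lebesgue_itv_width (a w : R) : 0 <= w -> lebesgue_measure `[a, a + w[%classic = w%:E.
Proof. by move=> w0; rewrite lebesgue_itv_co ?lerDl// [a + w]addrC addrK. Qed.

(** If the interface crosses the cell almost vertically, the three cells on each
    side in [aerosH] are almost full or almost empty, so that [aerosH] is close
    to 4 in absolute value, while [aerosV] cannot much exceed 2; if the set lies
    above the interface, [aerosV] is positive. *)
Lemma orientation h A i j (z0 : R * R) (nx ny d : R) :
  0 < d -> 40 * d <= 1 -> 0 < h -> measurable A ->
  1 <= nx ^+ 2 + ny ^+ 2 ->
  i%:~R * h <= z0.1 <= i%:~R * h + h -> j%:~R * h <= z0.2 <= j%:~R * h + h ->
  (forall z : R * R, `|z.1 - z0.1| <= 3 * h -> `|z.2 - z0.2| <= 3 * h ->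
     let L := nx * (z.1 - z0.1) + ny * (z.2 - z0.2) in
     (L <= - (d / 10 * h) -> A z) /\ (A z -> L <= d / 10 * h)) ->
  `|aerosH (cell_average \1_A h) i j| <= `|aerosV (cell_average \1_A h) i j| ->
  aerosV (cell_average \1_A h) i j <= 0 ->
  d <= ny.
Proof.
have rng (m : int) : [/\ m - 1 <= m - 1 <= m + 1, m - 1 <= m <= m + 1 & m - 1 <= m + 1 <= m + 1].
  by clear; split; lia.
have [im ic ip] := rng i; have [jm jc jp] := rng j.
have jtwo : j + 1 = j - 1 + 2%:Z by clear; lia.
move=> dp d40 h0 mA nn /andP[x1 x2] /andP[y1 y2] HL HV V0.
set a := cell_average \1_A h in HV V0.
have a0 i' j' : 0 <= a i' j' by exact: cell_average_ge0.
have a1 i' j' : a i' j' <= 1 by exact: cell_average_le1.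
have cellP i' j' z : cell h i' j' z -> (i - 1 <= i' <= i + 1) -> (j - 1 <= j' <= j + 1) ->
    [/\ i'%:~R * h <= z.1 < i'%:~R * h + h, j'%:~R * h <= z.2 < j'%:~R * h + h,
      `|z.1 - z0.1| <= 2 * h & `|z.2 - z0.2| <= 2 * h].
  move=> /in_cellP[c1 c2] /andP[i1 i2] /andP[j1 j2]; split => //.
    have k1 : (i - 1)%:~R * h <= i'%:~R * h by rewrite ler_pM2r// ler_int.
    have k2 : i'%:~R * h <= (i + 1)%:~R * h by rewrite ler_pM2r// ler_int.
    move: c1 k1 k2 => /andP[c1 c1']; rewrite intrB intrD mulrBl mulrDl mul1r.
    by clear - x1 x2 c1 c1' => k1 k2; rewrite ler_norml; apply/andP; split; lra.
  have k1 : (j - 1)%:~R * h <= j'%:~R * h by rewrite ler_pM2r// ler_int.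
  have k2 : j'%:~R * h <= (j + 1)%:~R * h by rewrite ler_pM2r// ler_int.
  move: c2 k1 k2 => /andP[c2 c2']; rewrite intrB intrD mulrBl mulrDl mul1r.
  by clear - y1 y2 c2 c2' => k1 k2; rewrite ler_norml; apply/andP; split; lra.
have b23 (x : R) : `|x| <= 2 * h -> `|x| <= 3 * h.
  by move=> h2; apply: (le_trans h2); clear - h0; lra.
rewrite leNgt; apply/negP => nylt.
have [nyneg|nypos] := ltP ny (- d).
  (* [A] is above the interface: moving up by [2 * h] maps it into itself, so that no
     term of [aerosV] is negative, and the middle one is positive. *)
  suff : 0 < aerosV a i j by rewrite ltNge V0.
  have sA i' z : i - 1 <= i' <= i + 1 -> cell h i' (j - 1) z -> A z -> A (z.1, z.2 + 2%:~R * h).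
    move=> hi' cz Az.
    have [c1 c2 d1 d2] := cellP i' (j - 1) z cz hi' jm.
    have [_ /(_ Az) L1] := HL z (b23 _ d1) (b23 _ d2).
    have d3 : `|z.2 + 2 * h - z0.2| <= 3 * h.
      move: c2; rewrite intrB mulrBl mul1r => /andP[c2 c2'].
      by rewrite ler_norml; apply/andP; split; clear - y1 y2 c2 c2' h0; lra.
    apply: (HL (z.1, z.2 + 2 * h) (b23 _ d1) d3).1 => /=.
    have : ny * h <= - d * h by rewrite ler_pM2r// ltW.
    by have := mulr_gt0 dp h0; clear - L1 => ? k; lra.
  have le i' : i - 1 <= i' <= i + 1 -> a i' (j - 1) <= a i' (j + 1).
    move=> hi'; have -> : i' = i' + 0 by rewrite addr0.
    rewrite {1}addr0 jtwo.
    apply: le_cell_average_shift => // z cz Az; rewrite mul0r addr0.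
    exact: (sA _ _ hi' cz Az).
  have lt : a i (j - 1) < a i (j + 1).
    rewrite jtwo.
    (* The box [B], in the cell below, has nearly the abscissa of [z0] and is at depth
       between [h / 2] and [3 / 2 * h] under it: it is outside [A], but its
       translate is inside. *)
    pose kap := d / 10 / (1 + `|nx|).
    have n0 : 0 < 1 + `|nx| by have := normr_ge0 nx; clear; lra.
    have dt : 0 < d / 10 by clear - dp; lra.
    have kap0 : 0 < kap by rewrite divr_gt0.
    have kapE : kap * (1 + `|nx|) = d / 10 by rewrite divfK// gt_eqF.
    have kapn : `|nx| * kap <= d / 10.
      by rewrite -kapE mulrC ler_wpM2l ?(ltW kap0)// lerDr.
    have kap2 : kap <= 1 / 2.
      have : kap <= d / 10 by rewrite -kapE ler_peMr ?(ltW kap0)// lerDl.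
      by clear - d40; lra.
    clearbody kap.
    pose X1 := if z0.1 <= i%:~R * h + h / 2 then z0.1 else z0.1 - kap * h.
    pose Y1 := if z0.2 <= j%:~R * h + h / 2 then j%:~R * h - h else j%:~R * h - h / 2.
    pose B : set plane := `[X1, X1 + kap * h[%classic `*` `[Y1, Y1 + h / 2[%classic.
    have kh : 0 < kap * h by rewrite mulr_gt0.
    have kh2 : kap * h <= h / 2 by rewrite -[leRHS]mulrC ler_pM2r// -div1r.
    have mB : measurable B by apply: measurableX; exact: measurable_itv.
    have BP z : B z -> [/\ cell h i (j - 1) z, `|z.1 - z0.1| <= kap * h,
        - (3 / 2 * h) <= z.2 - z0.2 & z.2 - z0.2 <= - (1 / 2 * h)].
      move=> [/=]; rewrite !in_itv/= => /andP[u1 u2] /andP[v1 v2].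
      have U : [/\ i%:~R * h <= z.1, z.1 < i%:~R * h + h & `|z.1 - z0.1| <= kap * h].
        rewrite ler_norml; move: u1 u2; rewrite /X1; case: (leP z0.1 (i%:~R * h + h / 2)) => hh u1 u2;
          clear - x1 x2 kh kh2 h0 hh u1 u2; (split; [idtac|idtac|apply/andP; split]); lra.
      have W : [/\ j%:~R * h - h <= z.2, z.2 < j%:~R * h, - (3 / 2 * h) <= z.2 - z0.2
          & z.2 - z0.2 <= - (1 / 2 * h)].
        move: v1 v2; rewrite /Y1; case: (leP z0.2 (j%:~R * h + h / 2)) => hh v1 v2;
          clear - y1 y2 h0 hh v1 v2; split; lra.
      case: U => U1 U2 U3; case: W => W1 W2 W3 W4; split => //.
      by apply/in_cellP; rewrite intrB mulrBl mul1r subrK U1 U2 W1 W2.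
    apply: (@lt_cell_average_shift h A i (j - 1) 2 B) => //.
    - by move=> z /BP[].
    - rewrite lebesgue2X; try exact: measurable_itv.
      have h20 : 0 < h / 2 by rewrite divr_gt0.
      rewrite !lebesgue_itv_width ?(ltW kh) ?(ltW h20)// -EFinM.
      by move=> [] /eqP; rewrite mulf_eq0 (gt_eqF kh) (gt_eqF h20).
    - move=> z /BP[cz k1 k2 k3].
      have [_ _ d1 d2] := cellP i (j - 1) z cz ic jm.
      have nX : `|nx * (z.1 - z0.1)| <= d / 10 * h.
        rewrite normrM; apply: (le_trans (ler_wpM2l (normr_ge0 nx) k1)).
        by rewrite mulrA ler_pM2r.
      move: nX; rewrite ler_norml => /andP[nX1 nX2].
      split.
        move=> Az; have [_ /(_ Az) L1] := HL z (b23 _ d1) (b23 _ d2).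
        have : d * (1 / 2 * h) <= (- ny) * (- (z.2 - z0.2)).
          by apply: ler_pM; clear - nyneg k3 h0 dp; lra.
        by have := mulr_gt0 dp h0; clear - L1 nX1 => ? k; lra.
      have d3 : `|z.2 + 2 * h - z0.2| <= 3 * h.
        by rewrite ler_norml; apply/andP; split; clear - k2 k3 h0; lra.
      apply: (HL (z.1, z.2 + 2 * h) (b23 _ d1) d3).1 => /=.
      have : d * (1 / 2 * h) <= (- ny) * (z.2 + 2 * h - z0.2).
        by apply: ler_pM; clear - nyneg k2 h0 dp; lra.
      by have := mulr_gt0 dp h0; clear - nX2 => ? k; lra.
    - by move=> z cz Az; exact: (sA _ _ ic cz Az).
  have := le _ ip; have := le _ im.
  by move: lt; rewrite /aerosV; clear; lra.
have nyb : `|ny| <= d by rewrite ler_norml; apply/andP; split; clear - nypos nylt; lra.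
(* Now [nx] is at least 1/2 in absolute value, so that outside a vertical strip of
   half-width [6 * d * h] around [z0] the sign of [nx * (z.1 - z0.1)] decides whether
   [z] is in [A]. *)
pose th : R := 6 * d.
have th0 : 0 <= th by rewrite /th; clear - dp; lra.
have nY (y : R) : `|y| <= 2 * h -> - (2 * d * h) <= ny * y <= 2 * d * h.
  move=> hy; rewrite -ler_norml normrM.
  by rewrite (le_trans (ler_pM _ _ nyb hy))//; clear; lra.
have dh : 0 < d * h by exact: mulr_gt0.
have right (B : set plane) j' : measurable B -> j - 1 <= j' <= j + 1 ->
    (forall z, cell h (i + 1) j' z -> B z -> z.1 - z0.1 <= 6 * d * h) ->
    cell_average \1_B h (i + 1) j' <= th.
  move=> mB hj HB; apply: (@cell_average_le_vstrip h B _ _ (i%:~R * h + h)) => // z cz Bz.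
  have [/andP[c1 _] _ _ _] := cellP _ _ z cz ip hj; have b := HB z cz Bz.
  move: c1; rewrite intrSl => c1; apply/andP; split => //.
  by move: b; rewrite /th; clear - x2; lra.
have left (B : set plane) j' : measurable B -> j - 1 <= j' <= j + 1 ->
    (forall z, cell h (i - 1) j' z -> B z -> - (6 * d * h) <= z.1 - z0.1) ->
    cell_average \1_B h (i - 1) j' <= th.
  move=> mB hj HB.
  apply: (@cell_average_le_vstrip h B _ _ (i%:~R * h - 6 * d * h)) => // z cz Bz.
  have [/andP[_ c1] _ _ _] := cellP _ _ z cz im hj; have b := HB z cz Bz.
  move: c1 b; rewrite intrB mulrBl mul1r subrK /th => c1 b.
  by apply/andP; split; clear - c1 b x1; lra.
have inA z i' j' : i - 1 <= i' <= i + 1 -> j - 1 <= j' <= j + 1 -> cell h i' j' z ->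
    A z -> nx * (z.1 - z0.1) <= 3 * (d * h).
  move=> hi hj cz Az; have [_ _ d1 d2] := cellP i' j' z cz hi hj.
  have [_ /(_ Az) L1] := HL z (b23 _ d1) (b23 _ d2).
  by have /andP[k1 _] := nY _ d2; clear - L1 k1 dh; lra.
have outA z i' j' : i - 1 <= i' <= i + 1 -> j - 1 <= j' <= j + 1 -> cell h i' j' z ->
    ~ A z -> - (3 * (d * h)) <= nx * (z.1 - z0.1).
  move=> hi hj cz nAz; have [_ _ d1 d2] := cellP i' j' z cz hi hj.
  rewrite leNgt; apply/negP => lt; apply: nAz.
  apply: (HL z (b23 _ d1) (b23 _ d2)).1.
  by have /andP[_ k1] := nY _ d2; clear - lt k1 dh; lra.
have mAC : measurable (~` A) by exact: measurableC.
have aC i' j' : cell_average \1_(~` A) h i' j' = 1 - a i' j' by exact: cell_average_setC.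
have nx2 : 1 / 4 <= nx ^+ 2.
  have : ny ^+ 2 <= 1 / 4.
    rewrite -real_normK ?num_real//.
    have nyh : `|ny| <= 1 / 2 by apply: (le_trans nyb); clear - d40; lra.
    have := ler_pM (normr_ge0 ny) (normr_ge0 ny) nyh nyh; rewrite -expr2.
    by clear; lra.
  by clear - nn; lra.
have pull (x y : R) : 1 / 2 <= x -> x * y <= 3 * (d * h) -> y <= 6 * d * h.
  move=> hx hxy; rewrite leNgt; apply/negP => hy.
  have y0 : 0 <= y by apply/ltW; apply: le_lt_trans hy; clear - dh; lra.
  by have := ler_wpM2r y0 hx; clear - hy hxy; lra.
have pull' (x y : R) : 1 / 2 <= x -> - (3 * (d * h)) <= x * y -> - (6 * d * h) <= y.
  move=> hx hxy; rewrite lerNl; apply: (pull x) => //.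
  by rewrite mulrN lerNl.
have fin (u : int -> int -> R) : (forall i' j', 0 <= u i' j' <= 1) ->
    (forall j', j - 1 <= j' <= j + 1 -> u (i + 1) j' <= th /\ 1 - u (i - 1) j' <= th) ->
    4 - 8 * th <= - aerosH u i j /\ `|aerosV u i j| <= 2 + 2 * th.
  move=> u01 H; have [p1 p2] := H _ jm; have [p3 p4] := H _ jc; have [p5 p6] := H _ jp.
  have /andP[q1 q2] := u01 i (j + 1); have /andP[q3 q4] := u01 i (j - 1).
  have /andP[q5 q6] := u01 (i + 1) (j + 1); have /andP[q7 q8] := u01 (i + 1) (j - 1).
  have /andP[v1 v2] := u01 (i - 1) (j + 1); have /andP[v3 v4] := u01 (i - 1) (j - 1).
  rewrite /aerosH /aerosV ler_norml; move: (u i (j + 1)) (u i (j - 1)) (u (i + 1) (j + 1)) (u (i + 1) (j - 1)) (u (i - 1) (j + 1)) (u (i - 1) (j - 1)) (u (i + 1) j) (u (i - 1) j) p1 p2 p3 p4 p5 p6 q1 q2 q3 q4 q5 q6 q7 q8 v1 v2 v3 v4.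
  clear => *; split; [lra|apply/andP; split; lra].
have a01 i' j' : 0 <= a i' j' <= 1 by rewrite a0 a1.
have half (x : R) : 0 <= x -> 1 / 4 <= x ^+ 2 -> 1 / 2 <= x.
  move=> x0 hx; rewrite leNgt; apply/negP => lx.
  have := ler_wpM2l x0 (ltW lx); rewrite -expr2.
  by clear - hx lx; lra.
have [nx0|nx0] := leP 0 nx.
  have nxh : 1 / 2 <= nx.
    exact: half nx0 nx2.
  have [] := fin a a01.
    move=> j' hj; split.
      by apply: right => // z cz Az; apply: pull nxh _; exact: inA cz Az.
    by rewrite -aC; apply: left => // z cz Az; apply: pull' nxh _; exact: outA cz Az.
  have : - aerosH a i j <= `|aerosH a i j| by rewrite -normrN ler_norm.
  by move: HV; rewrite /th; clear - d40; lra.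
have nxh : 1 / 2 <= - nx.
  have nx0' : 0 <= - nx by rewrite oppr_ge0 ltW.
  by apply: half => //; rewrite sqrrN.
have [||] := fin (fun i' j' => 1 - a i' j').
- by move=> i' j'; have := a01 i' j'; clear; lra.
- move=> j' hj; split.
    rewrite -aC; apply: right => // z cz Az; apply: pull nxh _.
    by rewrite mulNr lerNl; exact: outA cz Az.
  rewrite opprB addrCA subrr addr0; apply: left => // z cz Az; apply: pull' nxh _.
  by rewrite mulNr lerN2; exact: inA cz Az.
have -> : aerosH (fun i' j' => 1 - a i' j') i j = - aerosH a i j by rewrite /aerosH; ring.
have -> : aerosV (fun i' j' => 1 - a i' j') i j = - aerosV a i j by rewrite /aerosV; ring.
rewrite normrN opprK.
have := ler_norm (aerosH a i j).
by move: HV; rewrite /th; clear - d40; lra.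
Qed.

End Orientation.

(** * Stencils and heights of columns *)

Section Stencils.
Context {R : realType}.
Local Notation mR := (measurableTypeR R).
Local Notation plane := (mR * mR)%type.
Local Notation lam := (@lebesgue_measure R).
Implicit Types (h : R) (A : set plane) (i j : int) (a : int -> int -> R).

Lemma is_least_exists (Q : nat -> Prop) (m : nat) : Q m ->
  exists l, is_least Q l.
Proof.
move=> Qm; have ex : exists n, `[< Q n >] by exists m; apply/asboolP.
case: (ex_minnP ex) => l /asboolP Ql lmin; exists l; split => // n Qn.
by apply: lmin; apply/asboolP.
Qed.

Lemma Rintegral_horner (p P : {poly R}) (x y : R) : x <= y -> P^`() = p ->
  \int[lam]_(t in `[x, y]) p.[t] = P.[y] - P.[x].
Proof. by move=> xy Pp; rewrite /Rintegral (horner_FTC xy Pp). Qed.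

(** One more full row below raises the sum by [h] and lowers the base of the column by
    [h]; one more empty row above adds nothing. *)
Lemma column_sum_extend h a jT (lm lp dm dp : nat) i :
  (forall d : nat, (d < dm)%N -> a i (jT - lm%:Z - 1 - d%:Z) = 1) ->
  (forall d : nat, (d < dp)%N -> a i (jT + lp%:Z + 1 + d%:Z) = 0) ->
  column_sum h a jT (lm + dm) (lp + dp) i + (jT - (lm + dm)%N%:Z)%:~R * h
  = column_sum h a jT lm lp i + (jT - lm%:Z)%:~R * h.
Proof.
move=> Hm Hp.
have up d : (d <= dp)%N -> column_sum h a jT lm (lp + d) i = column_sum h a jT lm lp i.
  elim: d => [|d IHd] ld; first by rewrite addn0.
  rewrite -IHd; last exact: ltnW.
  rewrite /column_sum addnS addnS big_ord_recr /=.
  have -> : jT - lm%:Z + (lm + (lp + d)).+1%:Z = jT + lp%:Z + 1 + d%:Z by clear; lia.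
  by rewrite Hp// addr0.
rewrite -(up dp (leqnn _)).
suff dn d : (d <= dm)%N ->
    column_sum h a jT (lm + d) (lp + dp) i + (jT - (lm + d)%N%:Z)%:~R * h
    = column_sum h a jT lm (lp + dp) i + (jT - lm%:Z)%:~R * h by exact: dn.
elim: d => [|d IHd] ld; first by rewrite addn0.
rewrite -IHd; last exact: ltnW.
rewrite /column_sum addnS addSn big_ord_recl /= addr0.
have -> : jT - (lm + d).+1%:Z = jT - lm%:Z - 1 - d%:Z by clear; lia.
rewrite Hm// mulrDr mulr1 addrAC addrC.
congr (_ + _).
  congr (h * _); apply: eq_bigr => l _; congr (a i _).
  by rewrite /bump /=; clear; lia.
have -> : jT - (lm + d)%N%:Z = jT - lm%:Z - 1 - d%:Z + 1 by clear; lia.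
by rewrite intrSl addrC.
Qed.

(** What the algorithm sees around a cell. The columns extend to [2 * k] on each side,
    because a stencil need not be centered; the graph of [q] stays within [L] rows, and
    two more rows leave room for the full and empty rows that bound the stencil
    and for a vertical shift by [h]. *)
Record window (k : nat) h A (iT jT : int) (q : {poly R}) (E : R) (L : nat) : Prop := Window {
  wsize : (size q <= (2 * k).+1)%N;
  wE : 0 <= E;
  wEh : 2 * E <= h;
  wsq : forall x y : R,
    (iT - (2 * k)%N%:Z)%:~R * h <= x < (iT + (2 * k)%N%:Z + 1)%:~R * h ->
    (jT - L%:Z - 2)%:~R * h <= y < (jT + L%:Z + 3)%:~R * h ->
    (y <= q.[x] - E -> A (x, y)) /\ (A (x, y) -> y <= q.[x] + E);
  wq : forall x : R,
    (iT - (2 * k)%N%:Z)%:~R * h <= x < (iT + (2 * k)%N%:Z + 1)%:~R * h ->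
    (jT - L%:Z)%:~R * h <= q.[x] - E /\ q.[x] + E < (jT + L%:Z + 1)%:~R * h }.

Section Window.
Variables (k : nat) (h : R) (A : set plane) (iT jT : int) (q : {poly R}) (E : R) (L : nat).
Hypotheses (h0 : 0 < h) (mA : measurable A) (W : window k h A iT jT q E L).
Let a := cell_average \1_A h.

Let lez (m n : int) : m <= n -> m%:~R * h <= n%:~R * h.
Proof. by move=> mn; rewrite ler_pM2r// ler_int. Qed.

Let colP i x : iT - (2 * k)%N%:Z <= i <= iT + (2 * k)%N%:Z ->
  i%:~R * h <= x < (i + 1)%:~R * h ->
  (iT - (2 * k)%N%:Z)%:~R * h <= x < (iT + (2 * k)%N%:Z + 1)%:~R * h.
Proof.
move=> /andP[i1 i2] /andP[x1 x2]; rewrite (le_trans (lez i1))//=.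
by rewrite (lt_le_trans x2)// lez// lerD2r.
Qed.

Let rowP j y : jT - L%:Z - 2 <= j <= jT + L%:Z + 2 ->
  j%:~R * h <= y < (j + 1)%:~R * h ->
  (jT - L%:Z - 2)%:~R * h <= y < (jT + L%:Z + 3)%:~R * h.
Proof.
move=> /andP[i1 i2] /andP[x1 x2]; rewrite (le_trans (lez i1))//=.
by rewrite (lt_le_trans x2)// lez//; lia.
Qed.

Lemma window_row_full i : iT - (2 * k)%N%:Z <= i <= iT + (2 * k)%N%:Z ->
  a i (jT - L%:Z - 1) = 1.
Proof.
move=> hi; apply: cell_average1 => // -[x y] [/=]; rewrite !in_itv/= => hx hy.
have cx := colP hi hx; have [q1 _] := wq W cx.
apply: (wsq W cx _).1.
  by apply: rowP hy; lia.
apply: (le_trans _ q1); case/andP: hy => _ /ltW; suff -> : jT - L%:Z - 1 + 1 = jT - L%:Z by [].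
by lia.
Qed.

Lemma window_row_empty i : iT - (2 * k)%N%:Z <= i <= iT + (2 * k)%N%:Z ->
  a i (jT + L%:Z + 1) = 0.
Proof.
move=> hi; apply: cell_average0 => //; apply/seteqP; split => // -[x y] [[/=]].
rewrite !in_itv/= => hx hy Axy.
have cx := colP hi hx; have [_ q2] := wq W cx.
have cy : (jT - L%:Z - 2)%:~R * h <= y < (jT + L%:Z + 3)%:~R * h.
  by apply: rowP hy; lia.
have := (wsq W cx cy).2 Axy; case/andP: hy => y1 _.
by rewrite leNgt (lt_le_trans q2).
Qed.

(** A point of [A] is below the graph of [q + E]; moved down by [h], it is below the
    graph of [q - E], since [2 * E <= h]. *)
Lemma window_monotone i j : iT - (2 * k)%N%:Z <= i <= iT + (2 * k)%N%:Z ->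
  jT - L%:Z - 1 <= j <= jT + L%:Z + 2 -> a i j <= a i (j - 1).
Proof.
move=> hi hj; have e : i = i + 0 by rewrite addr0.
rewrite {2}e; apply: le_cell_average_shift => // -[x y] [/=]; rewrite !in_itv/= => hx hy Axy.
have cx := colP hi hx.
have cy : (jT - L%:Z - 2)%:~R * h <= y < (jT + L%:Z + 3)%:~R * h.
  by apply: rowP hy; lia.
have y1 := (wsq W cx cy).2 Axy.
rewrite mul0r addr0 intrN mulN1r; apply: (wsq W cx _).1.
  have hj' : jT - L%:Z - 2 <= j - 1 <= jT + L%:Z + 2 by lia.
  apply: rowP hj' _; rewrite subrK intrB mulrBl mul1r lerD2r.
  by case/andP: hy => -> /=; rewrite intrSl ltrBlDr.
by have := wEh W; lra.
Qed.

Lemma window_full_below i (l d : nat) : iT - (2 * k)%N%:Z <= i <= iT + (2 * k)%N%:Z ->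
  a i (jT - l%:Z - 1) = 1 -> (l + d <= L)%N -> a i (jT - l%:Z - 1 - d%:Z) = 1.
Proof.
move=> hi a1; elim: d => [|d IHd] ld; first by rewrite subr0.
have /IHd e : (l + d <= L)%N by lia.
apply/eqP; rewrite eq_le cell_average_le1//= -e.
have -> : jT - l%:Z - 1 - d.+1%:Z = jT - l%:Z - 1 - d%:Z - 1 by lia.
by apply: window_monotone => //; lia.
Qed.

Lemma window_empty_above i (l d : nat) : iT - (2 * k)%N%:Z <= i <= iT + (2 * k)%N%:Z ->
  a i (jT + l%:Z + 1) = 0 -> (l + d <= L)%N -> a i (jT + l%:Z + 1 + d%:Z) = 0.
Proof.
move=> hi a1; elim: d => [|d IHd] ld; first by rewrite addr0.
have /IHd e : (l + d <= L)%N by lia.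
apply/eqP; rewrite eq_le cell_average_ge0// andbT -[leRHS]e.
have -> : jT + l%:Z + 1 + d%:Z = jT + l%:Z + 1 + d.+1%:Z - 1 by lia.
by apply: window_monotone => //; lia.
Qed.

Lemma window_column_sum i (Q : {poly R}) : iT - (2 * k)%N%:Z <= i <= iT + (2 * k)%N%:Z ->
  Q^`() = q ->
  `|column_sum h a jT L L i + (jT - L%:Z)%:~R * h
     - h^-1 * (Q.[(i + 1)%:~R * h] - Q.[i%:~R * h])| <= E.
Proof.
move=> hi Qq; pose b : R := (jT - L%:Z)%:~R * h; pose n := (L + L).+1.
have tE : jT - L%:Z + n%:Z = jT + L%:Z + 1 by rewrite /n; lia.
have ii : i%:~R * h <= (i + 1)%:~R * h by apply: lez; rewrite lerDl.
have [||m [mE mle]] := @column_squeeze R A q Q (i%:~R * h) ((i + 1)%:~R * h) b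
    ((jT - L%:Z + n%:Z)%:~R * h) E mA ii (wE W) Qq.
- move=> x; rewrite in_itv/= => hx; have [q1 q2] := wq W (colP hi hx).
  by rewrite tE (ltW q2).
- move=> x y; rewrite !in_itv/= tE => hx /andP[y1 y2]; apply: (wsq W (colP hi hx)).
  rewrite (le_trans _ y1)/=; last by apply: lez; lia.
  by rewrite (lt_le_trans y2)//; apply: lez; lia.
move: mE; rewrite cell_row_measure// => -[mE].
have hn0 : h != 0 by rewrite gt_eqF.
have -> : column_sum h a jT L L i + b - h^-1 * (Q.[(i + 1)%:~R * h] - Q.[i%:~R * h]) =
    h^-1 * (m - (Q.[(i + 1)%:~R * h] - Q.[i%:~R * h] - b * ((i + 1)%:~R * h - i%:~R * h))).
  rewrite -mE /column_sum -/a -/n [X in b * (X - _)]intrSl.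
  by set S := \sum_(_ < _) _; field.
rewrite normrM gtr0_norm ?invr_gt0// mulrC ler_pdivrMr//.
by rewrite (le_trans mle)// intrSl addrAC subrr add0r.
Qed.

Lemma window_has_stencil (km kp : nat) : (km <= 2 * k)%N -> (kp <= 2 * k)%N ->
  (0 < L)%N -> exists lm lp, is_stencil a iT jT km kp lm lp.
Proof.
move=> hm hp L0.
have hi i : iT - km%:Z <= i <= iT + kp%:Z -> iT - (2 * k)%N%:Z <= i <= iT + (2 * k)%N%:Z by lia.
have [|lm hlm] := @is_least_exists (fun l => (0 < l)%N /\ row_equals a iT km kp (jT - l%:Z - 1) 1) L.
  by split => // i /hi; exact: window_row_full.
have [|lp hlp] := @is_least_exists (fun l => (0 < l)%N /\ row_equals a iT km kp (jT + l%:Z + 1) 0) L.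
  by split => // i /hi; exact: window_row_empty.
by exists lm, lp; split.
Qed.

(** By minimality the stencil is within the window, and by monotonicity the rows in
    between are full or empty. *)
Lemma window_stencil_column (km kp lm lp : nat) i (Q : {poly R}) :
  (km <= 2 * k)%N -> (kp <= 2 * k)%N -> (0 < L)%N ->
  is_stencil a iT jT km kp lm lp -> iT - km%:Z <= i <= iT + kp%:Z -> Q^`() = q ->
  `|column_sum h a jT lm lp i + (jT - lm%:Z)%:~R * h
     - h^-1 * (Q.[(i + 1)%:~R * h] - Q.[i%:~R * h])| <= E.
Proof.
move=> hm hp L0 [[[lm0 rm] lmin] [[lp0 rp] lpin]] hi Qq.
have hi' i' : iT - km%:Z <= i' <= iT + kp%:Z ->
  iT - (2 * k)%N%:Z <= i' <= iT + (2 * k)%N%:Z by lia.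
have lmL : (lm <= L)%N.
  by apply: lmin; split => // i' /hi'; exact: window_row_full.
have lpL : (lp <= L)%N.
  by apply: lpin; split => // i' /hi'; exact: window_row_empty.
have := window_column_sum (hi' _ hi) Qq.
rewrite -(@column_sum_extend h a jT lm lp (L - lm) (L - lp)) ?subnKC//.
- move=> d hd; apply: window_full_below => //; [exact: hi'|exact: rm|lia].
- move=> d hd; apply: window_empty_above => //; [exact: hi'|exact: rp|lia].
Qed.

End Window.

(** Every polynomial that the algorithm may produce has nearly the same averages as
    [q] over [2 * k + 1] consecutive intervals. *)
Lemma window_aeros (k : nat) : exists K : R, 0 <= K /\
  forall h A (iT jT : int) (q : {poly R}) (E : R) (L : nat),
  0 < h -> measurable A -> window k h A iT jT q E L -> (0 < L)%N ->
  let a := cell_average \1_A h in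
  (exists p km kp lm lp, aeros_stencil k a iT jT km kp lm lp /\
     fits_columns k h a iT jT km kp lm lp p) /\
  (forall p km kp lm lp, aeros_stencil k a iT jT km kp lm lp ->
     fits_columns k h a iT jT km kp lm lp p ->
     forall x, iT%:~R * h <= x <= (iT + 1)%:~R * h -> `|p.[x] - q.[x]| <= K * E).
Proof.
have [K [K0 HK]] := @averages_stable R (2 * k + 1).
exists K; split => // h A iT jT q E L h0 mA W L0 a.
have lez (m : int) : m%:~R * h <= (m + 1)%:~R * h by rewrite intrSl lerDl ltW.
split.
  have [||lm [lp st]] := @window_has_stencil k h A iT jT q E L h0 mA W k k _ _ L0; try lia.
  pose c (m : nat) := h * (column_sum h a jT lm lp (iT - k%:Z + m%:Z) + (jT - lm%:Z)%:~R * h).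
  have [p [P [sp Pp PE]]] := @averages_exist R (2 * k + 1) ((iT - k%:Z)%:~R * h) h c h0 ltac:(lia).
  exists p, k, k, lm, lp; split; first by split => //; [lia|left].
  split; first by rewrite -addn1.
  move=> i hi; rewrite (Rintegral_horner (lez i) Pp).
  have [m [mk iE]] : exists m : nat, (m < 2 * k + 1)%N /\ i = iT - k%:Z + m%:Z.
    by exists (absz (i - (iT - k%:Z))%R); split; lia.
  have e1 : (i + 1)%:~R * h = (iT - k%:Z)%:~R * h + m.+1%:R * h.
    by rewrite -mulrDl iE -[m.+1%:R]/(m.+1%:Z%:~R) -intrD; congr (_%:~R * h); lia.
  have e2 : i%:~R * h = (iT - k%:Z)%:~R * h + m%:R * h.
    by rewrite -mulrDl iE -[m%:R]/(m%:Z%:~R) -intrD.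
  by rewrite e1 e2 PE// /c -iE mulKf ?gt_eqF.
move=> p km kp lm lp [kk st _] [sp fp] x /andP[x1 x2].
have [P [Pp sP]] := primitive_exists p; have [Q [Qq sQ]] := primitive_exists q.
have sPQ : (size (P - Q)%R <= (2 * k + 1).+1)%N.
  rewrite (leq_trans (size_polyD _ _))// geq_max size_polyN addn1.
  by rewrite (leq_trans sP)// (leq_trans sQ)// ltnS (wsize W).
pose x0 : R := (iT - km%:Z)%:~R * h.
pose t : R := (x - x0) / h.
have hn0 : h != 0 by rewrite gt_eqF.
have xE : x = x0 + t * h by rewrite /t divfK// subrKC.
have -> : p.[x] - q.[x] = (p - q).[x0 + t * h] by rewrite -xE hornerD hornerN.
apply: (HK _ (P - Q) x0 h E) => //; first by rewrite derivB Pp Qq.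
  move=> m mk; set i : int := iT - km%:Z + m%:Z.
  have hi : iT - km%:Z <= i <= iT + kp%:Z by rewrite /i; lia.
  have e1 : (i + 1)%:~R * h = x0 + m.+1%:R * h.
    by rewrite /x0 -mulrDl -[m.+1%:R]/(m.+1%:Z%:~R) -intrD; congr (_%:~R * h); rewrite /i; lia.
  have e2 : i%:~R * h = x0 + m%:R * h.
    by rewrite /x0 -mulrDl -[m%:R]/(m%:Z%:~R) -intrD.
  have := @window_stencil_column k h A iT jT q E L h0 mA W km kp lm lp i Q ltac:(lia) ltac:(lia) L0 st hi Qq.
  rewrite -/a -(fp i hi) (Rintegral_horner (lez i) Pp) -mulrBr normrM gtr0_norm ?invr_gt0//.
  rewrite mulrC ler_pdivrMr// [E * h]mulrC e1 e2 !hornerD !hornerN.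
  by apply: le_trans; rewrite le_eqVlt; apply/orP; left; apply/eqP; congr (`|_|); ring.
have tE : t = x / h - (iT - km%:Z)%:~R.
  by rewrite /t /x0; field.
rewrite tE; apply/andP; split.
  rewrite subr_ge0 ler_pdivlMr// (le_trans _ x1)// ler_pM2r// ler_int; lia.
rewrite lerBlDr ler_pdivrMr// (le_trans x2)// ler_pM2r//.
by rewrite -[(2 * k + 1)%:R]/((2 * k + 1)%N%:Z%:~R) -intrD ler_int; lia.
Qed.

End Stencils.

(** * The interface near a singular cell *)

Section LocalError.
Context {R : realType}.
Local Notation mR := (measurableTypeR R).
Local Notation plane := (mR * mR)%type.
Implicit Types (h : R) (i j : int).

Lemma powR_small (sg e : R) : 0 < sg -> 0 < e ->
  exists h0 : R, 0 < h0 /\ forall h, 0 <= h -> h <= h0 -> h `^ sg <= e.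
Proof.
move=> sg0 e0; exists (e `^ sg^-1); split; first exact: powR_gt0.
move=> h hp hh; rewrite (@le_trans _ _ ((e `^ sg^-1) `^ sg))//.
  by rewrite ge0_ler_powR ?nnegrE ?powR_ge0 ?(ltW sg0).
by rewrite -powRrM mulVf ?gt_eqF// powRr1// ltW.
Qed.

Lemma powR_split (h r : R) : 0 < h -> h `^ r = h * h `^ (r - 1).
Proof.
move=> h0; rewrite -{2}[h]powRr1 ?(ltW h0)// -powRD ?subrKC//.
by apply/implyP => _; rewrite gt_eqF.
Qed.

(** On the scale of the mesh the interface is a line up to o(h); [orientation]
    then bounds its slope in the selected frame. The error is o(h)
    because [r > 1]. *)
Lemma chart_orientation n (C rho r d : R) : 1 < r -> 0 < C -> 0 < rho -> 0 < d -> 40 * d <= 1 ->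
  exists h0, 0 < h0 /\ forall h (A : set plane) i j (z0 e1 e2 : R * R) (p : {poly R}),
    0 < h -> h <= h0 -> measurable A -> taylor_chart n C rho r A z0 e1 e2 p ->
    i%:~R * h <= z0.1 <= i%:~R * h + h -> j%:~R * h <= z0.2 <= j%:~R * h + h ->
    `|aerosH (cell_average \1_A h) i j| <= `|aerosV (cell_average \1_A h) i j| ->
    aerosV (cell_average \1_A h) i j <= 0 ->
    d <= e2.2 - p`_1 * e1.2.
Proof.
move=> r1 C0 rho0 d0 d40.
have r10 : 0 < r - 1 by rewrite subr_gt0.
(* The tolerance [d / 10 * h] of [orientation] is shared between the quadratic part of
   the Taylor polynomial and its remainder; [k1] and [k2] are their constants at
   distance [6 * h]. *)
pose k1 : R := n.+1%:R * C * 36.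
have k10 : 0 < k1 by rewrite !mulr_gt0.
pose k2 : R := C * 6 `^ r.
have k20 : 0 < k2 by rewrite mulr_gt0// powR_gt0.
have d20 : 0 < d / 20 by clear - d0; lra.
have [h2 [h20 Hh2]] := powR_small r10 (divr_gt0 d20 k20).
pose h0 := Num.min (Num.min (1 / 6) (rho / 3)) (Num.min (d / 20 / k1) h2).
exists h0; split.
  by rewrite !lt_min h20 !divr_gt0.
move=> h A i j z0 e1 e2 p hp; rewrite !le_min => /andP[/andP[ha hb] /andP[hc hd]] mA ch hx hy.
have [on sp p0 pC H] := ch; have [se1 se2] := orthonormal2_small on.
set nx := e2.1 - p`_1 * e1.1; set ny := e2.2 - p`_1 * e1.2.
apply: (@orientation R h A i j z0 nx ny d) => //.
  have -> : nx ^+ 2 + ny ^+ 2 = (e2.1 ^+ 2 + e2.2 ^+ 2)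
     - 2 * p`_1 * (e1.1 * e2.1 + e1.2 * e2.2) + p`_1 ^+ 2 * (e1.1 ^+ 2 + e1.2 ^+ 2).
    by rewrite /nx /ny; ring.
  case: on => -> -> ->; have := sqr_ge0 p`_1; clear; lra.
move=> z hX hY L.
have rz (x : R) : `|x| <= 3 * h -> `|x| <= rho.
  by move=> hx'; apply: (le_trans hx'); clear - hb; lra.
have := H z (rz _ hX) (rz _ hY); set G := implicit_eq _ _ _ _ _ => -[G1 G2].
set w := axis_coord e1 z0 z in G1 G2.
have hw : `|w| <= 6 * h.
  by apply: (le_trans (axis_coord_le se1 hX hY)); rewrite mulrA -natrM.
have wr : C * `|w| `^ r <= d / 20 * h.
  apply: (@le_trans _ _ (C * (6 * h) `^ r)).
    rewrite ler_wpM2l ?(ltW C0)// ge0_ler_powR ?nnegrE ?mulr_ge0 ?(ltW hp)//.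
    by rewrite ltW// (lt_trans ltr01).
  rewrite powRM ?(ltW hp)// mulrA -/k2 powR_split// mulrCA mulrC ler_pM2r//.
  by rewrite mulrC -ler_pdivlMr// Hh2// ltW.
have h61 : 6 * h <= 1 by clear - ha; lra.
have h60 : `|0 : R| <= 6 * h by rewrite normr0 mulr_ge0// ltW.
have := horner_linear_approx sp hw h60 h61; rewrite p0 !subr0 => lin.
have lin' : `|p.[w] - p`_1 * w| <= d / 20 * h.
  apply: (le_trans lin); apply: (@le_trans _ _ (k1 * h * h)); last first.
    by rewrite ler_pM2r// mulrC -ler_pdivlMr.
  have -> : k1 * h * h = n.+1%:R * C * (6 * h * (6 * h)).
    by rewrite /k1; ring.
  rewrite -!mulrA; apply: ler_wpM2l => //.
  apply: ler_pM => //; rewrite ?coef_norm_ge0 ?mulr_ge0 ?(ltW hp)//.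
  by rewrite !ler_wpM2l// ltW.
have LG : G = L - (p.[w] - p`_1 * w).
  by rewrite /L /nx /ny /G /implicit_eq /w /axis_coord; ring.
move: lin'; rewrite ler_norml => /andP[l1 l2]; split.
  by move=> hL; apply: G1; rewrite LG; clear - wr hL l1 l2; lra.
by move=> /G2; rewrite LG; clear - wr l1 l2; lra.
Qed.

(** Once the slope is bounded below, the interface near the cell is, up to
    O(h^r), the graph of a polynomial solving the Taylor equation implicitly. *)
Lemma chart_window k (C rho r d : R) : 1 < r -> r <= (2 * k + 1)%:R ->
  0 < C -> 0 < rho -> 0 < d ->
  exists h0 CE (L : nat), [/\ 0 < h0, 0 <= CE, (0 < L)%N &
   forall h (A : set plane) i j (z0 e1 e2 : R * R) (p : {poly R}),
    0 < h -> h <= h0 -> taylor_chart (2 * k + 1) C rho r A z0 e1 e2 p ->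
    i%:~R * h <= z0.1 <= i%:~R * h + h -> j%:~R * h <= z0.2 <= j%:~R * h + h ->
    d <= e2.2 - p`_1 * e1.2 ->
    exists q : {poly R}, window k h A i j q (CE * h `^ r) L].
Proof.
move=> r1 rk C0 rho0 d0.
have r0 : 0 < r by exact: lt_trans r1.
have r10 : 0 < r - 1 by rewrite subr_gt0.
have n0 : (0 < 2 * k + 1)%N by rewrite addn1.
have [B [rho' [B1 rho'0 rho'1 HB]]] := @implicit_squeeze R (2 * k + 1) C d r C0 d0 r0 rk n0.
have B0 : 0 <= B by exact: le_trans B1.
(* Over the columns of the window, the graph of [q] moves away from [z0] by at most
   [B * (2 * k + 2) * h]. The square of half-side [N * h] around [z0] contains the
   window. *)
pose L := (Num.truncn (B * (2 * k + 2)%:R)).+3.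
have LB : B * (2 * k + 2)%:R + 2 <= L%:R.
  have /ltW := truncnS_gt (B * (2 * k + 2)%:R); rewrite /L.
  set t := Num.truncn _; rewrite -[t.+3%:R]natr1 -[t.+2%:R]natr1.
  by clear; lra.
pose N : R := (L + 2 * k + 6)%:R.
have N0 : 0 < N by rewrite ltr0n addnS.
pose CE := B * N `^ r.
have CE0 : 0 <= CE by rewrite mulr_ge0 ?powR_ge0.
have CE1 : 0 < 2 * (CE + 1) by rewrite mulr_gt0// ltr_wpDl.
have CE2 : 0 < (2 * (CE + 1))^-1 by rewrite invr_gt0.
have [h2 [h20 Hh2]] := powR_small r10 CE2.
pose h0 := Num.min (Num.min (rho / N) (rho' / N)) h2.
exists h0, CE, L; split => //; first by rewrite !lt_min h20 !divr_gt0.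
move=> h A i j z0 e1 e2 p hp; rewrite !le_min => /andP[/andP[ha hb] hc] ch hx hy sl.
have [on sp p0 pC H] := ch; have [se1 se2] := orthonormal2_small on.
have D : implicit_data (2 * k + 1) C d e1 e2 p by [].
have [q0 [sq0 q00 nq0 Hq0]] := HB _ _ _ D.
pose eta := N * h.
have eta0 : 0 <= eta by rewrite /eta mulr_ge0 ?(ltW N0) ?(ltW hp).
have etar : eta <= rho by rewrite /eta mulrC -ler_pdivlMr.
have etar' : eta <= rho' by rewrite /eta mulrC -ler_pdivlMr.
have EE : B * eta `^ r = CE * h `^ r by rewrite /eta powRM ?(ltW N0) ?(ltW hp)// mulrA.
have Eh : 2 * (CE * h `^ r) <= h.
  have := Hh2 h (ltW hp) hc; rewrite (powR_split r hp) -div1r ler_pdivlMr// => hh.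
  have p0' := powR_ge0 h (r - 1); move: hh p0'; set w := h `^ _ => hh p0'.
  have -> : 2 * (CE * (h * w)) = h * (2 * (CE * w)) by ring.
  by rewrite -[leRHS]mulr1 ler_pM2l//; clear - hh p0'; lra.
pose q := (q0 \Po ('X - z0.1%:P)) + z0.2%:P.
have qE x : q.[x] = q0.[x - z0.1] + z0.2.
  by rewrite hornerD hornerC horner_comp hornerXsubC.
have colX x : (i - (2 * k)%N%:Z)%:~R * h <= x < (i + (2 * k)%N%:Z + 1)%:~R * h ->
    `|x - z0.1| <= (2 * k + 2)%:R * h.
  rewrite intrB !intrD mulrBl !mulrDl natrD mulrDl mul1r; set m := i%:~R * h in hx *.
  rewrite -!pmulrn; set kk := (2 * k)%:R * h; move=> /andP[x1 x2].
  have k0 : 0 <= kk by rewrite mulr_ge0// ltW.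
  case/andP: hx => y1 y2; rewrite ler_norml; apply/andP.
  by split; clear - x1 x2 y1 y2 k0 hp; lra.
have rowY y : (j - L%:Z - 2)%:~R * h <= y < (j + L%:Z + 3)%:~R * h ->
    `|y - z0.2| <= (L + 3)%:R * h.
  have -> : (j - L%:Z - 2)%:~R * h = j%:~R * h - L%:R * h - 2 * h.
    by rewrite !intrB !mulrBl.
  have -> : (j + L%:Z + 3)%:~R * h = j%:~R * h + L%:R * h + 3 * h.
    by rewrite !intrD !mulrDl.
  have -> : (L + 3)%:R * h = L%:R * h + 3 * h by rewrite natrD mulrDl.
  set m := j%:~R * h in hy *; set kk := L%:R * h; move=> /andP[x1 x2].
  case/andP: hy => y1 y2; rewrite ler_norml; apply/andP.
  by split; clear - x1 x2 y1 y2 hp; lra.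
have Xeta : (2 * k + 2)%:R * h <= eta.
  by rewrite /eta ler_pM2r// /N ler_nat; clear; lia.
have Yeta : (L + 3)%:R * h <= eta.
  by rewrite /eta ler_pM2r// /N ler_nat; clear; lia.
exists q; split.
- rewrite -addn1 (leq_trans (size_polyD _ _))// geq_max (leq_trans (size_polyC_leq1 _))// andbT.
  by rewrite size_comp_poly2 ?size_XsubC.
- by rewrite mulr_ge0 ?powR_ge0.
- by [].
- move=> x y hx' hy'; have X1 := le_trans (colX x hx') Xeta.
  have Y1 := le_trans (rowY y hy') Yeta.
  have [S1 S2] := Hq0 eta (x - z0.1) (y - z0.2) eta0 etar' X1 Y1.
  have /= [T1 T2] := H (x, y) (le_trans X1 etar) (le_trans Y1 etar).
  set w := axis_coord e1 z0 (x, y) in T1 T2.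
  have hw : C * `|w| `^ r <= C * (2 * eta) `^ r.
    have eta2 : 0 <= 2 * eta by rewrite (le_trans eta0)// ler_peMl// ler1n.
    rewrite ler_wpM2l ?(ltW C0)// ge0_ler_powR ?nnegrE ?(ltW r0)//.
    exact: (@axis_coord_le R e1 z0 (x, y) eta se1 X1 Y1).
  rewrite qE -EE; split => [hyq|/T2 hG].
    by apply: T1; apply: (le_trans (S1 _)); [clear - hyq; lra|rewrite lerN2].
  rewrite leNgt; apply/negP => hyq.
  have /S2 : q0.[x - z0.1] + B * eta `^ r < y - z0.2 by clear - hyq; lra.
  by rewrite ltNge (le_trans hG hw).
- move=> x hx'; have X0 := colX x hx'; have X1 := le_trans X0 Xeta.
  have xs : `|x - z0.1| <= 1 by apply: (le_trans X1); exact: le_trans rho'1.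
  have q0b : `|q0.[x - z0.1]| <= B * (2 * k + 2)%:R * h.
    apply: (le_trans (coef_norm_horner0 q00 xs)); rewrite -mulrA.
    by apply: ler_pM; rewrite ?coef_norm_ge0.
  have LBh : B * (2 * k + 2)%:R * h + 2 * h <= L%:R * h by rewrite -mulrDl ler_pM2r.
  have E0 : 0 <= CE * h `^ r by rewrite mulr_ge0 ?powR_ge0.
  have -> : (j - L%:Z)%:~R * h = j%:~R * h - L%:R * h by rewrite intrB mulrBl.
  have -> : (j + L%:Z + 1)%:~R * h = j%:~R * h + L%:R * h + h.
    by rewrite intrSl intrD mulrDl.
  rewrite qE.
  move: q0b LBh Eh E0; rewrite ler_norml => /andP[b1 b2].
  case/andP: hy => y1 y2; move: (CE * _) => E; move: (B * _ * h) b1 b2 => bb b1 b2 LBh Eh E0.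
  by split; clear - b1 b2 LBh Eh E0 y1 y2 hp; lra.
Qed.

End LocalError.

(** * The local error bound *)

Section LocalBound.
Context {R : realType}.
Local Notation mR := (measurableTypeR R).
Local Notation plane := (mR * mR)%type.
Local Notation mu := (@lebesgue_measure2 R).
Implicit Types (h : R) (i j : int) (Omega : set plane).

(** Cells are convex, so that [segment_boundary] applies inside the cell. *)
Lemma singular_boundary Omega h i j : closed (Omega : set (R * R)) ->
  singular Omega h i j -> exists z, boundary (Omega : set (R * R)) z /\ cell h i j z.
Proof.
move=> cO [s1 s2].
have [z [cz Oz]] : exists z, (cell h i j `&` Omega) z.
  apply: contrapT => H; apply: s1; suff -> : cell h i j `&` Omega = set0 by rewrite measure0.
  by apply/seteqP; split => // z Hz; apply: H; exists z.
have [w [cw Ow]] : exists z, (cell h i j `&` ~` Omega) z.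
  apply: contrapT => H; apply: s2; suff -> : cell h i j `&` ~` Omega = set0 by rewrite measure0.
  by apply/seteqP; split => // z' Hz; apply: H; exists z'.
have [t [/andP[t0 t1] bt]] := segment_boundary cO Oz Ow.
exists (z.1 + t * (w.1 - z.1), z.2 + t * (w.2 - z.2)); split => //.
have conv (a b x y : R) : a <= x < b -> a <= y < b -> a <= x + t * (y - x) < b.
  move=> /andP[x1 x2] /andP[y1 y2].
  have -> : x + t * (y - x) = (1 - t) * x + t * y by ring.
  have u0 : 0 <= 1 - t by clear - t1; lra.
  apply/andP; split.
    have := ler_wpM2l u0 x1; have := ler_wpM2l t0 y1; clear; lra.
  have [t00|tn] := eqVneq t 0; first by rewrite t00 subr0 mul1r mul0r addr0.
  have tp : 0 < t by rewrite lt_neqAle eq_sym tn.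
  have := ler_wpM2l u0 (ltW x2); have : t * y < t * b by rewrite ltr_pM2l.
  by clear; lra.
move: cz cw => /in_cellP[z1 z2] /in_cellP[w1 w2]; apply/in_cellP.
by split; apply: conv.
Qed.

Lemma measurable_subgraph (p : {poly R}) : measurable ([set w | w.2 <= p.[w.1]] : set plane).
Proof.
have mf : measurable_fun setT (fun w : plane => p.[w.1]).
  exact: measurableT_comp (measurable_horner p) measurable_fst.
have mg : measurable_fun setT (fun w : plane => w.2 : R) by exact: measurable_snd.
have mt : measurable [set true] by [].
have := measurable_fun_ler mg mf measurableT mt.
by rewrite setTI; congr (measurable _); apply/seteqP; split => w.
Qed.

Lemma measurable_strip (p : {poly R}) (a b c : R) :
  measurable ([set w | w.1 \in `[a, b] /\ `|w.2 - p.[w.1]| <= c] : set plane).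
Proof.
have mf : measurable_fun setT (fun w : plane => w.2 - p.[w.1] : R).
  apply: measurable_funB; first exact: measurable_snd.
  exact: measurableT_comp (measurable_horner p) measurable_fst.
have -> : [set w | w.1 \in `[a, b] /\ `|w.2 - p.[w.1]| <= c] =
   (`[a, b]%classic `*` setT) `&` (setT `&` (fun w : plane => w.2 - p.[w.1]) @^-1` `[- c, c]).
  by apply/seteqP; split => w /=; rewrite !in_itv/= -!ler_norml; [case|case=> -[? _] []].
apply: measurableI; first by apply: measurableX => //; exact: measurable_itv.
by apply: mf => //; exact: measurable_itv.
Qed.

Lemma measurable_recovered_set a i j (p : {poly R}) :
  measurable (recovered_set a i j p : set plane).
Proof.
have := @measurable_to_frame R (aeros_form a i j) measurableT _ (measurable_subgraph p).
by rewrite setTI.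
Qed.

Lemma L1_norm_recovery_eq Omega (D : set plane) a i j (p : {poly R}) :
  measurable Omega -> measurable D ->
  let Y := D `&` [set z | \1_Omega z != recovery a i j p z] in
  measurable (Y : set plane) /\
  mu Y = L1_norm D (fun z => \1_Omega z - recovery a i j p z)%R.
Proof.
move=> mO mD Y; have mS := measurable_recovered_set a i j p.
set S := recovered_set a i j p in mS.
have YE : [set z | \1_Omega z != recovery a i j p z] = (Omega `\` S) `|` (S `\` Omega).
  apply/seteqP; split => z /=.
    rewrite /recovery !indicE -/S; case: (boolP (z \in Omega)) => hO; case: (boolP (z \in S)) => hS;
      rewrite ?eqxx// => _; [left|right].
      by split; [exact: set_mem|move=> w; move/negP: hS; apply; exact: mem_set].
    by split; [exact: set_mem hS|move=> w; move/negP: hO; apply; exact: mem_set].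
  rewrite /recovery !indicE -/S => -[[z1 z2]|[z1 z2]].
    by rewrite (mem_set z1) (memNset z2) oner_neq0.
  by rewrite (mem_set z1) (memNset z2) eq_sym oner_neq0.
have mY : measurable (Y : set plane).
  by apply: measurableI => //; rewrite YE; apply: measurableU; exact: measurableD.
split => //.
rewrite /L1_norm (eq_integral (fun z => (\1_Y z)%:E)); last first.
  move=> z /set_mem Dz; rewrite abse_EFin; congr EFin.
  have [e|ne] := eqVneq (\1_Omega z : R) (recovery a i j p z).
    by rewrite e subrr normr0 indicE memNset// => -[_]; rewrite /= e eqxx.
  rewrite [RHS]indicE mem_set//=.
  move: ne; rewrite /recovery !indicE.
  by do 2!case: (_ \in _); rewrite /= ?eqxx// ?subr0 ?sub0r ?normrN ?normr1.
by rewrite integral_indic// setIC; congr (mu _); apply/seteqP; split => z; [case|move=> [? ?]].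
Qed.

Lemma L1_norm_recovery Omega (D X : set plane) a i j (p : {poly R}) :
  measurable Omega -> measurable D -> measurable X ->
  (forall z, D z -> \1_Omega z != recovery a i j p z -> X z) ->
  (L1_norm D (fun z => \1_Omega z - recovery a i j p z)%R <= mu X)%E.
Proof.
move=> mO mD mX H; have [mY <-] := L1_norm_recovery_eq a i j p mO mD.
by apply: le_measure; rewrite ?inE// => z [Dz ne]; exact: H.
Qed.

Lemma L1_norm_recovery_cell Omega h i j a (p : {poly R}) : 0 <= h -> measurable Omega ->
  (L1_norm (cell h i j) (fun z => \1_Omega z - recovery a i j p z)%R <= (h ^+ 2)%:E)%E.
Proof.
move=> h0 mO; rewrite -(lebesgue2_cell i j h0).
by apply: L1_norm_recovery => //; exact: measurable_cell.
Qed.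

Lemma cell_to_frame_closed (f : Defs.form) h i j (z : R * R) : cell h i j z ->
  (cell_to_frame f i j).1%:~R * h <= (to_frame f z).1 <= (cell_to_frame f i j).1%:~R * h + h /\
  (cell_to_frame f i j).2%:~R * h <= (to_frame f z).2 <= (cell_to_frame f i j).2%:~R * h + h.
Proof.
move=> /in_cellP[/andP[x1 x2] /andP[y1 y2]].
have e (m : int) : (-1 - m)%:~R * h = - (m%:~R * h) - h :> R.
  by rewrite intrB mulrBl; ring.
have e' (m : int) (x : R) : m%:~R * h <= x -> x < m%:~R * h + h ->
    (-1 - m)%:~R * h <= - x <= (-1 - m)%:~R * h + h.
  by rewrite e => a1 a2; apply/andP; split; clear - a1 a2; lra.
by case: f => /=; rewrite ?x1 ?y1 ?(ltW x2) ?(ltW y2) ?e'.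
Qed.

(** The local estimate on fine meshes: with [f] the selected form, the set seen in
    the frame [f] satisfies the hypotheses of [chart_orientation],
    hence of [chart_window] and [window_aeros]. *)
Lemma aeros_local_error k s Omega : 1 < s -> (0 < k)%N -> Cs_domain s (Omega : set (R * R)) ->
  let r := Num.min s (2 * k + 1)%:R in
  exists h0 C1 : R, [/\ 0 < h0, 0 <= C1 & forall h i j, 0 < h -> h <= h0 ->
    singular Omega h i j -> forall p, aeros_output k h (cell_average \1_Omega h) i j p ->
    (L1_norm (cell h i j) (fun z => \1_Omega z - recovery (cell_average \1_Omega h) i j p z)%R
      <= (C1 * h `^ (r + 1))%:E)%E].
Proof.
move=> s1 k0 Cs r.
have cO := Cs_domain_closed (ltW s1) Cs.
have mO := closed_measurable_plane cO.
have [C [rho [C0 rho0 ch]]] := Cs_domain_taylor_charts k (ltW s1) Cs.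
rewrite -/r in ch.
have r1 : 1 < r by rewrite lt_min s1/= ltr1n addn1 ltnS muln_gt0.
have rk : r <= (2 * k + 1)%:R by rewrite ge_min lexx orbT.
(* The largest lower bound on the slope that [orientation] provides. *)
pose d : R := 1 / 40.
have d0 : 0 < d by rewrite /d; clear; lra.
have d40 : 40 * d <= 1 by rewrite /d; clear; lra.
have [h1 [h10 OR]] := @chart_orientation R (2 * k + 1) C rho r d r1 C0 rho0 d0 d40.
have [h2 [CE [L [h20 CE0 L0 WI]]]] := chart_window r1 rk C0 rho0 d0.
have [K [K0 HK]] := @window_aeros R k.
pose c := (K + 1) * CE.
have c0 : 0 <= c by rewrite mulr_ge0// addr_ge0.
exists (Num.min h1 h2), (4 * c); split.
- by rewrite lt_min h10.
- by rewrite mulr_ge0.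
move=> h i j hp; rewrite le_min => /andP[hh1 hh2] sing p.
set a := cell_average \1_Omega h; set f := aeros_form a i j.
set iT := (cell_to_frame f i j).1; set jT := (cell_to_frame f i j).2.
pose A : set plane := from_frame f @^-1` Omega.
have OA : Omega = @to_frame R f @^-1` A.
  by apply/seteqP; split => z; rewrite /A /= to_frameK.
have mA : measurable A.
  have -> : A = @to_frame R f @^-1` (@to_frame R f @^-1` (@to_frame R f @^-1` Omega)).
    by apply/seteqP; split => -[x y]; rewrite /A /=; case: (f); rewrite /= ?opprK.
  have pre (Y : set plane) : measurable Y -> measurable (@to_frame R f @^-1` Y : set plane).
    by move=> mY; rewrite -[X in measurable X]setTI; exact: (@measurable_to_frame R f measurableT _ mY).
  exact: (pre _ (pre _ (pre _ mO))).
have dat : data_in_frame f a = cell_average \1_A h.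
  by rewrite /a {1}OA data_in_frame_indic.
have [z0 [bz0 cz0]] := singular_boundary cO sing.
have [e1 [e2 [P chz]]] := ch z0 bz0.
have chA := taylor_chart_frame f chz; rewrite -/A in chA.
have [zx zy] := cell_to_frame_closed f cz0; rewrite -/iT -/jT in zx zy.
have [HV V0] := aeros_form_in_frame a i j; rewrite -/f -/iT -/jT dat in HV V0.
have sl := OR h A iT jT _ _ _ P hp hh1 mA chA zx zy HV V0.
have [q W] := WI h A iT jT _ _ _ P hp hh2 chA zx zy sl.
have [[q' [km [kp [lm [lp ex]]]]] st] := HK h A iT jT q _ L hp mA W L0.
have poly_frame p' : aeros_poly k h a i j p' <-> exists km kp lm lp,
   aeros_stencil k (cell_average \1_A h) iT jT km kp lm lp /\
   fits_columns k h (cell_average \1_A h) iT jT km kp lm lp p'.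
  by rewrite /aeros_poly -/f dat /iT /jT; case: (cell_to_frame f i j).
move=> out; have /poly_frame[km' [kp' [lm' [lp' [st' fit']]]]] : aeros_poly k h a i j p.
  by apply: out; exists q'; apply/poly_frame; exists km, kp, lm, lp.
have pq := st _ _ _ _ _ st' fit'.
pose E := CE * h `^ r.
pose Y : set plane := [set w | w.1 \in `[iT%:~R * h, (iT + 1)%:~R * h] /\
   `|w.2 - q.[w.1]| <= (K + 1) * E].
have mY : measurable Y by exact: measurable_strip.
have E0 : 0 <= E by rewrite mulr_ge0 ?powR_ge0.
have E1 : 0 <= (K + 1) * E by rewrite mulr_ge0// addr_ge0.
have muY : (mu Y <= (2 * ((K + 1) * E) * ((iT + 1)%:~R * h + h - iT%:~R * h))%:E)%E.
  apply: (@strip_measure R Y (horner q)) => //.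
    by rewrite intrSl; clear - hp; lra.
  move=> w [w1 w2]; split => //; move: w1; rewrite !in_itv/= => /andP[-> w1]/=.
  by rewrite (le_lt_trans w1)// ltrDl.
apply: (@le_trans _ _ (mu Y)); last first.
  apply: (le_trans muY); rewrite lee_fin intrSl.
  rewrite powRD ?powRr1 ?(ltW hp)//; last by apply/implyP => _; rewrite gt_eqF.
  by rewrite /E /c le_eqVlt; apply/orP; left; apply/eqP; ring.
rewrite -(lebesgue2_to_frame f mY); apply: L1_norm_recovery => //.
- exact: measurable_cell.
- by rewrite -[X in measurable X]setTI; exact: (@measurable_to_frame R f measurableT _ mY).
move=> z cz; have [wx wy] := cell_to_frame_closed f cz; rewrite -/iT -/jT in wx wy.
set w := to_frame f z in wx wy.
have wx' : iT%:~R * h <= w.1 <= (iT + 1)%:~R * h by rewrite intrSl.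
have cx : (iT - (2 * k)%N%:Z)%:~R * h <= w.1 < (iT + (2 * k)%N%:Z + 1)%:~R * h.
  case/andP: wx' => x1 x2; apply/andP; split.
    by rewrite (le_trans _ x1)// ler_pM2r// ler_int; clear; lia.
  by rewrite (le_lt_trans x2)// ltr_pM2r// ltr_int; clear - k0; lia.
have cy : (jT - L%:Z - 2)%:~R * h <= w.2 < (jT + L%:Z + 3)%:~R * h.
  move: wy; rewrite -intrSl => /andP[x1 x2]; apply/andP; split.
    by rewrite (le_trans _ x1)// ler_pM2r// ler_int; clear; lia.
  by rewrite (le_lt_trans x2)// ltr_pM2r// ltr_int; clear; lia.
have [S1 S2] := wsq W cx cy; have := pq _ wx'.
have wAE : Omega z <-> A (w.1, w.2).
  by rewrite OA /= -/w; case: (w).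
rewrite -/E in S1 S2 *; rewrite ler_norml => /andP[p1 p2].
rewrite /recovery !indicE => ne; split; first by rewrite in_itv.
have {ne} : (Omega z /\ ~ (w.2 <= p.[w.1])) \/ (~ Omega z /\ w.2 <= p.[w.1]).
  move: ne; case: (boolP (z \in Omega)) => hO;
    case: (boolP (z \in recovered_set a i j p)) => hP; rewrite ?eqxx// => _; [left|right].
    by split; [exact: set_mem|move=> hw; move/negP: hP; apply; exact: mem_set].
  by split; [move=> hw; move/negP: hO; apply; exact: mem_set|exact: set_mem hP].
have KE : 0 <= K * E by rewrite mulr_ge0.
rewrite mulrDl mul1r ler_norml => -[[/wAE/S2 a1 /negP]|[nO a2]].
  rewrite -ltNge => a2; rewrite /= -/w; apply/andP.
  by split; clear - a1 a2 p1 p2 KE E0; lra.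
have a1 : q.[w.1] - E < w.2.
  by rewrite ltNge; apply/negP => a1; apply/nO/wAE/S1.
rewrite /= -/w; apply/andP.
by split; clear - a1 a2 p1 p2 KE E0; lra.
Qed.

End LocalBound.

(** * The number of singular cells *)

Section Counting.
Context {R : realType}.
Implicit Types (h r M : R) (i j : int) (Omega : set (R * R)) (z : R * R).

(** Both points are on the graph of a Lipschitz function of the first axis
    coordinate. *)
Lemma chart_boundary_lipschitz r M Omega z0 (e1 e2 : R * R) psi z z' (t : R) : 0 <= M ->
  graph_chart r M Omega z0 e1 e2 psi ->
  boundary Omega z -> boundary Omega z' ->
  `|axis_coord e1 z0 z| < r -> `|axis_coord e2 z0 z| < r ->
  `|axis_coord e1 z0 z'| < r -> `|axis_coord e2 z0 z'| < r ->
  `|axis_coord e1 z0 z' - axis_coord e1 z0 z| <= t ->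
  `|z'.1 - z.1| <= (1 + M) * t /\ `|z'.2 - z.2| <= (1 + M) * t.
Proof.
move=> M0 G bz bz' k1 k2 k1' k2'.
have [on lip _] := G; have [se1 se2] := orthonormal2_small on.
have g := boundary_on_graph M0 G bz k1 k2.
have g' := boundary_on_graph M0 G bz' k1' k2'.
have Ez := local_point_coord z0 z on; have Ez' := local_point_coord z0 z' on.
move: k1 k2 k1' k2' g g' Ez Ez'.
set a := axis_coord e1 z0 z; set b := axis_coord e2 z0 z.
set a' := axis_coord e1 z0 z'; set b' := axis_coord e2 z0 z'.
move=> k1 k2 k1' k2' g g' <- <- ht.
have hb : `|b' - b| <= M * t.
  rewrite g g' (le_trans (lip _ _ _ _)) ?in_itv/= -?ltr_norml//.
  by rewrite ler_wpM2l.
have bd (x y : R) : `|x| <= 1 -> `|y| <= 1 -> `|(a' - a) * x + (b' - b) * y| <= (1 + M) * t.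
  move=> hx hy; rewrite (le_trans (ler_normD _ _))// !normrM mulrDl mul1r lerD//.
    by apply: (le_trans _ ht); rewrite ler_piMr.
  by apply: (le_trans _ hb); rewrite ler_piMr.
case: se1 se2 => u1 u2 [v1 v2]; rewrite /local_point /=; split.
  by have := bd _ _ u1 v1; apply: le_trans; rewrite le_eqVlt; apply/orP; left; apply/eqP; congr (`|_|); ring.
by have := bd _ _ u2 v2; apply: le_trans; rewrite le_eqVlt; apply/orP; left; apply/eqP; congr (`|_|); ring.
Qed.

Lemma truncn_eq_close (x y : R) : 0 <= x -> 0 <= y -> Num.truncn x = Num.truncn y ->
  `|x - y| <= 1.
Proof.
move=> x0 y0 e; have /andP[x1 x2] := truncn_itv x0; have /andP[y1 y2] := truncn_itv y0.
move: x1 x2 y1 y2; rewrite e -natr1; set t := _%:R => x1 x2 y1 y2.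
by rewrite ler_norml; apply/andP; split; clear - x1 x2 y1 y2; lra.
Qed.

(** A singular cell is determined, among O(1 / h) possibilities, by a coarse
    square containing a boundary point of it, the position of that point along
    the interface up to h in a chart, and its coordinates modulo a constant:
    two boundary points at distance h along the interface are O(h) apart. *)
Lemma singular_count s Omega : 1 <= s -> Cs_domain s Omega ->
  exists N : nat, forall ell : nat, (0 < ell)%N ->
   (#|[pred t : 'I_ell * 'I_ell |
      `[< singular Omega (ell%:R^-1 : R) t.1%:Z t.2%:Z >]]| <= N * ell)%N.
Proof.
move=> s1 Cs; have cO := Cs_domain_closed s1 Cs.
have [r [M [r0 M0 ch]]] := Cs_domain_graph_charts s1 Cs.
(* Boundary points in the same coarse square of side [Q%:R^-1] see each other in their
   charts. [Q2] bounds axis coordinates by 1. *)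
pose Q := (Num.truncn (2 / r)).+2.
have Q0 : (0 : R) < Q%:R by rewrite ltr0n.
have Qr : 2 / Q%:R < r.
  rewrite ltr_pdivrMr// -ltr_pdivrMl// mulrC.
  by rewrite (lt_le_trans (truncnS_gt _))// ler_nat.
have Q2 : 2 / Q%:R <= 1 :> R by rewrite ler_pdivrMr// mul1r ler_nat.
(* Cells containing boundary points that are [(1 + M) * h] apart have coordinates that
   differ by less than [B], hence are equal if congruent modulo [B]. *)
pose B := (Num.truncn (M + 2)).+1.
have BM : M + 2 < B%:R by exact: truncnS_gt.
pose cidx z : 'I_Q.+1 * 'I_Q.+1 := (inord (Num.truncn (Q%:R * z.1)), inord (Num.truncn (Q%:R * z.2))).
pose sq z := 0 <= z.1 <= 1 /\ 0 <= z.2 <= 1.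
have cidx_close z z' : sq z -> sq z' -> cidx z = cidx z' ->
    `|z.1 - z'.1| <= Q%:R^-1 /\ `|z.2 - z'.2| <= Q%:R^-1.
  have one (x y : R) : 0 <= x <= 1 -> 0 <= y <= 1 ->
      inord (Num.truncn (Q%:R * x)) = inord (Num.truncn (Q%:R * y)) :> 'I_Q.+1 -> `|x - y| <= Q%:R^-1.
    move=> /andP[x0 x1] /andP[y0 y1] /(congr1 (@nat_of_ord _)).
    have tr (t : R) : 0 <= t -> t <= 1 -> (Num.truncn (Q%:R * t) < Q.+1)%N.
      move=> t0 t1; rewrite truncn_lt_nat ?mulr_ge0 ?(ltW Q0)//.
      by rewrite -natr1 (@le_lt_trans _ _ Q%:R)// ?ltrDl// ler_piMr// ltW.
    rewrite !inordK ?tr// => /truncn_eq_close.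
    rewrite !mulr_ge0 ?(ltW Q0)// => /(_ isT isT).
    by rewrite -mulrBr normrM gtr0_norm// -ler_pdivlMl// mulr1.
  by move=> [a1 a2] [b1 b2] [/(one _ _ a1 b1) ? /(one _ _ a2 b2) ?].
have /choice[D HD] : forall c, exists D : (R * R) * (R * R) * (R * R) * (R -> R),
    forall z, sq z -> boundary Omega z -> cidx z = c ->
    [/\ sq D.1.1.1, cidx D.1.1.1 = c & graph_chart r M Omega D.1.1.1 D.1.1.2 D.1.2 D.2].
  move=> c; have [[z0 [sz0 bz0 cz0]]|no] := pselect (exists z, [/\ sq z, boundary Omega z & cidx z = c]).
    by have [e1 [e2 [psi G]]] := ch z0 bz0; exists (z0, e1, e2, psi).
  by exists (0, 0, 0, fun=> 0) => z sz bz cz; case: no; exists z.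
(* One chart [D c] is chosen per coarse square [c]; [w] is the first coordinate in it. *)
exists (Q.+1 * Q.+1 * 3 * B * B)%N => ell ell0.
set h : R := ell%:R^-1; set S := [pred t | _].
have l0 : (0 : R) < ell%:R by rewrite ltr0n.
have h0 : 0 < h by rewrite invr_gt0.
have hl : ell%:R * h = 1 by rewrite mulfV// gt_eqF.
have /choice[Z HZ] : forall t : 'I_ell * 'I_ell, exists z, t \in S ->
    [/\ sq z, boundary Omega z & cell h t.1%:Z t.2%:Z z].
  move=> t; have [tS|tS] := boolP (t \in S); last by exists 0.
  have /asboolP sing : `[< singular Omega h t.1%:Z t.2%:Z >] by move: tS; rewrite inE.
  have [z [bz cz]] := singular_boundary cO sing; exists z => _; split => //.
  move/in_cellP: cz => [/andP[x1 x2] /andP[y1 y2]].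
  have le1 (m : 'I_ell) : 0 <= (m%:Z)%:~R * h /\ (m%:Z)%:~R * h + h <= 1.
    split; first by rewrite mulr_ge0 ?(ltW h0)// ler0z.
    by rewrite -intrSl -[leRHS]hl ler_pM2r// -PoszD addn1 -pmulrn ler_nat.
  have [u1 u2] := le1 t.1; have [v1 v2] := le1 t.2.
  by split; apply/andP; split; clear - x1 x2 y1 y2 u1 u2 v1 v2; lra.
pose w t := axis_coord (D (cidx (Z t))).1.1.2 (D (cidx (Z t))).1.1.1 (Z t).
pose phi (t : 'I_ell * 'I_ell) : 'I_Q.+1 * 'I_Q.+1 * 'I_(2 * ell).+1 * 'I_B * 'I_B :=
  (cidx (Z t), inord (Num.truncn ((w t + 1) * ell%:R)),
   inord (t.1 %% B), inord (t.2 %% B)).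
have phi_inj : {in S &, injective phi}.
  move=> t t' tS tS'; have [sz bz cz] := HZ t tS; have [sz' bz' cz'] := HZ t' tS'.
  rewrite /phi => -[ec0 ec1 ew ei ej].
  have ec : cidx (Z t) = cidx (Z t') by rewrite /cidx ec0 ec1.
  have [sz0 c0 G] := HD _ (Z t) sz bz erefl.
  move: G c0 sz0; rewrite /w -ec in ew; move: ew; set z0 := (D _).1.1.1; set e1 := (D _).1.1.2.
  set e2 := (D _).1.2 => ew G c0 sz0.
  have [on _ _] := G; have [se1 se2] := orthonormal2_small on.
  have [n1 n2] := cidx_close _ _ sz sz0 (esym c0).
  have [n1' n2'] := cidx_close _ _ sz' sz0 (etrans (esym ec) (esym c0)).
  have k e (z : R * R) : small_dir e -> `|z.1 - z0.1| <= Q%:R^-1 -> `|z.2 - z0.2| <= Q%:R^-1 ->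
      `|axis_coord e z0 z| <= 2 / Q%:R by exact: axis_coord_le.
  have kr e z se a b := le_lt_trans (k e z se a b) Qr.
  have w1 e z se a b := le_trans (k e z se a b) Q2.
  have wclose : `|axis_coord e1 z0 (Z t') - axis_coord e1 z0 (Z t)| <= h.
    have rng (x : R) : `|x| <= 1 -> 0 <= (x + 1) * ell%:R /\ (Num.truncn ((x + 1) * ell%:R) < (2 * ell).+1)%N.
      rewrite ler_norml => /andP[x1 x2].
      have p0 : 0 <= (x + 1) * ell%:R by rewrite mulr_ge0 ?(ltW l0)//; clear - x1; lra.
      split => //; rewrite truncn_lt_nat//.
      apply: (@le_lt_trans _ _ (2 * ell)%:R); last by rewrite ltr_nat.
      by rewrite natrM ler_pM2r//; clear - x2; lra.
    have [p1 q1] := rng _ (w1 _ _ se1 n1 n2); have [p2 q2] := rng _ (w1 _ _ se1 n1' n2').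
    move: ew => /(congr1 (@nat_of_ord _)); rewrite !inordK// => /esym/(truncn_eq_close p2 p1).
    rewrite -mulrBl normrM (gtr0_norm l0) -ler_pdivlMr// div1r.
    by apply: le_trans; rewrite le_eqVlt; apply/orP; left; apply/eqP; congr (`|_|); ring.
  have [d1 d2] := chart_boundary_lipschitz (ltW M0) G bz bz' (kr _ _ se1 n1 n2)
    (kr _ _ se2 n1 n2) (kr _ _ se1 n1' n2') (kr _ _ se2 n1' n2') wclose.
  have same (x x' : R) (m m' : 'I_ell) : (m%:Z)%:~R * h <= x < (m%:Z)%:~R * h + h ->
      (m'%:Z)%:~R * h <= x' < (m'%:Z)%:~R * h + h -> `|x' - x| <= (1 + M) * h ->
      inord (m %% B) = inord (m' %% B) :> 'I_B -> m = m'.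
    move=> /andP[x1 x2] /andP[x1' x2']; rewrite ler_norml => /andP[y1 y2] /(congr1 (@nat_of_ord _)).
    rewrite !inordK ?ltn_pmod// => emod.
    have lt (u v : nat) : (u%:R : R) * h < v%:R * h + B%:R * h -> (u < v + B)%N.
      by rewrite -mulrDl ltr_pM2r// -natrD ltr_nat.
    have BMh : (M + 2) * h < B%:R * h by rewrite ltr_pM2r.
    rewrite -!pmulrn in x1 x2 x1' x2'.
    have l1 : (m < m' + B)%N by apply: lt; clear - x1 x2 x1' x2' y1 y2 BMh; lra.
    have l2 : (m' < m + B)%N by apply: lt; clear - x1 x2 x1' x2' y1 y2 BMh; lra.
    apply: val_inj => /=; move: l1 l2; rewrite (divn_eq m B) (divn_eq m' B) emod.
    rewrite -!addnA ![((_ %% _) + B)%N]addnC !addnA !ltn_add2r -!mulSnr !ltn_mul2r /= !ltnS.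
    by move=> l1 l2; congr (_ * _ + _)%N; apply/eqP; rewrite eqn_leq l1.
  move/in_cellP: cz => [cx cy]; move/in_cellP: cz' => [cx' cy'].
  have m1 := same _ _ _ _ cx cx' d1 ei; have m2 := same _ _ _ _ cy cy' d2 ej.
  by rewrite [t]surjective_pairing m1 m2 -surjective_pairing.
rewrite -(card_in_image phi_inj); apply: (leq_trans (max_card _)).
rewrite !card_prod !card_ord.
have hl3 : ((2 * ell).+1 <= 3 * ell)%N by clear - ell0; lia.
apply: (@leq_trans (Q.+1 * Q.+1 * (3 * ell) * B * B)%N).
  by do 2!apply: leq_mul => //; apply: leq_mul.
by rewrite leq_eqVlt; apply/orP; left; apply/eqP; clear; ring.
Qed.

End Counting.

(** * The global error bound *)

Section GlobalError.
Context {R : realType}.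
Local Notation mR := (measurableTypeR R).
Local Notation plane := (mR * mR)%type.
Local Notation mu := (@lebesgue_measure2 R).
Implicit Types (h : R) (i j : int) (Omega : set plane).

Lemma cell_unique h i j i' j' (z : R * R) : 0 < h -> cell h i j z -> cell h i' j' z ->
  i = i' /\ j = j'.
Proof.
move=> h0 /in_cellP[x y] /in_cellP[x' y'].
have one (m m' : int) (t : R) : m%:~R * h <= t < m%:~R * h + h ->
    m'%:~R * h <= t < m'%:~R * h + h -> m <= m'.
  move=> /andP[t1 _] /andP[_ t2]; rewrite -ltzD1 -(@ltr_int R) -(ltr_pM2r h0) intrSl.
  exact: le_lt_trans t2.
by split; apply/eqP; rewrite eq_le ?(one _ _ _ x x') ?(one _ _ _ x' x) ?(one _ _ _ y y') ?(one _ _ _ y' y).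
Qed.

Section Mesh.
Variables (Omega : set plane) (ell : nat) (p : 'I_ell -> 'I_ell -> {poly R}).
Hypothesis ell0 : (0 < ell)%N.
Let h : R := ell%:R^-1.
Let a := cell_average (\1_Omega : R * R -> R) h.
Let h0 : 0 < h. Proof. by rewrite invr_gt0 ltr0n. Qed.

Lemma reconstruction_on_cell (i j : 'I_ell) (z : R * R) : cell h i%:Z j%:Z z ->
  reconstruction Omega p z =
    if `[< singular Omega h i%:Z j%:Z >] then recovery a i%:Z j%:Z (p i j) z
    else a i%:Z j%:Z.
Proof.
move=> cz; rewrite /reconstruction -/h -/a (bigD1 i)//= (bigD1 j)//=.
rewrite [X in _ + X]big1 ?addr0; last first.
  move=> i' ii'; apply: big1 => j' _; rewrite [X in _ * X]indicE memNset ?mulr0// => cz'.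
  have [e _] := cell_unique h0 cz cz'; move: e => [] e; move: ii'.
  by rewrite (_ : i' = i) ?eqxx//; apply: val_inj.
rewrite [X in _ + X]big1 ?addr0; last first.
  move=> j' jj'; rewrite [X in _ * X]indicE memNset ?mulr0// => cz'.
  have [_ e] := cell_unique h0 cz cz'; move: e => [] e; move: jj'.
  by rewrite (_ : j' = j) ?eqxx//; apply: val_inj.
by rewrite [X in _ * X]indicE mem_set// mulr1.
Qed.

Lemma reconstruction_off_cells (z : R * R) : (forall i j : 'I_ell, ~ cell h i%:Z j%:Z z) ->
  reconstruction Omega p z = 0.
Proof.
move=> nz; rewrite /reconstruction -/h; apply: big1 => i _; apply: big1 => j _.
by rewrite [X in _ * X]indicE memNset ?mulr0.
Qed.

Lemma unit_square_cell (z : R * R) : 0 <= z.1 < 1 -> 0 <= z.2 < 1 ->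
  exists i j : 'I_ell, cell h i%:Z j%:Z z.
Proof.
have l0 : (0 : R) < ell%:R by rewrite ltr0n.
have one (x : R) : 0 <= x < 1 -> exists i : 'I_ell, (i%:Z)%:~R * h <= x < (i%:Z)%:~R * h + h.
  move=> /andP[x0 x1].
  have p0 : 0 <= x * ell%:R by rewrite mulr_ge0// ltW.
  have lt : (Num.truncn (x * ell%:R) < ell)%N.
    by rewrite truncn_lt_nat// gtr_pMl.
  exists (Ordinal lt) => /=; have /andP[t1 t2] := truncn_itv p0.
  rewrite -pmulrn; set t := Num.truncn _ in t1 t2 *.
  rewrite -[X in _ + X]mul1r -mulrDl natr1 /h.
  by rewrite ler_pdivrMr// ltr_pdivlMr// t1.
by move=> /one[i hi] /one[j hj]; exists i, j; apply/in_cellP.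
Qed.

(** The reconstruction error is the indicator of a union of error sets in the
    cells, up to a null set; regular cells contribute nothing. *)
Lemma global_error (c : R) (n : nat) : measurable Omega -> 0 <= c ->
  (forall i j : 'I_ell, singular Omega h i%:Z j%:Z ->
     (L1_norm (cell h i%:Z j%:Z) (fun z => \1_Omega z - recovery a i%:Z j%:Z (p i j) z)%R
       <= c%:E)%E) ->
  (#|[pred t : 'I_ell * 'I_ell | `[< singular Omega h t.1%:Z t.2%:Z >]]| <= n)%N ->
  (L1_norm unit_square (fun z => \1_Omega z - reconstruction Omega p z)%R
     <= (n%:R * c)%:E)%E.
Proof.
move=> mO c0 Hc Hn.
pose sg (t : 'I_ell * 'I_ell) := `[< singular Omega h t.1%:Z t.2%:Z >].
pose v t (z : R * R) : R := if sg t then recovery a t.1%:Z t.2%:Z (p t.1 t.2) z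
  else a t.1%:Z t.2%:Z.
pose Y (t : 'I_ell * 'I_ell) : set plane :=
  cell h t.1%:Z t.2%:Z `&` [set z | \1_Omega z != v t z].
have mc (t : 'I_ell * 'I_ell) : measurable (cell h t.1%:Z t.2%:Z : set plane) by exact: measurable_cell.
have reg t : ~~ sg t ->
    (a t.1%:Z t.2%:Z = 0 /\ mu (cell h t.1%:Z t.2%:Z `&` Omega) = 0%E /\
       Y t = cell h t.1%:Z t.2%:Z `&` Omega) \/
    (a t.1%:Z t.2%:Z = 1 /\ mu (cell h t.1%:Z t.2%:Z `&` ~` Omega) = 0%E /\
       Y t = cell h t.1%:Z t.2%:Z `&` ~` Omega).
  move=> nsg; have vE z : v t z = a t.1%:Z t.2%:Z by rewrite /v (negbTE nsg).
  have h2 : h ^+ 2 != 0 by rewrite expf_neq0 ?gt_eqF.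
  have [m0|m0] := pselect (mu (cell h t.1%:Z t.2%:Z `&` Omega) = 0%E).
    left; have a0 : a t.1%:Z t.2%:Z = 0.
      have := @cell_average_indic R h Omega t.1%:Z t.2%:Z h0 mO; rewrite m0 => -[/esym/eqP].
      by rewrite mulf_eq0 (negbTE h2) => /eqP.
    split => //; split => //; apply/seteqP; split => z [cz] /= Hz; split => //.
      by apply: contrapT => nO; move: Hz; rewrite vE a0 indicE memNset// eqxx.
    by rewrite /= vE a0 indicE mem_set// oner_neq0.
  have m1 : mu (cell h t.1%:Z t.2%:Z `&` ~` Omega) = 0%E.
    by apply: contrapT => m1; move/negP: nsg; apply; apply/asboolP.
  right; have a1 : a t.1%:Z t.2%:Z = 1.
    have := @cell_average_sub1 R h Omega t.1%:Z t.2%:Z h0 mO; rewrite setDE m1 => /eqP.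
    by rewrite mulf_eq0 (negbTE h2) subr_eq0 => /eqP.
  split => //; split => //; apply/seteqP; split => z [cz] /= Hz; split => //.
    by move=> Oz; move: Hz; rewrite vE a1 indicE mem_set// eqxx.
  by rewrite /= vE a1 indicE memNset// eq_sym oner_neq0.
have mYs t : measurable (Y t) /\ (mu (Y t) <= if sg t then c%:E else 0%E)%E.
  have [st|nst] := boolP (sg t).
    have vE : v t = recovery a t.1%:Z t.2%:Z (p t.1 t.2) by apply/funext => z; rewrite /v st.
    have [m1 m2] := L1_norm_recovery_eq a t.1%:Z t.2%:Z (p t.1 t.2) mO (mc t).
    rewrite /Y vE; split => //; rewrite m2; apply: Hc; exact/asboolP.
  have [[_ [m0 ->]]|[_ [m0 ->]]] := reg t nst; rewrite m0; split => //; apply: measurableI => //.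
  exact: measurableC.
pose U : set plane := \big[setU/set0]_(t : 'I_ell * 'I_ell) Y t.
have UP z : U z <-> exists t, Y t z.
  rewrite /U -bigcup_seq; split => [[t _ Yt]|[t Yt]]; exists t => //=.
  by rewrite mem_index_enum.
have mU : measurable U by apply: bigsetU_measurable => t _; case: (mYs t).
have muU : (mu U <= (n%:R * c)%:E)%E.
  apply: (@le_trans _ _ (\sum_(t : 'I_ell * 'I_ell) mu (Y t))%E).
    rewrite /U; elim: (index_enum _) => [|t s IHs]; first by rewrite !big_nil measure0.
    rewrite !big_cons; apply: (le_trans (measureU2 _ _ _)).
    - by case: (mYs t).
    - by apply: bigsetU_measurable => u _; case: (mYs u).
    - exact: leeD2l.
  apply: (@le_trans _ _ (\sum_(t : 'I_ell * 'I_ell) (if sg t then c%:E else 0%E))%E).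
    by apply: lee_sum => t _; case: (mYs t).
  rewrite -big_mkcond /= sumEFin lee_fin sumr_const -[c *+ _]mulr_natl ler_wpM2r// ler_nat.
  by rewrite (leq_trans _ Hn)// subset_leq_card//; apply/subsetP => t.
(* The cells are half-open and miss the right and upper sides of the square. *)
pose N : set plane := unit_square `&` ([set z | z.1 = 1] `|` [set z | z.2 = 1]).
have mD : measurable (@unit_square R : set plane) by apply: measurableX; exact: measurable_itv.
have m1 : measurable ([set z | z.1 = 1] : set plane).
  have -> : [set z : plane | z.1 = 1] = [set (1 : R)] `*` setT by apply/seteqP; split => z // [].
  exact: measurableX.
have m2 : measurable ([set z | z.2 = 1] : set plane).
  have -> : [set z : plane | z.2 = 1] = setT `*` [set (1 : R)] by apply/seteqP; split => z // [].
  exact: measurableX.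
have mN : measurable N by apply: measurableI => //; exact: measurableU.
have N0 : mu (N `&` Omega) = 0%E.
  have z1 : mu [set z | z.1 = 1] = 0%E.
    have -> : [set z : plane | z.1 = 1] = [set (1 : R)] `*` setT by apply/seteqP; split => z // [].
    by rewrite lebesgue2X// lebesgue_measure_set1 mul0e.
  have z2 : mu [set z | z.2 = 1] = 0%E.
    have -> : [set z : plane | z.2 = 1] = setT `*` [set (1 : R)] by apply/seteqP; split => z // [].
    by rewrite lebesgue2X// lebesgue_measure_set1 mule0.
  have z12 : mu ([set z | z.1 = 1] `|` [set z | z.2 = 1]) = 0%E by rewrite measureU0.
  apply: (@subset_measure0 _ _ _ mu _ ([set z | z.1 = 1] `|` [set z | z.2 = 1])).
  - exact: measurableI.
  - exact: measurableU.
  - by move=> z [[]].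
  - exact: z12.
have mNO : measurable (N `&` Omega) by exact: measurableI.
have mW : measurable (U `|` N `&` Omega) by exact: measurableU.
have v01 t z : v t z = 0 \/ v t z = 1.
  have [st|nst] := boolP (sg t).
    by rewrite /v st /recovery indicE; case: (_ \in _); [right|left].
  by rewrite /v (negbTE nst); have [[-> _]|[-> _]] := reg t nst; [left|right].
rewrite /L1_norm (eq_integral (fun z => (\1_(U `|` N `&` Omega) z)%:E)); last first.
  move=> z /set_mem Dz; rewrite abse_EFin; congr EFin.
  move: (Dz) => [/=]; rewrite !in_itv/= => /andP[z10 z11] /andP[z20 z21].
  have [[i [j cz]]|nc] := pselect (exists i j : 'I_ell, cell h i%:Z j%:Z z).
    have -> : reconstruction Omega p z = v (i, j) z by rewrite (reconstruction_on_cell cz).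
    have NP : ~ N z.
      move=> [_ nz]; move/in_cellP: cz => [/andP[_ c1] /andP[_ c2]].
      have lt1 (m : 'I_ell) : (m%:Z)%:~R * h + h <= 1.
        have hl : ell%:R * h = 1 by rewrite mulfV// pnatr_eq0 -lt0n.
        by rewrite -intrSl -[leRHS]hl ler_pM2r// -PoszD addn1 -pmulrn ler_nat.
      have k1 := lt_le_trans c1 (lt1 i); have k2 := lt_le_trans c2 (lt1 j).
      by case: nz => /= e; rewrite e ltxx in k1 k2.
    have [e|ne] := eqVneq (\1_Omega z : R) (v (i, j) z).
      rewrite e subrr normr0 indicE memNset// => -[/UP[t [ct /= nt]]|[]//].
      have [e1 e2] := cell_unique h0 cz ct; move: nt.
      rewrite (_ : t = (i, j)) ?e ?eqxx//.
      rewrite [t]surjective_pairing; congr (_, _); apply: val_inj => /=.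
        by case: e1 => ->.
      by case: e2 => ->.
    rewrite [RHS]indicE mem_set/=; last by left; apply/UP; exists (i, j); split.
    move: ne; have [->|->] := v01 (i, j) z; rewrite indicE; case: (_ \in _);
      by rewrite /= ?eqxx// ?subr0 ?sub0r ?normrN ?normr1.
  rewrite reconstruction_off_cells ?subr0; last by move=> i j cz; apply: nc; exists i, j.
  rewrite ger0_norm ?indicE//; congr (_%:R); congr nat_of_bool.
  have Nz : N z.
    split => //; apply: contrapT => nz; apply: nc; apply: unit_square_cell.
      by rewrite z10 lt_neqAle z11 andbT; apply/eqP => e; apply: nz; left.
    by rewrite z20 lt_neqAle z21 andbT; apply/eqP => e; apply: nz; right.
  apply/idP/idP => /set_mem hz; apply/mem_set; first by right.
  case: hz => [/UP[t [ct _]]|[_ //]]; exfalso; apply: nc.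
  by exists t.1, t.2.
rewrite integral_indic//; apply: (@le_trans _ _ (mu (U `|` N `&` Omega))).
  by apply: le_measure; rewrite ?inE//; exact: measurableI.
by rewrite measureU0.
Qed.

End Mesh.

(** The local bound on all meshes: on coarse meshes, and for Lipschitz domains,
    the area of the cell is already of the right order. *)
Lemma aeros_local_error_all k s Omega : 1 <= s -> (0 < k)%N ->
  Cs_domain s (Omega : set (R * R)) ->
  let r := Num.min s (2 * k + 1)%:R in
  exists C : R, 0 < C /\ forall h i j, 0 < h -> h <= 1 ->
    singular Omega h i j -> forall p, aeros_output k h (cell_average \1_Omega h) i j p ->
    (L1_norm (cell h i j) (fun z => \1_Omega z - recovery (cell_average \1_Omega h) i j p z)%R
      <= (C * h `^ (r + 1))%:E)%E.
Proof.
move=> s1 k0 Cs r.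
have mO : measurable Omega.
  exact: (closed_measurable_plane (Cs_domain_closed s1 Cs)).
have powE h : 0 < h -> h `^ (r + 1) = h ^+ 2 * h `^ (r - 1).
  move=> hp; have -> : r + 1 = 2 + (r - 1) by ring.
  by rewrite powRD ?powR_mulrn ?(ltW hp)//; apply/implyP => _; rewrite gt_eqF.
have [s1'|] := ltP 1 s; last first.
  move=> s1'; exists 1; split => // h i j hp h1 _ p _.
  apply: (le_trans (L1_norm_recovery_cell _ _ _ _ (ltW hp) mO)).
  have -> : r = 1.
    have se : s = 1 by apply/eqP; rewrite eq_le s1 s1'.
    by rewrite /r se; apply/min_idPl; rewrite ler1n addn1.
  by rewrite mul1r lee_fin (_ : 1 + 1 = 2%:R)// powR_mulrn// ltW.
have [h0 [C1 [h00 C10 H]]] := aeros_local_error s1' k0 Cs.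
have r1 : 0 <= r - 1 by rewrite subr_ge0 le_min s1/= ler1n addn1.
have P0 : 0 < h0 `^ (r - 1) by exact: powR_gt0.
exists (C1 + (h0 `^ (r - 1))^-1); split; first by rewrite ltr_wpDl// invr_gt0.
move=> h i j hp h1 sing p out.
have Ph : 0 <= h `^ (r + 1) by exact: powR_ge0.
have [hh0|hh0] := leP h h0.
  apply: (le_trans (H h i j hp hh0 sing p out)); rewrite lee_fin ler_wpM2r//.
  by rewrite lerDl invr_ge0 ltW.
apply: (le_trans (L1_norm_recovery_cell _ _ _ _ (ltW hp) mO)).
rewrite lee_fin (@le_trans _ _ ((h0 `^ (r - 1))^-1 * h `^ (r + 1)))//; last first.
  by rewrite ler_wpM2r// lerDr.
rewrite powE// mulrCA ler_peMr ?exprn_ge0 ?(ltW hp)//.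
by rewrite ler_pdivlMl// mulr1 ge0_ler_powR ?nnegrE ?(ltW hp) ?(ltW h00) ?(ltW hh0).
Qed.

End GlobalError.

Unset Implicit Arguments.

Theorem theorem4p3 (R : realType) (k : nat) (s : R) (Omega : set (R * R))
    (hk : (1 <= k)%N) (hs : 1 <= s)
    (hD : Omega `<=` unit_square) (hOmega : Cs_domain s Omega) :
  let r := Num.min s (2 * k + 1)%:R in
  exists C : R, 0 < C /\
    forall ell : nat, (1 < ell)%N ->
    let h : R := ell%:R^-1 in
    let u : R * R -> R := \1_Omega in
    let a := cell_average u h in
    forall p : 'I_ell -> 'I_ell -> {poly R},
    (forall i j : 'I_ell, singular Omega h i%:Z j%:Z ->
       aeros_output k h a i%:Z j%:Z (p i j)) ->
    (forall i j : 'I_ell, singular Omega h i%:Z j%:Z ->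
       (L1_norm (cell h i%:Z j%:Z)
          (fun z => u z - recovery a i%:Z j%:Z (p i j) z)%R
        <= (C * h `^ (r + 1))%:E)%E) /\
    (L1_norm unit_square (fun z => u z - reconstruction Omega p z)%R
     <= (C * h `^ r)%:E)%E.
Proof.
move=> r.
have mO := closed_measurable_plane (Cs_domain_closed hs hOmega).
have [C [C0 HC]] := @aeros_local_error_all R k s Omega hs hk hOmega.
have [N HN] := singular_count hs hOmega.
exists (C * (N%:R + 1)); split; first by rewrite mulr_gt0// ltr_wpDl.
move=> ell ell1 h u a p out.
have l0 : (0 : R) < ell%:R by rewrite ltr0n ltnW.
have h0 : 0 < h by rewrite invr_gt0.
have h1 : h <= 1 by rewrite invf_le1// ler1n ltnW.
have loc (i j : 'I_ell) : singular Omega h i%:Z j%:Z ->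
    (L1_norm (cell h i%:Z j%:Z) (fun z => u z - recovery a i%:Z j%:Z (p i j) z)%R
      <= (C * h `^ (r + 1))%:E)%E.
  by move=> sij; exact: (HC h _ _ h0 h1 sij _ (out i j sij)).
split.
  move=> i j sij; apply: (le_trans (loc i j sij)).
  by rewrite lee_fin ler_wpM2r ?powR_ge0// ler_pMr// lerDr.
have c0 : 0 <= C * h `^ (r + 1) by rewrite mulr_ge0 ?powR_ge0// ltW.
apply: (le_trans (global_error (ltnW ell1) mO c0 loc (HN ell (ltnW ell1)))).
rewrite lee_fin powRD ?powRr1 ?(ltW h0)//; last first.
  by apply/implyP => _; rewrite gt_eqF.
have -> : (N * ell)%:R * (C * (h `^ r * h)) = C * N%:R * h `^ r * (ell%:R * h).
  by rewrite natrM; ring.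
have -> : ell%:R * h = 1 by rewrite mulfV// gt_eqF.
by rewrite mulr1 ler_wpM2r ?powR_ge0// ler_pM2l// lerDl.
Qed.
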